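(* Let $T_n^{(p)}$, $T_n^{(p,q)}$ and $B_n^{(p,r)}$ be the numbers defined in the context. Then for all $r\geq 1$, $p\geq 1$ and $n\geq 1$, $$B_n^{(p,r)}=B_n^{(\max(p-1,1),\,r-1)}+\sum_{k=0}^{n-1}B_k^{(1,r-1)}\,B_{n-k}^{(p,1)},$$ and for all $p\geq 1$, $q\geq 1$ and $n\geq 1$, $$T_n^{(p,q)}=\sum_{r=1}^{2n-q}\ \sum_{k=0}^{n-\lfloor\frac{r+q}{2}\rfloor+1}B_k^{(p,r)}\,T_{n-k}^{(r+q-2)}$$ (where empty sums are zero).
   Context: A planar map is a finite connected graph (loops and multiple edges allowed) properly embedded in the two-dimensional sphere, considered up to continuous (orientation-preserving) deformation. It is rooted if an oriented edge is distinguished. The degree of a face is the number of sides of its underlying polygon (an edge with the same face on both sides is counted twice). $T_n^{(p)}$: for $p\geq 1$, the number of rooted planar maps with $n$ vertices in which the face to the right of the root edge (the boundary, or external face, not necessarily simple) has degree $p$ and all other faces have degree $3$. By convention $T_1^{(0)}=1$ (the single-vertex map), $T_n^{(0)}=0$ for $n\geq 2$, and $T_0^{(p)}=0$ for all $p\geq 0$. $T_n^{(p,q)}$ ($p,q\geq 1$): the number of rooted planar maps with $n$ vertices in which the face to the right of the root edge has degree $p$, together with a distinguished face, different from the external face, of degree $q$ (carrying no root of its own), all other faces having degree $3$. $B_n^{(p,r)}$ for $r\geq 1$, $p\geq 1$, $n\geq 0$: the number of finite rooted plane trees with nonnegative integer labels on the vertices, with one distinguished leaf, such that: the root has label $p$;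 the distinguished leaf has label $r$; there are exactly $n$ other leaves, all with label $0$; every non-leaf vertex has a label $\ell\geq 1$ and has either exactly one child, with label $\ell+1$, or exactly two (ordered) children, with labels $\ell_1,\ell_2\geq 0$ satisfying $\ell_1+\ell_2+2=\ell$. (In particular $B_0^{(p,r)}$ equals $1$ if $r\geq p$ and $0$ otherwise.) For $r=0$ and $p\geq 1$: $B_n^{(p,0)}=(n+1)\,T_{n+1}^{(p)}$ if $n\geq 1$, and $B_0^{(p,0)}=0$. *)

(* Defs.v *)
From HB Require Import structures.
From mathcomp Require Import all_boot all_fingroup finmap.
From mathcomp Require Import boolp classical_sets functions cardinality.
From mathcomp Require Import zify.

Set Implicit Arguments.
Unset Strict Implicit.
Unset Printing Implicit Defensive.

(** A planar map with [e >= 1] edges is encoded, as usual, by two permutations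
    of its [2e] darts (oriented edges): [reverse] sends a dart to the opposite
    dart, and [rotate] sends a dart to the next one in counterclockwise order
    around its origin.  Following a dart and then taking the next one
    counterclockwise walks along the boundary of the face on its right. *)
Record rooted_map (e : nat) := RootedMap {
  rotate : {perm 'I_(e.*2)};
  reverse : {perm 'I_(e.*2)};
  root : 'I_(e.*2) }.

Definition rooted_map_code e (M : rooted_map e) := (rotate M, reverse M, root M).
Definition rooted_map_decode e (u : {perm 'I_(e.*2)} * {perm 'I_(e.*2)} * 'I_(e.*2)) :=
  RootedMap u.1.1 u.1.2 u.2.
Lemma rooted_map_codeK e : cancel (@rooted_map_code e) (@rooted_map_decode e).
Proof. by case. Qed.

HB.instance Definition _ e :=
  Countable.copy (rooted_map e) (can_type (@rooted_map_codeK e)).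
HB.instance Definition _ e : isFinite (rooted_map e) :=
  CanIsFinite (@rooted_map_codeK e).

Section Maps.
Local Open Scope set_scope.
Variable e : nat.
Implicit Type M : rooted_map e.

(** [(s * t)%g x = t (s x)] for permutations. *)
Definition right_walk M : {perm 'I_(e.*2)} := (reverse M * rotate M)%g.

Definition vertices M : {set {set 'I_(e.*2)}} := porbits (rotate M).
Definition faces M : {set {set 'I_(e.*2)}} := porbits (right_walk M).

(** The cardinal of a face, seen as the set of darts having it on their right,
    is its degree. *)
Definition root_face M : {set 'I_(e.*2)} := porbit (right_walk M) (root M).

Definition is_connected M : bool :=
  [forall x, forall y,
     connect (fun u v => (v == rotate M u) || (v == reverse M u)) x y].

(** A connected graph properly embedded in an orientable surface is on the
    sphere if and only if its Euler characteristic is 2. *)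
Definition is_planar_map M : bool :=
  [&& [forall x, reverse M x != x], [forall x, reverse M (reverse M x) == x],
      is_connected M & #|vertices M| + #|faces M| == e + 2].

Definition is_triangulation (n p : nat) M : bool :=
  [&& is_planar_map M, #|vertices M| == n, #|root_face M| == p &
      [forall F in faces M, (F != root_face M) ==> (#|F| == 3)]].

Definition is_triangulation2 (n p q : nat) (MF : rooted_map e * {set 'I_(e.*2)}) : bool :=
  let: (M, F0) := MF in
  [&& is_planar_map M, #|vertices M| == n, #|root_face M| == p,
      [&& F0 \in faces M, F0 != root_face M & #|F0| == q] &
      [forall F in faces M, (F != root_face M) && (F != F0) ==> (#|F| == 3)]].

Definition map_iso M N : bool :=
  [exists h : {perm 'I_(e.*2)},
    [&& rotate N == (rotate M ^ h)%g, reverse N == (reverse M ^ h)%g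
      & root N == h (root M)]].

Definition map_iso2 (MF NG : rooted_map e * {set 'I_(e.*2)}) : bool :=
  [exists h : {perm 'I_(e.*2)},
    [&& rotate NG.1 == (rotate MF.1 ^ h)%g, reverse NG.1 == (reverse MF.1 ^ h)%g,
        root NG.1 == h (root MF.1) & NG.2 == h @: MF.2]].

Lemma map_iso_equiv : equivalence_rel map_iso.
Proof.
have refl : reflexive map_iso.
  by move=> M; apply/existsP; exists 1%g; rewrite !conjg1 perm1 !eqxx.
have sym : symmetric map_iso.
  suff imp M N : map_iso M N -> map_iso N M by move=> M N; apply/idP/idP; apply: imp.
  case/existsP=> h /and3P[/eqP r1 /eqP r2 /eqP r3].
  by apply/existsP; exists h^-1%g; rewrite r1 r2 r3 !conjgK permK !eqxx.
apply/equivalence_relP; split=> // M N MN P.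
have trans : transitive map_iso.
  move=> Y X Z /existsP[h /and3P[/eqP r1 /eqP r2 /eqP r3]].
  case/existsP=> g /and3P[/eqP s1 /eqP s2 /eqP s3].
  apply/existsP; exists (h * g)%g.
  by rewrite s1 s2 s3 r1 r2 r3 !conjgM permM !eqxx.
by apply/idP/idP; apply: trans; rewrite // sym.
Qed.

Lemma map_iso2_equiv : equivalence_rel map_iso2.
Proof.
have refl : reflexive map_iso2.
  move=> U; apply/existsP; exists 1%g; rewrite !conjg1 perm1 !eqxx /=.
  by apply/eqP/setP=> x; apply/idP/imsetP => [xU|[y yU ->]]; rewrite ?perm1 //; exists x; rewrite ?perm1.
have sym : symmetric map_iso2.
  suff imp U V : map_iso2 U V -> map_iso2 V U by move=> U V; apply/idP/idP; apply: imp.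
  case/existsP=> h /and4P[/eqP r1 /eqP r2 /eqP r3 /eqP r4].
  apply/existsP; exists h^-1%g; rewrite r1 r2 r3 r4 !conjgK permK !eqxx /=.
  rewrite -imset_comp; apply/eqP/setP=> x.
  apply/idP/imsetP => [xU|[y yU ->]]; last by rewrite /= permK.
  by exists x; rewrite //= permK.
apply/equivalence_relP; split=> // U V UV P.
have trans : transitive map_iso2.
  move=> Y X Z /existsP[h /and4P[/eqP r1 /eqP r2 /eqP r3 /eqP r4]].
  case/existsP=> g /and4P[/eqP s1 /eqP s2 /eqP s3 /eqP s4].
  apply/existsP; exists (h * g)%g.
  rewrite s1 s2 s3 s4 r1 r2 r3 r4 !conjgM permM !eqxx /= -imset_comp.
  by apply/eqP; apply: eq_imset => x; rewrite /= permM.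
by apply/idP/idP; apply: trans; rewrite // sym.
Qed.

Lemma sum_face_degrees M : \sum_(F in faces M) #|F| = e.*2.
Proof.
have -> : faces M = preim_partition (porbit (right_walk M)) [set: 'I_(e.*2)].
  apply/setP=> F; apply/imsetP/imsetP => -[x _ ->]; exists x; rewrite ?inE //.
    by apply/setP=> y; rewrite !inE eq_porbit_mem porbit_sym.
  by apply/setP=> y; rewrite !inE eq_porbit_mem porbit_sym.
by rewrite -(card_partition (preim_partitionP _ _)) cardsT card_ord.
Qed.

(** Euler's formula determines the number of edges. *)
Lemma triangulation_edges n p M : is_triangulation n p M -> e + p + 3 = 3 * n.
Proof.
case/and4P=> /and4P[_ _ _ /eqP euler] /eqP vn /eqP rp /forall_inP deg3.
have r_in : root_face M \in faces M by apply: imset_f.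
have := sum_face_degrees M; rewrite (big_setD1 _ r_in) /= rp.
rewrite (eq_bigr (fun=> 3)); last first.
  by move=> F /setD1P[Fr Ff]; apply/eqP; apply: (implyP (deg3 F Ff)).
rewrite sum_nat_const => sum2e; move: euler sum2e.
rewrite vn (cardsD1 (root_face M) (faces M)) r_in /=.
by lia.
Qed.

Lemma triangulation2_edges n p q MF : is_triangulation2 n p q MF -> e + p + q = 3 * n.
Proof.
case: MF => M F0 /and5P[/and4P[_ _ _ /eqP euler] /eqP vn /eqP rp].
case/and3P=> F0f F0r /eqP F0q /forall_inP deg3.
have r_in : root_face M \in faces M by apply: imset_f.
have F0_in : F0 \in faces M :\ root_face M by rewrite in_setD1 F0r.
have := sum_face_degrees M; rewrite (big_setD1 _ r_in) (big_setD1 _ F0_in) /= rp F0q.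
rewrite (eq_bigr (fun=> 3)); last first.
  move=> F /setD1P[FF0 /setD1P[Fr Ff]].
  by apply/eqP/(implyP (deg3 F Ff)); rewrite Fr FF0.
rewrite sum_nat_const => sum2e; move: euler sum2e.
rewrite vn (cardsD1 (root_face M) (faces M)) r_in (cardsD1 F0 (_ :\ _)) F0_in /=.
by move: #|_ :\ F0| => k; lia.
Qed.

End Maps.

(** The bound [e < 3 * n] loses no map, by [triangulation_edges] and
    [triangulation2_edges].  Maps without edges only occur for [p = 0]. *)
Definition T (n p : nat) : nat :=
  if p == 0 then (n == 1 : nat)
  else \sum_(e < 3 * n)
         #|equivalence_partition (@map_iso e) [set M | is_triangulation n p M]%SET|.

Definition T2 (n p q : nat) : nat :=
  \sum_(e < 3 * n)
     #|equivalence_partition (@map_iso2 e) [set MF | is_triangulation2 n p q MF]%SET|.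

(** Plane trees of arity at most two with labelled vertices; the boolean carried
    by a leaf tells whether that leaf is distinguished. *)
Inductive ltree :=
| Leaf of bool & nat
| Node1 of nat & ltree
| Node2 of nat & ltree & ltree.

Fixpoint ltree_code (t : ltree) : GenTree.tree (bool * nat) :=
  match t with
  | Leaf b l => GenTree.Leaf (b, l)
  | Node1 l t1 => GenTree.Node l [:: ltree_code t1]
  | Node2 l t1 t2 => GenTree.Node l [:: ltree_code t1; ltree_code t2]
  end.
Fixpoint ltree_decode (u : GenTree.tree (bool * nat)) : option ltree :=
  match u with
  | GenTree.Leaf (b, l) => Some (Leaf b l)
  | GenTree.Node l [:: u1] => omap (Node1 l) (ltree_decode u1)
  | GenTree.Node l [:: u1; u2] =>
      obind (fun t1 => omap (Node2 l t1) (ltree_decode u2)) (ltree_decode u1)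
  | _ => None
  end.
Lemma ltree_codeK : pcancel ltree_code ltree_decode.
Proof. by elim=> //= [l t1 -> | l t1 -> t2 ->]. Qed.

HB.instance Definition _ := Countable.copy ltree (pcan_type ltree_codeK).

Definition label (t : ltree) : nat :=
  match t with Leaf _ l => l | Node1 l _ => l | Node2 l _ _ => l end.

Fixpoint leaves (t : ltree) : seq (bool * nat) :=
  match t with
  | Leaf b l => [:: (b, l)]
  | Node1 _ t1 => leaves t1
  | Node2 _ t1 t2 => leaves t1 ++ leaves t2
  end.

Fixpoint label_rule (t : ltree) : bool :=
  match t with
  | Leaf _ _ => true
  | Node1 l t1 => [&& 1 <= l, label t1 == l + 1 & label_rule t1]
  | Node2 l t1 t2 =>
      [&& 1 <= l, label t1 + label t2 + 2 == l, label_rule t1 & label_rule t2]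
  end.

Definition is_peeling_tree (n p r : nat) (t : ltree) : bool :=
  [&& label_rule t, label t == p
    & perm_eq (leaves t) ((true, r) :: nseq n (false, 0))].

Definition ltrees_step (b : nat) (s : seq ltree) : seq ltree :=
  [seq Leaf c l | c <- [:: true; false], l <- iota 0 b.+1] ++
  [seq Node1 l t1 | l <- iota 0 b.+1, t1 <- s] ++
  [seq Node2 l t.1 t.2 | l <- iota 0 b.+1, t <- [seq (t1, t2) | t1 <- s, t2 <- s]].

Definition ltrees_upto (b h : nat) : seq ltree := iter h (ltrees_step b) [::].

Fixpoint inner_size (t : ltree) : nat :=
  match t with
  | Leaf _ _ => 0
  | Node1 _ t1 => (inner_size t1).+1
  | Node2 _ t1 t2 => (inner_size t1 + inner_size t2).+1
  end.

Definition leaf_weight (t : ltree) := \sum_(x <- leaves t) (x.2 + 3).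

Lemma label_rule_bound t :
  label_rule t -> label t + inner_size t + 3 <= leaf_weight t.
Proof.
rewrite /leaf_weight; elim: t => [b l|l t1 IH|l t1 IH1 t2 IH2] /=.
- by rewrite big_seq1 /=; lia.
- by case/and3P=> _ /eqP e1 /IH; lia.
- case/and4P=> _ /eqP e1 /IH1 h1 /IH2 h2; rewrite big_cat /=; lia.
Qed.

Lemma mem_ltrees_upto b h t : label_rule t -> leaf_weight t <= b ->
  inner_size t < h -> t \in ltrees_upto b h.
Proof.
have mem_cat3 (x : ltree) s1 s2 s3 :
    (x \in s1 ++ s2 ++ s3) = [|| x \in s1, x \in s2 | x \in s3] by rewrite !mem_cat.
elim: h t => // h IH t rt wt ht; have := label_rule_bound rt.
have lab : forall l, l <= b -> l \in iota 0 b.+1 by move=> l lb; rewrite mem_iota; lia.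
case: t rt wt ht => [c l|l t1|l t1 t2] rt wt ht bt; rewrite /ltrees_upto iterS /ltrees_step mem_cat3.
- apply/orP; left; apply/allpairsPdep; exists c, l; split=> //; first by case: (c).
  by apply: lab; move: bt => /=; lia.
- apply/orP; right; apply/orP; left; apply/allpairsPdep; exists l, t1; split=> //=.
    by apply: lab; move: bt => /=; lia.
  by move: rt => /= /and3P[_ _ rt]; apply: IH => //; move: ht => /=; lia.
- apply/orP; right; apply/orP; right; apply/allpairsPdep; exists l, (t1, t2); split=> //=.
    by apply: lab; move: bt => /=; lia.
  move: rt wt ht => /= /and4P[_ _ rt1 rt2]; rewrite /leaf_weight /= big_cat /= => wt ht.
  by apply/allpairsPdep; exists t1, t2; split=> //=; apply: IH => //; rewrite /leaf_weight; lia.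
Qed.

Lemma finite_peeling_trees n p r :
  finite_set [set t | is_peeling_tree n p r t]%classic.
Proof.
pose b := r + 3 + n * 3.
apply: (@sub_finite_set _ _ [set` ltrees_upto b b.+1]%classic); last exact: finite_seq.
move=> t /= /and3P[rt _ lt].
have wt : leaf_weight t = b.
  by rewrite /leaf_weight (perm_big _ lt) /= big_cons big_nseq iter_addn_0 /= add0n mulnC.
change (is_true (t \in ltrees_upto b b.+1)); apply: mem_ltrees_upto; rewrite ?wt //.
by have := label_rule_bound rt; rewrite wt; lia.
Qed.

(** [fset_set A] is the finite set [A] when [A] is finite, which is the case here
    by [finite_peeling_trees]. *)
Definition B (n p r : nat) : nat :=
  if r == 0 then (if n == 0 then 0 else n.+1 * T n.+1 p)
  else #|` fset_set [set t | is_peeling_tree n p r t]%classic |.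

(* Main.v *)
(** Peeling the root edge of a map either reveals the face on its other side or, when that side is
    the external face too, splits the map in two.  Iterating this encodes maps by binary trees:
    planarity enters through Euler's formula, which forces the two pieces to be disconnected, and
    rooted maps being rigid, isomorphism classes of maps correspond to trees.  Hence [T] and [T2]
    satisfy the recurrences of the tree counts [B], and the path to the distinguished leaf (or to
    the marked face) behaves like a walk on labels.  Cutting this walk at its last visit to 1 gives
    the first identity; stopping it when the marked face is revealed gives the second. *)
From HB Require Import structures.
From mathcomp Require Import classical_sets cardinality.
From mathcomp Require Import all_boot all_fingroup finmap.
From mathcomp Require Import zify.
Require Import Defs.

Set Implicit Arguments.
Unset Strict Implicit.
Unset Printing Implicit Defensive.

(** * Permutations, components and Euler inequality *)

(** Neither identity is proved by an explicit bijection between its two sides. Both sides solve one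
    linear recurrence, [peel], with the same source term, and [peel_unique] shows that values at
    boundary 0 and vanishing at large boundary determine the solution. The label of a tree is the
    boundary length and a leaf of label 0 is a vertex: revealing a triangle turns [p] into [p + 1],
    a split shares [p - 2] sides between two pieces. The convention for [r = 0] fits because [T]
    satisfies a quadratic recurrence whose derivative is [peel]: marking a vertex amounts to
    distinguishing a leaf of label 0. On the side of maps, peeling produces pieces with fewer darts,
    half-edges and several components. To keep one type of darts throughout, all statements concern
    arbitrary permutations of a fixed finite type, seen from the component of a root, and Euler's
    formula is used in the form of a genus inequality valid for any number of components. *)

Section Linked.
Variable D : finType.
Implicit Types (s t i : {perm D}) (x y z : D).

Definition linked s t : rel D := connect (fun u v => (v == s u) || (v == t u)).

Lemma linked_refl s t x : linked s t x x.
Proof. exact: connect0. Qed.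

Lemma linked_trans s t : transitive (linked s t).
Proof. exact: connect_trans. Qed.

Lemma linked_l s t x : linked s t x (s x).
Proof. by apply: connect1; rewrite eqxx. Qed.

Lemma linked_r s t x : linked s t x (t x).
Proof. by apply: connect1; rewrite eqxx orbT. Qed.

Lemma linked_ind s t (P : pred D) x y :
  (forall u, P u -> P (s u)) -> (forall u, P u -> P (t u)) ->
  linked s t x y -> P x -> P y.
Proof.
move=> Ps Pt /connectP[p + ->]; elim: p x => //= u p IH x /andP[/orP[]/eqP-> /IH h] Px; apply: h.
  exact: Ps.
exact: Pt.
Qed.

Lemma linked_expl s t x n : linked s t x ((s ^+ n)%g x).
Proof.
elim: n => [|n IH]; first by rewrite perm1 linked_refl.
by rewrite expgSr permM (linked_trans IH) // linked_l.
Qed.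

Lemma linked_expr s t x n : linked s t x ((t ^+ n)%g x).
Proof.
elim: n => [|n IH]; first by rewrite perm1 linked_refl.
by rewrite expgSr permM (linked_trans IH) // linked_r.
Qed.

(** On a finite set the inverse of [s] acts at each point as a power of [s]; this makes [linked]
    symmetric although it is generated by forward steps. *)
Lemma perm_back s x : exists n, x = (s ^+ n)%g (s x).
Proof. by apply/porbitP; rewrite porbit_sym; have := mem_porbit s 1 x; rewrite expg1. Qed.

Lemma linked_sym s t : symmetric (linked s t).
Proof.
suff imp x y : linked s t x y -> linked s t y x by move=> x y; apply/idP/idP; apply: imp.
move=> xy; apply: (linked_ind (P := linked s t ^~ x) _ _ xy (linked_refl _ _ _)) => u ux.
  have [n e] := perm_back s u; apply: linked_trans ux; rewrite {2}e; exact: linked_expl.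
have [n e] := perm_back t u; apply: linked_trans ux; rewrite {2}e; exact: linked_expr.
Qed.

Lemma linked_eqr s t x y z : linked s t x y -> linked s t z x = linked s t z y.
Proof.
move=> xy; apply/idP/idP => h; first exact: linked_trans xy.
by apply: linked_trans h _; rewrite linked_sym.
Qed.

Lemma linked_eql s t x y z : linked s t x y -> linked s t x z = linked s t y z.
Proof. by move=> xy; rewrite !(linked_sym _ _ _ z); exact: linked_eqr. Qed.

Lemma linked_swap s t : linked s t =2 linked t s.
Proof. by move=> x y; apply: eq_connect => u v; rewrite orbC. Qed.

(** With the identity as second permutation, components are cycles, so results on [linked] also
    serve for faces and vertices. *)
Lemma linked_porbit s x y : linked s 1%g x y = (y \in porbit s x).
Proof.
apply/idP/porbitP => [|[n ->]]; last exact: linked_expl.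
move=> h; apply/porbitP.
apply: (linked_ind (P := [in porbit s x]) _ _ h (porbit_id _ _)) => u /=.
  by rewrite -!eq_porbit_mem; have := porbit_perm s 1 u; rewrite expg1 => ->.
by rewrite perm1.
Qed.

Lemma porbit_face_linked s t x y : y \in porbit (t * s)%g x -> linked s t x y.
Proof.
rewrite -linked_porbit => h.
apply: (linked_ind (P := linked s t x) _ _ h (linked_refl _ _ _)) => u xu.
  by rewrite permM (linked_trans xu) // (linked_trans (linked_r s t u)) // linked_l.
by rewrite perm1.
Qed.

(** When [e] is an equivalence, this merges the classes of [x0] and [y0]. *)
Definition link_rel (e : rel D) x0 y0 : rel D :=
  fun u v => [|| e u v, e u x0 && e y0 v | e u y0 && e x0 v].

Lemma link_rel_trans s t x0 y0 : transitive (link_rel (linked s t) x0 y0).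
Proof.
move=> y x z; rewrite /link_rel => /or3P[h|/andP[h1 h2]|/andP[h1 h2]].
- by rewrite !(linked_eql _ h).
- case/or3P=> [h'|/andP[h3 h4]|/andP[h3 h4]]; rewrite ?h1 ?h4 /= ?orbT //.
    by rewrite (linked_trans h2 h') orbT.
  by rewrite (linked_trans h1 h4).
- case/or3P=> [h'|/andP[h3 h4]|/andP[h3 h4]]; rewrite ?h1 ?h4 /= ?orbT //.
    by rewrite (linked_trans h2 h') !orbT.
  by rewrite (linked_trans h1 h4).
Qed.

Lemma link_relP s t s' t' x0 y0 x y :
  (forall u, link_rel (linked s' t') x0 y0 u (s u)) ->
  (forall u, link_rel (linked s' t') x0 y0 u (t u)) ->
  linked s t x y -> link_rel (linked s' t') x0 y0 x y.
Proof.
move=> hs ht h; apply: (linked_ind (P := link_rel (linked s' t') x0 y0 x) _ _ h).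
- by move=> u xu; apply: link_rel_trans xu _.
- by move=> u xu; apply: link_rel_trans xu _.
- by rewrite /link_rel linked_refl.
Qed.

Lemma linked_le s t s' t' x y :
  (forall u, linked s' t' u (s u)) -> (forall u, linked s' t' u (t u)) ->
  linked s t x y -> linked s' t' x y.
Proof.
move=> hs ht h; apply: (linked_ind (P := linked s' t' x) _ _ h) => [u xu|u xu|].
- exact: linked_trans xu _.
- exact: linked_trans xu _.
- exact: linked_refl.
Qed.

Lemma link_rel_mulr s t x0 y0 u :
  link_rel (linked s t) x0 y0 u ((s * tperm x0 y0)%g u).
Proof.
rewrite permM /link_rel; case: tpermP => [e|e|_ _].
- by rewrite -e linked_l linked_refl orbT.
- by rewrite -e linked_l linked_refl !orbT.
- by rewrite linked_l.
Qed.

Lemma link_rel_mull s t x0 y0 u :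
  link_rel (linked s t) x0 y0 u ((tperm x0 y0 * s)%g u).
Proof.
rewrite permM /link_rel; case: tpermP => [->|->|_ _].
- by rewrite linked_refl linked_l orbT.
- by rewrite linked_refl linked_l !orbT.
- by rewrite linked_l.
Qed.

Lemma link_relW (e : rel D) x0 y0 u v : e u v -> link_rel e x0 y0 u v.
Proof. by rewrite /link_rel => ->. Qed.

Lemma link_rel_id s t x0 y0 : linked s t x0 y0 ->
  link_rel (linked s t) x0 y0 =2 linked s t.
Proof.
move=> h u v; rewrite /link_rel (linked_eqr _ h) (linked_eql _ h).
apply/idP/idP=> [/or3P[//|/andP[a b]|/andP[a b]]|-> //]; last exact: linked_trans a b.
exact: linked_trans a b.
Qed.

Lemma link_rel_swap s t x0 y0 : 
  link_rel (linked s t) x0 y0 =2 link_rel (linked t s) x0 y0.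
Proof. by move=> u v; rewrite /link_rel !(linked_swap s t). Qed.

(** Multiplying by the transposition can at most merge two classes, and the same transposition
    undoes it. Since the new graph already links [x0] to [y0], undoing merges nothing, so old
    components lie inside new ones. *)
Lemma linked_mull s t x0 y0 : linked (tperm x0 y0 * s)%g t x0 y0 ->
  linked (tperm x0 y0 * s)%g t =2 link_rel (linked s t) x0 y0.
Proof.
set s' := (_ * s)%g => l x y; apply/idP/idP.
  apply: link_relP => u; first exact: link_rel_mull.
  by rewrite link_relW // linked_r.
have le u v : linked s t u v -> linked s' t u v.
  apply: linked_le => w; last exact: linked_r.
  by rewrite -[s](tpermKg x0 y0) -(link_rel_id l) link_rel_mull.
rewrite -(link_rel_id l) /link_rel => /or3P[h|/andP[h1 h2]|/andP[h1 h2]].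
- by rewrite le.
- by rewrite (le _ _ h1) (le _ _ h2) orbT.
- by rewrite (le _ _ h1) (le _ _ h2) !orbT.
Qed.

Lemma linked_mulr s t x0 y0 : linked (s * tperm x0 y0)%g t x0 y0 ->
  linked (s * tperm x0 y0)%g t =2 link_rel (linked s t) x0 y0.
Proof.
set s' := (s * _)%g => l x y; apply/idP/idP.
  apply: link_relP => u; first exact: link_rel_mulr.
  by rewrite link_relW // linked_r.
have le u v : linked s t u v -> linked s' t u v.
  apply: linked_le => w; last exact: linked_r.
  have -> : s = (s' * tperm x0 y0)%g by rewrite /s' -mulgA tperm2 mulg1.
  by rewrite -(link_rel_id l) link_rel_mulr.
rewrite -(link_rel_id l) /link_rel => /or3P[h|/andP[h1 h2]|/andP[h1 h2]].
- by rewrite le.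
- by rewrite (le _ _ h1) (le _ _ h2) orbT.
- by rewrite (le _ _ h1) (le _ _ h2) !orbT.
Qed.

Definition ncomp s t := #|[set [set y | linked s t x y] | x : D]|.

Lemma ncomp_link s t s' t' x0 y0 : linked s t =2 link_rel (linked s' t') x0 y0 ->
  ncomp s' t' = ncomp s t + ~~ linked s' t' x0 y0.
Proof.
move=> h; have [l|nl] /= := boolP (linked s' t' x0 y0).
  rewrite addn0; congr #|pred_of_set _|; apply: eq_imset => x; apply/setP=> y.
  by rewrite !inE h link_rel_id.
pose K x := [set y | linked s' t' x y]; pose L x := [set y | linked s t x y].
have Kin x : K x \in [set K x | x : D] by apply: imset_f.
have Lin x : L x \in [set L x | x : D] by apply: imset_f.
have Keq x y : (K x == K y) = linked s' t' x y.
  apply/eqP/idP=> [e|xy]; first by move/setP/(_ y): e; rewrite !inE linked_refl.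
  by apply/setP=> z; rewrite !inE; exact: linked_eql.
have Leq x y : (L x == L y) = linked s t x y.
  apply/eqP/idP=> [e|xy]; first by move/setP/(_ y): e; rewrite !inE linked_refl.
  by apply/setP=> z; rewrite !inE; exact: linked_eql.
have rest : [set K x | x : D] :\ K x0 :\ K y0 = [set L x | x : D] :\ L x0.
  apply/setP=> C; rewrite !inE; apply/and3P/andP=> [[h1 h2 /imsetP[x _ e]]|[h1 /imsetP[x _ e]]].
    move: h1 h2; rewrite e !Keq => h1 h2.
    have -> : K x = L x.
      by apply/setP=> z; rewrite !inE h /link_rel (negPf h1) (negPf h2) orbF.
    by rewrite Leq Lin h /link_rel (negPf h1) (negPf h2).
  move: h1; rewrite e Leq h /link_rel linked_refl andbT !negb_or => /and3P[h1 _ h2].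
  have -> : L x = K x.
    by apply/setP=> z; rewrite !inE h /link_rel (negPf h1) (negPf h2) orbF.
  by rewrite !Keq.
rewrite /ncomp (cardsD1 (K x0)) Kin (cardsD1 (K y0)) !inE Kin eq_sym Keq nl /= -/L.
by rewrite rest (cardsD1 (L x0) [set L x | x : D]) Lin /= addnC.
Qed.

Definition ndarts : nat := #|D|.

Definition ncyc s := #|porbits s|.

Lemma ncyc_tperm_mul s x y :
  ncyc (tperm x y * s)%g + (x \notin porbit s y).*2 = ncyc s + (x != y).
Proof. exact: porbits_mul_tperm. Qed.

Lemma ncyc_mul_tperm s x y :
  ncyc (s * tperm x y)%g + (x \notin porbit s y).*2 = ncyc s + (x != y).
Proof.
by rewrite /ncyc -porbitsV invMg tpermV -(porbitsV s) -(porbitV s) porbits_mul_tperm.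
Qed.

Lemma ncyc1 : ncyc (1 : {perm D}) = ndarts.
Proof.
rewrite /ndarts.
rewrite /ncyc /porbits card_imset // => x y /eqP; rewrite eq_porbit_mem porbit.unlock cycle1.
by rewrite imset_set1 /aperm perm1 inE => /eqP.
Qed.

Lemma ncomp1 s : ncomp s 1%g = ncyc s.
Proof.
congr #|pred_of_set _|; apply: eq_imset => x; apply/setP=> y.
by rewrite inE linked_porbit.
Qed.

(** The edge carried by [a] and [i a] becomes two half-edges, that is, two fixed points. *)
Definition cut (i : {perm D}) a := (tperm a (i a) * i)%g.

Lemma cutE i a x : involutive i -> cut i a x = if (x == a) || (x == i a) then x else i x.
Proof.
move=> ii; rewrite permM; case: tpermP => [->|->|/eqP/negPf-> /eqP/negPf->] //.
  by rewrite eqxx ii.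
by rewrite eqxx orbT.
Qed.

Lemma cut_inv i a : involutive i -> involutive (cut i a).
Proof.
move=> ii x; rewrite [cut i a x]cutE //; case: ifP => h; rewrite cutE ?h //.
by rewrite (inv_eq ii) (inj_eq perm_inj) orbC h ii.
Qed.

Lemma cutK i a : (tperm a (i a) * cut i a)%g = i.
Proof. by rewrite /cut mulgA tperm2 mul1g. Qed.

Lemma cut_cutr i a : involutive i -> i = (cut i a * tperm a (i a))%g.
Proof.
move=> ii; apply/permP=> x; rewrite permM cutE //.
case: eqVneq => [->|xa] /=; first by rewrite tpermL.
case: eqVneq => [->|xia] /=; first by rewrite tpermR ii.
by rewrite tpermD // eq_sym ?(inj_eq perm_inj) // (inv_eq ii) // eq_sym.
Qed.

Lemma linked_cut s i a : involutive i ->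
  linked s i =2 link_rel (linked s (cut i a)) a (i a).
Proof.
move=> ii x y; rewrite link_rel_swap linked_swap {1}(cut_cutr a ii) linked_mulr //.
by rewrite -cut_cutr // linked_l.
Qed.

Lemma ncomp_cut s i a : involutive i ->
  ncomp s (cut i a) = ncomp s i + ~~ linked s (cut i a) a (i a).
Proof. by move=> ii; apply: ncomp_link; exact: linked_cut. Qed.

Lemma face_cut s i a : (cut i a * s)%g = (tperm a (i a) * (i * s))%g.
Proof. by rewrite mulgA. Qed.

Lemma ncyc_cut i a : involutive i -> i a != a ->
  ncyc (cut i a) = ncyc i + 1.
Proof.
move=> ii ia; have := ncyc_tperm_mul i a (i a).
by rewrite porbit_sym; have := mem_porbit i 1 a; rewrite expg1 => -> /=; rewrite addn0 eq_sym ia.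
Qed.

Lemma ncyc_face_cut s i a : involutive i -> i a != a ->
  ncyc (cut i a * s)%g + (i a \notin porbit (i * s) a).*2 = ncyc (i * s)%g + 1.
Proof.
move=> ii ia; have := ncyc_tperm_mul (i * s)%g a (i a).
by rewrite /= porbit_sym -face_cut eq_sym ia.
Qed.

(** A transposition either splits one cycle or merges two, and applying it twice restores the count;
    so exactly one of the two face permutations has both darts on one cycle. *)
Lemma face_cut_link s i a : involutive i -> i a != a ->
  (i a \in porbit (cut i a * s)%g a) = (i a \notin porbit (i * s)%g a).
Proof.
move=> ii ia; have := ncyc_face_cut s ii ia.
have := ncyc_tperm_mul (cut i a * s)%g a (i a); rewrite /= porbit_sym eq_sym ia.
have -> : (tperm a (i a) * (cut i a * s) = i * s)%g by rewrite mulgA cutK.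
by do 2 case: (_ \in _) => //=; rewrite -?muln2 => h1 h2; exfalso; move: h1 h2; lia.
Qed.

(** Nonnegativity of the genus, summed over components. Cut the edges one by one: a cut that splits
    a face creates at most one component, and a cut that merges two faces creates none, because the
    merged face still links the two ends. Without edges, both sides agree. *)
Lemma euler_inequality s i : involutive i ->
  ncyc s + ncyc i + ncyc (i * s)%g <= ndarts + (ncomp s i).*2.
Proof.
have [n] := ubnP #|[pred x | i x != x]|; elim: n i => // n IH i le ii.
have [a ia|i1] := pickP (fun x => i x != x); last first.
  have -> : i = 1%g by apply/permP=> x; rewrite perm1; apply/eqP; rewrite -[_ == _]negbK i1.
  by rewrite ncomp1 mul1g ncyc1; lia.
have lt : #|[pred x | cut i a x != x]| < n.
  apply: (leq_trans _ (ltnSE le)); apply: proper_card; apply/properP; split.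
    by apply/subsetP=> x; rewrite !inE cutE //; case: ifP; rewrite ?eqxx.
  by exists a; rewrite ?inE ?cutE ?eqxx.
have {IH le lt} := IH (cut i a) lt (cut_inv a ii); rewrite (ncyc_cut ii ia) (ncomp_cut s a ii).
have := ncyc_face_cut s ii ia; have := face_cut_link s ii ia.
have : i a \in porbit (cut i a * s)%g a -> linked s (cut i a) a (i a) by exact: porbit_face_linked.
case: (i a \in porbit (i * s)%g a); case: (i a \in porbit _ a) => //=.
  by case: (linked _ _ _ _) => _ _ /=; rewrite -!muln2 => h1 h2; lia.
by move=> /(_ isT) -> _ /=; rewrite -!muln2 => h1 h2; lia.
Qed.

(** Genus zero in every component. Half-edges are counted as fixed points in [ncyc i], which
    balances their presence among the darts. *)
Definition eulerian s i : Prop :=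
  ncyc s + ncyc i + ncyc (i * s)%g = ndarts + (ncomp s i).*2.

(** A discrete Jordan theorem. When both sides of the edge lie on one face, the cut raises the left
    side of Euler's relation by 2, which the inequality allows only if a component is created.
    Otherwise the merged face keeps the ends linked. *)
Lemma eulerian_cut s i a : involutive i -> i a != a -> eulerian s i ->
  eulerian s (cut i a) /\ linked s (cut i a) a (i a) = (i a \notin porbit (i * s)%g a).
Proof.
move=> ii ia; rewrite /eulerian -!muln2 => E.
have := euler_inequality s (cut_inv a ii).
rewrite (ncyc_cut ii ia) (ncomp_cut s a ii).
have := ncyc_face_cut s ii ia; have := face_cut_link s ii ia.
have : i a \in porbit (cut i a * s)%g a -> linked s (cut i a) a (i a) by exact: porbit_face_linked.
case: (i a \in porbit (i * s)%g a); case: (i a \in porbit _ a) => //=.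
  case: (linked _ _ _ _) => _ _ /=; rewrite -!muln2 => h1 h2; first by exfalso; lia.
  by split=> //; lia.
move=> /(_ isT) -> _ /=; rewrite -!muln2 => h1 h2.
by split=> //; lia.
Qed.

End Linked.

(** * Peeling codes *)

Inductive gtree :=
| GLeaf
| GNode1 of bool & nat & gtree
| GNode2 of gtree & gtree.

Section Del.
Variable D : finType.
Implicit Types (t : gtree) (s i f : {perm D}) (x y z a h : D) (F : {set D}).

(** [x] is taken out of its cycle and left as a fixed point, so that the type of darts does not
    change. *)
Definition del s x := (s * tperm x (s x))%g.

Lemma delE s x y : del s x y = if y == x then x else if s y == x then s x else s y.
Proof.
rewrite permM; case: eqVneq => [->|yx]; first by rewrite tpermR.
case: eqVneq => [->|syx]; first by rewrite tpermL.
by rewrite tpermD // eq_sym ?(inj_eq perm_inj).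
Qed.

Lemma del_id s x : del s x x = x.
Proof. by rewrite delE eqxx. Qed.

Lemma del_mulK s x : (del s x * tperm x (s x))%g = s.
Proof. by rewrite -mulgA tperm2 mulg1. Qed.

Lemma ncyc_del s x : s x != x -> ncyc (del s x) = ncyc s + 1.
Proof.
move=> sx; have := ncyc_mul_tperm s x (s x); rewrite eq_sym sx.
by rewrite porbit_sym; have := mem_porbit s 1 x; rewrite expg1 => -> /=; rewrite addn0.
Qed.

Lemma linked_del_id s i h y : i h = h -> linked (del s h) i h y = (y == h).
Proof.
move=> ih; apply/idP/eqP=> [|->]; last exact: linked_refl.
move=> l; apply/eqP; apply: (linked_ind (P := pred1 h) _ _ l (eqxx _)) => u /eqP->.
  by rewrite del_id /=.
by rewrite ih /=.
Qed.

Lemma linked_del_link s i h :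
  linked s i =2 link_rel (linked (del s h) i) h (s h).
Proof. by move=> x y; rewrite -linked_mulr del_mulK // linked_l. Qed.

Lemma linked_del s i h x y : i h = h -> x != h -> y != h ->
  linked (del s h) i x y = linked s i x y.
Proof.
move=> ih xh yh; rewrite [linked s i x y](linked_del_link s i h) /link_rel !(linked_sym _ _ x) !linked_del_id //.
by rewrite (negPf xh) (negPf yh) /= orbC andbF.
Qed.

Lemma porbit_del s h x : x != h -> porbit (del s h) x = porbit s x :\ h.
Proof.
move=> xh; apply/setP=> y; rewrite !inE -!linked_porbit.
have [->|yh] /= := eqVneq y h; last by rewrite linked_del ?perm1.
by rewrite linked_sym linked_del_id ?perm1 // (negPf xh).
Qed.

Lemma face_del s i h : i h = h -> (i * del s h = del (i * s) h)%g.
Proof. by move=> ih; rewrite /del mulgA permM ih. Qed.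

(** Isolating a half-edge adds one vertex, one face and one component, which balance in Euler's
    relation. *)
Lemma eulerian_del s i h : i h = h -> s h != h -> eulerian s i -> eulerian (del s h) i.
Proof.
rewrite /eulerian -!muln2 => ih sh E; rewrite face_del // !ncyc_del ?permM ?ih //.
rewrite (ncomp_link (linked_del_link s i h)) linked_del_id // sh /=; lia.
Qed.

Definition stable_under f F := forall x, x \in F -> f x \in F.

Lemma stable_under_porbit f F x y : stable_under f F -> y \in porbit f x -> (y \in F) = (x \in F).
Proof.
move=> cF; have imp u v : v \in porbit f u -> u \in F -> v \in F.
  case/porbitP=> n -> uF; elim: n => [|n IH]; first by rewrite perm1.
  by rewrite expgSr permM; exact: cF.
by move=> yx; apply/idP/idP; apply: imp; rewrite // porbit_sym.
Qed.

Lemma stable_under_perm f F x : stable_under f F -> (f x \in F) = (x \in F).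
Proof.
move=> cF; apply: (stable_under_porbit cF).
by have := mem_porbit f 1 x; rewrite expg1.
Qed.

Lemma porbit_link f x y : y \in porbit f x -> forall u v,
  (v \in porbit f u) = link_rel (fun z w => w \in porbit (tperm x y * f)%g z) x y u v.
Proof.
move=> yx u v; have := @linked_mull D (tperm x y * f)%g 1%g x y.
have -> : (tperm x y * (tperm x y * f) = f)%g by rewrite mulgA tperm2 mul1g.
rewrite linked_porbit => /(_ yx u v); rewrite /link_rel !linked_porbit => ->.
by rewrite (porbit_sym _ x).
Qed.

(* The darts of a rotation [s] and an involution [i] may include dangling half-edges, the fixed
   points of [i].  A map is rooted at such a half-edge [h], sitting in the root corner, so that the
   map without edges is not special; the root edge is [(s h, i (s h))].  Peeling removes [h], cuts
   the root edge into two half-edges, and keeps them as roots of the two resulting maps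
   ([GNode2]), or, when a face is revealed, keeps [s h] and removes the other one ([GNode1], which
   records whether the face is in the marked set [F], and its degree).  Removed darts stay in [D]
   as isolated points, and only the component of [h] matters. *)
Fixpoint codes (t : gtree) s i F h : bool :=
  match t with
  | GLeaf => s h == h
  | GNode1 b d t1 =>
      let s1 := del s h in let a := s h in let a' := i a in
      let G := porbit (i * s1)%g a' in
      (s h != h) && [&& a' \notin porbit (i * s1)%g a, b == (a' \in F), d == #|G|
        & codes t1 (del s1 a') (cut i a) (F :\: G) a]
  | GNode2 t1 t2 =>
      let s1 := del s h in let a := s h in let a' := i a in
      (s h != h) && [&& ~~ linked s1 (cut i a) a a', codes t1 s1 (cut i a) F a
        & codes t2 s1 (cut i a) F a']
  end.

(* Same as [codes], for a map rooted at a dart [a] instead of a half-edge. *)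
Definition rcodes (t : gtree) s i F a : bool :=
  match t with
  | GLeaf => false
  | GNode1 b d t1 =>
      let G := porbit (i * s)%g (i a) in
      [&& i a \notin porbit (i * s)%g a, b == (i a \in F), d == #|G|
        & codes t1 (del s (i a)) (cut i a) (F :\: G) a]
  | GNode2 t1 t2 =>
      [&& ~~ linked s (cut i a) a (i a), codes t1 s (cut i a) F a
        & codes t2 s (cut i a) F (i a)]
  end.

Lemma codesE (t : gtree) s i F h :
  codes t s i F h = if t is GLeaf then s h == h else (s h != h) && rcodes t (del s h) i F (s h).
Proof. by case: t. Qed.

(** Among the darts linked to [h], only [h] is a half-edge, and [F] is a union of faces avoiding
    that of [h]; [rwf] is the analogue for a root dart, without half-edges. *)
Definition wf s i F h := [/\ involutive i, i h = h,
  forall x, linked s i h x -> i x = x -> x = h, h \notin F & stable_under (i * s)%g F].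

Definition rwf s i F a := [/\ involutive i, forall x, linked s i a x -> i x != x,
  a \notin F & stable_under (i * s)%g F].

Lemma linked_del_root s i h x : i h = h -> s h != h ->
  linked (del s h) i (s h) x = (x != h) && linked s i h x.
Proof.
move=> ih sh; have [->|xh] /= := eqVneq x h.
  by rewrite linked_sym linked_del_id // (negPf sh).
by rewrite linked_del // -(linked_eql _ (linked_l s i h)).
Qed.

Lemma rwf_del s i F h : wf s i F h -> s h != h -> rwf (del s h) i F (s h).
Proof.
case=> ii ih fx hF cF sh; split=> //.
- by move=> x; rewrite linked_del_root // => /andP[xh lx]; apply: contra_neq xh; exact: fx.
- by rewrite -(stable_under_perm _ cF) permM ih in hF.
- move=> x xF; rewrite face_del // delE.
  case: eqVneq => [e|_]; first by rewrite e (negPf hF) in xF.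
  by case: eqVneq => [e|_]; [rewrite -e cF // in hF|exact: cF].
Qed.

Lemma linked_cut_root s i a x : involutive i ->
  linked s i a x = linked s (cut i a) a x || linked s (cut i a) (i a) x.
Proof.
move=> ii; rewrite (linked_cut s a ii) /link_rel linked_refl /=.
case: (linked s (cut i a) a x) => //=; by rewrite andbF orbF.
Qed.

Lemma cut_root i a : involutive i -> cut i a a = a.
Proof. by move=> ii; rewrite cutE // eqxx. Qed.

Lemma cut_root' i a : involutive i -> cut i a (i a) = i a.
Proof. by move=> ii; rewrite cutE // eqxx orbT. Qed.

(** If the cut disconnects, [face_cut_link] puts [i a] on the face of [a], so [F] avoids both ends
    and each piece has a single half-edge. *)
Lemma wf_cut s i F a : rwf s i F a -> ~~ linked s (cut i a) a (i a) ->
  wf s (cut i a) F a /\ wf s (cut i a) F (i a).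
Proof.
case=> ii nfx aF cF nl.
have iaa : i a != a by apply: nfx; exact: linked_refl.
have ia_a : i a \in porbit (i * s)%g a.
  rewrite -[_ \in _]negbK -face_cut_link //; apply: contra nl; exact: porbit_face_linked.
have iaF : i a \notin F by rewrite (stable_under_porbit cF ia_a).
have cF' : stable_under (cut i a * s)%g F.
  move=> x xF; rewrite face_cut permM tpermD ?cF //.
    by apply: contraNneq aF => ->.
  by apply: contraNneq iaF => ->.
have root x : linked s i a x -> cut i a x = x -> x = a \/ x = i a.
  move=> l; rewrite cutE //; case: (eqVneq x a) => [->|_]; first by left.
  case: (eqVneq x (i a)) => [->|_] /=; first by right.
  by move=> e; have := nfx x l; rewrite e eqxx.
split; split=> //; try exact: cut_inv.
- exact: cut_root.
- move=> x lx; have /root h : linked s i a x by rewrite linked_cut_root // lx.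
  by case/h => // e; rewrite e (negPf nl) in lx.
- exact: cut_root'.
- move=> x lx; have /root h : linked s i a x by rewrite linked_cut_root // lx orbT.
  by case/h => // e; rewrite e linked_sym (negPf nl) in lx.
Qed.

Lemma linked_cut_del s i a x : involutive i -> i a != a ->
  i a \notin porbit (i * s)%g a ->
  linked (del s (i a)) (cut i a) a x = (x != i a) && linked s i a x.
Proof.
move=> ii ia nf; have l : linked s (cut i a) a (i a).
  by apply: porbit_face_linked; rewrite face_cut_link.
have [->|xa] /= := eqVneq x (i a).
  by rewrite linked_sym linked_del_id ?cut_root' // eq_sym (negPf ia).
rewrite (linked_cut_root s a x ii) -(linked_eql _ l) orbb.
by rewrite linked_del ?cut_root' // eq_sym.
Qed.

Lemma wf_cut_del s i F a : rwf s i F a -> i a \notin porbit (i * s)%g a ->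
  wf (del s (i a)) (cut i a) (F :\: porbit (i * s)%g (i a)) a.
Proof.
case=> ii nfx aF cF nf.
have iaa : i a != a by apply: nfx; exact: linked_refl.
split; [exact: cut_inv|exact: cut_root| | |].
- move=> x; rewrite linked_cut_del // => /andP[xa l]; rewrite cutE // (negPf xa) orbF.
  by case: eqVneq => // _ e; have := nfx x l; rewrite e eqxx.
- by rewrite inE negb_and aF orbT.
- move=> x; rewrite !inE => /andP[xo xF].
  rewrite face_del ?cut_root' // delE face_cut permM.
  have xa : x != i a by apply: contraNneq xo => ->; exact: porbit_id.
  rewrite (negPf xa) tpermD 1?eq_sym //; last by apply: contraNneq aF => <-.
  have fo : (i * s)%g x \notin porbit (i * s)%g (i a).
    rewrite -eq_porbit_mem; have := porbit_perm (i * s)%g 1 x; rewrite expg1 => ->.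
    by rewrite eq_porbit_mem.
  case: eqVneq => [e|_]; first by rewrite e porbit_id in fo.
  by rewrite fo cF.
Qed.

(** Induction on the size of the root component, alternating between the two kinds of roots. Euler's
    relation makes the constructors exhaustive: by [eulerian_cut], two sides on one face force a
    split. *)
Lemma exists_codes n :
  (forall s i F h, wf s i F h -> eulerian s i -> #|[set x | linked s i h x]| < n ->
    exists t, codes t s i F h) /\
  (forall s i F a, rwf s i F a -> eulerian s i -> #|[set x | linked s i a x]| < n ->
    exists t, rcodes t s i F a).
Proof.
elim: n => // n [IHp IHr]; split.
- move=> s i F h w E /ltnSE le; have [ii ih _ _ _] := w.
  have [sh|sh] := eqVneq (s h) h; first by exists GLeaf; rewrite codesE sh.
  have [|t ct] := IHr _ _ _ _ (rwf_del w sh) (eulerian_del ih sh E).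
    apply: (leq_trans _ le); apply: proper_card; apply/properP; split.
      by apply/subsetP=> x; rewrite !inE linked_del_root // => /andP[].
    by exists h; rewrite ?inE ?linked_del_root ?eqxx ?linked_refl.
  by exists t; rewrite codesE sh ct; case: t ct.
- move=> s i F a w E /ltnSE le; have [ii nfx aF cF] := w.
  have ia : i a != a by apply: nfx; exact: linked_refl.
  have [Ec] := eulerian_cut ii ia E.
  have [_|nf] /= := boolP (i a \in porbit (i * s)%g a).
    move/negbT=> nl; have [w1 w2] := wf_cut w nl.
    have [|t1 ct1] := IHp _ _ _ _ w1 Ec.
      apply: (leq_trans _ le); apply: proper_card; apply/properP; split.
        by apply/subsetP=> x; rewrite !inE (linked_cut_root s a x ii) => ->.
      by exists (i a); rewrite ?inE ?linked_r // (negPf nl).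
    have [|t2 ct2] := IHp _ _ _ _ w2 Ec.
      apply: (leq_trans _ le); apply: proper_card; apply/properP; split.
        by apply/subsetP=> x; rewrite !inE (linked_cut_root s a x ii) => ->; rewrite orbT.
      by exists a; rewrite ?inE ?linked_refl // linked_sym (negPf nl).
    by exists (GNode2 t1 t2); rewrite /= nl ct1 ct2.
  move=> l; have Ed : eulerian (del s (i a)) (cut i a).
    apply: eulerian_del => //; first exact: cut_root'.
    (* Were [i a] fixed by [s], it would be isolated once the edge is cut, contrary to [l]. *)
    apply: contraTneq l => e; have := linked_del_id s a (cut_root' a ii).
    by rewrite /del e tperm1 mulg1 linked_sym eq_sym (negPf ia) => ->.
  have [|t ct] := IHp _ _ _ _ (wf_cut_del w nf) Ed.
    apply: (leq_trans _ le); apply: proper_card; apply/properP; split.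
      by apply/subsetP=> x; rewrite !inE linked_cut_del // => /andP[].
    by exists (i a); rewrite ?inE ?linked_r // linked_cut_del // eqxx.
  by exists (GNode1 (i a \in F) #|porbit (i * s)%g (i a)| t); rewrite /= nf !eqxx.
Qed.

End Del.

(** The degree of the root face: merging a revealed face of degree [d] across the root edge adds
    [d - 2] sides, and a split loses the two sides of the root edge. *)
Fixpoint glab (t : gtree) : nat :=
  match t with
  | GLeaf => 0
  | GNode1 _ d t1 => glab t1 + 2 - d
  | GNode2 t1 t2 => glab t1 + glab t2 + 2
  end.

(** The upper bound on [d] makes the subtraction in [glab] exact, with a positive result. *)
Fixpoint gvalid (t : gtree) : bool :=
  match t with
  | GLeaf => true
  | GNode1 _ d t1 => [&& 0 < d, d <= glab t1 + 1 & gvalid t1]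
  | GNode2 t1 t2 => gvalid t1 && gvalid t2
  end.

Fixpoint gedges (t : gtree) : nat :=
  match t with
  | GLeaf => 0
  | GNode1 _ _ t1 => (gedges t1).+1
  | GNode2 t1 t2 => (gedges t1 + gedges t2).+1
  end.

(** Each revealed face counts once per dart, which matches [face_sum], a sum over the darts outside
    the root face. *)
Fixpoint gsum (u : bool -> nat -> nat) (t : gtree) : nat :=
  match t with
  | GLeaf => 0
  | GNode1 b d t1 => d * u b d + gsum u t1
  | GNode2 t1 t2 => gsum u t1 + gsum u t2
  end.

(** * Sizes and face degrees are determined by the code *)

Section Stats.
Variable D : finType.
Implicit Types (t : gtree) (s i f : {perm D}) (x y z a h : D) (F : {set D}).

Lemma porbit_out_link f x y z : y \in porbit f x -> z \notin porbit f x ->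
  porbit (tperm x y * f)%g z = porbit f z.
Proof.
move=> yx zx; apply/setP=> v; rewrite (porbit_link yx z v) /link_rel.
have /norP[/negPf n1 /negPf n2] : ~~ ((z \in porbit (tperm x y * f)%g x) || (z \in porbit (tperm x y * f)%g y)).
  apply: contra zx; rewrite (porbit_link yx x z) /link_rel porbit_id /=.
  by case/orP=> ->; rewrite ?orbT.
by rewrite !(porbit_sym _ _ z) n1 n2 /= orbF.
Qed.

Lemma porbit_root_link f x y : y \in porbit f x ->
  porbit f x = porbit (tperm x y * f)%g x :|: porbit (tperm x y * f)%g y.
Proof.
move=> yx; apply/setP=> v; rewrite inE (porbit_link yx x v) /link_rel porbit_id /=.
by case: (v \in porbit (tperm x y * f)%g x) => //=; rewrite andbF orbF.
Qed.

Definition size_face s i x := #|porbit (i * s)%g x|.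
Definition size_comp s i x := #|[set y | linked s i x y]|.
Definition face_sum (u : bool -> nat -> nat) s i F a :=
  \sum_(x | linked s i a x && (x \notin porbit (i * s)%g a)) u (x \in F) (size_face s i x).

Lemma size_face_del s i F h : wf s i F h -> s h != h ->
  size_face s i h = (size_face (del s h) i (s h)).+1.
Proof.
case=> ii ih _ _ _ sh; rewrite /size_face face_del // porbit_del //.
have -> : porbit (i * s)%g (s h) = porbit (i * s)%g h.
  by have := porbit_perm (i * s)%g 1 h; rewrite expg1 permM ih.
by rewrite (cardsD1 h) porbit_id.
Qed.

Lemma size_comp_del s i F h : wf s i F h -> s h != h ->
  size_comp s i h = (size_comp (del s h) i (s h)).+1.
Proof.
case=> ii ih _ _ _ sh; rewrite /size_comp (cardsD1 h) inE linked_refl add1n; congr _.+1.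
by apply: eq_card => x; rewrite !inE linked_del_root.
Qed.

Lemma face_sum_del u s i F h : wf s i F h -> s h != h ->
  face_sum u s i F h = face_sum u (del s h) i F (s h).
Proof.
case=> ii ih _ _ _ sh.
have e : porbit (del (i * s)%g h) (s h) = porbit (i * s)%g h :\ h.
  rewrite porbit_del //; congr (_ :\ _).
  by have := porbit_perm (i * s)%g 1 h; rewrite expg1 permM ih.
rewrite /face_sum /size_face face_del //; apply: eq_big => x.
  rewrite linked_del_root // e !inE; case: eqVneq => [->|] //=.
  by rewrite porbit_id andbF.
case/andP=> l nx; rewrite porbit_del; last by apply: contraNneq nx => ->; exact: porbit_id.
congr (u _ #|pred_of_set _|); apply/setP=> y; rewrite !inE.
by have [->|//] := eqVneq y h; rewrite porbit_sym (negPf nx).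
Qed.

Lemma size_face_cut s i F a : rwf s i F a -> ~~ linked s (cut i a) a (i a) ->
  size_face s i a = size_face s (cut i a) a + size_face s (cut i a) (i a).
Proof.
case=> ii nfx _ _ nl; have ia : i a != a by apply: nfx; exact: linked_refl.
rewrite /size_face face_cut (@porbit_root_link _ a (i a)).
  rewrite cardsU -face_cut; set I := _ :&: _.
  suff -> : I = set0 by rewrite cards0 subn0.
  apply/setP=> x; rewrite !inE; apply/negP=> /andP[/porbit_face_linked l1 /porbit_face_linked l2].
  by case/negP: nl; apply: linked_trans l1 _; rewrite linked_sym.
rewrite -[_ \in _]negbK -face_cut_link //; apply: contra nl; exact: porbit_face_linked.
Qed.

Lemma size_comp_cut s i F a : rwf s i F a -> ~~ linked s (cut i a) a (i a) ->
  size_comp s i a = size_comp s (cut i a) a + size_comp s (cut i a) (i a).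
Proof.
case=> ii nfx _ _ nl; rewrite /size_comp.
have -> : [set y | linked s i a y] = [set y | linked s (cut i a) a y] :|: [set y | linked s (cut i a) (i a) y].
  by apply/setP=> x; rewrite !inE (linked_cut_root s a x ii).
rewrite cardsU; set I := _ :&: _.
suff -> : I = set0 by rewrite cards0 subn0.
apply/setP=> x; rewrite !inE; apply/negP=> /andP[l1 l2].
by case/negP: nl; apply: linked_trans l1 _; rewrite linked_sym.
Qed.

Lemma face_sum_cut u s i F a : rwf s i F a -> ~~ linked s (cut i a) a (i a) ->
  face_sum u s i F a = face_sum u s (cut i a) F a + face_sum u s (cut i a) F (i a).
Proof.
case=> ii nfx _ _ nl; have ia : i a != a by apply: nfx; exact: linked_refl.
have fa : i a \in porbit (i * s)%g a.
  rewrite -[_ \in _]negbK -face_cut_link //; apply: contra nl; exact: porbit_face_linked.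
have nl' x : linked s (cut i a) a x -> linked s (cut i a) (i a) x = false.
  move=> l; apply/negP=> l2; case/negP: nl; apply: linked_trans l _; by rewrite linked_sym.
rewrite /face_sum (bigID (linked s (cut i a) a)) /=; congr (_ + _); apply: eq_big => x.
- rewrite (linked_cut_root s a x ii) (porbit_root_link fa) inE negb_or -face_cut.
  have [l|] /= := boolP (linked s (cut i a) a x); last by rewrite andbF.
  rewrite andbT; case: (x \in porbit _ a) => //=; apply/negP=> /porbit_face_linked.
  by rewrite nl'.
- case/andP=> /andP[_ nx] _; by rewrite /size_face face_cut porbit_out_link.
- rewrite (linked_cut_root s a x ii) (porbit_root_link fa) inE negb_or -face_cut.
  have [l|nl2] /= := boolP (linked s (cut i a) a x); first by rewrite andbF nl'.
  rewrite andbT; case: (linked _ _ _ x) => //=.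
  by case: (boolP (x \in porbit _ a)) => // /porbit_face_linked; rewrite (negPf nl2).
- case/andP=> /andP[_ nx] _; by rewrite /size_face face_cut porbit_out_link.
Qed.

Lemma porbit_cut_face s i a : involutive i -> i a != a -> i a \notin porbit (i * s)%g a ->
  porbit (cut i a * s)%g a = porbit (i * s)%g a :|: porbit (i * s)%g (i a).
Proof.
move=> ii ia nf; rewrite (@porbit_root_link _ a (i a)); last by rewrite face_cut_link.
by rewrite mulgA cutK.
Qed.

Lemma size_face_cut_del s i F a : rwf s i F a -> i a \notin porbit (i * s)%g a ->
  size_face s i a + size_face s i (i a) = (size_face (del s (i a)) (cut i a) a).+1.
Proof.
case=> ii nfx _ _ nf; have ia : i a != a by apply: nfx; exact: linked_refl.
rewrite /size_face face_del ?cut_root' // porbit_del 1?eq_sym // porbit_cut_face //.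
have -> : forall A : {set D}, i a \in A -> (#|A :\ i a|).+1 = #|A|.
  by move=> A iA; rewrite [in RHS](cardsD1 (i a)) iA.
  rewrite cardsU; set I := _ :&: _.
  suff -> : I = set0 by rewrite cards0 subn0.
  apply/setP=> x; rewrite !inE -!eq_porbit_mem; apply/negP=> /andP[/eqP e1 /eqP e2].
  by case/negP: nf; rewrite -eq_porbit_mem -e1 -e2.
by rewrite inE porbit_id orbT.
Qed.

Lemma size_comp_cut_del s i F a : rwf s i F a -> i a \notin porbit (i * s)%g a ->
  size_comp s i a = (size_comp (del s (i a)) (cut i a) a).+1.
Proof.
case=> ii nfx _ _ nf; have ia : i a != a by apply: nfx; exact: linked_refl.
rewrite /size_comp (cardsD1 (i a)) inE linked_r add1n; congr _.+1.
by apply: eq_card => x; rewrite !inE linked_cut_del.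
Qed.

Lemma face_sum_cut_del u s i F a : rwf s i F a -> i a \notin porbit (i * s)%g a ->
  let G := porbit (i * s)%g (i a) in
  face_sum u s i F a = #|G| * u (i a \in F) #|G|
    + face_sum u (del s (i a)) (cut i a) (F :\: G) a.
Proof.
case=> ii nfx aF cF nf G; have ia : i a != a by apply: nfx; exact: linked_refl.
have faG x : x \in G -> x \notin porbit (i * s)%g a.
  move=> xG; apply: contra nf => xa; move: xG xa.
  by rewrite /G -!eq_porbit_mem => /eqP->.
rewrite /face_sum (bigID [in G]) /=; congr (_ + _).
  rewrite -sum_nat_const; apply: eq_big => x.
    have [xG|] /= := boolP (x \in G); last by rewrite andbF.
    rewrite faG // !andbT (linked_trans (linked_r s i a)) //; exact: porbit_face_linked.
  case/andP=> _ xG; rewrite (stable_under_porbit cF xG) /size_face.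
  by move: xG; rewrite -eq_porbit_mem => /eqP->.
apply: eq_big => x.
  rewrite linked_cut_del // face_del ?cut_root' // porbit_del 1?eq_sym // porbit_cut_face //.
  rewrite !inE negb_and negb_or negbK -/G.
  have [->|xa] /= := eqVneq x (i a); first by rewrite porbit_id andbF.
  by rewrite andbA.
case/andP=> /andP[_ nx] xG; rewrite inE xG /= /size_face face_del ?cut_root' //.
rewrite porbit_del; last by apply: contraNneq xG => ->; exact: porbit_id.
congr (u _ #|pred_of_set _|); apply/setP=> y.
rewrite inE -(@porbit_out_link (cut i a * s)%g a (i a)) ?face_cut_link //; last first.
  by rewrite porbit_cut_face // inE negb_or nx.
rewrite mulgA cutK inE; have [->|//] := eqVneq y (i a).
by rewrite porbit_sym (negPf xG).
Qed.

(** The successors in the first form account for the half-edge, one more place on the root face and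
    one more dart. These quantities suffice to recognize a triangulation from its code. *)
Lemma codes_stats t :
  (forall s i F h, wf s i F h -> codes t s i F h ->
    [/\ gvalid t, size_face s i h = (glab t).+1, size_comp s i h = (gedges t).*2.+1
      & forall u, face_sum u s i F h = gsum u t]) /\
  (forall s i F a, rwf s i F a -> rcodes t s i F a ->
    [/\ gvalid t, size_face s i a = glab t, size_comp s i a = (gedges t).*2
      & forall u, face_sum u s i F a = gsum u t]).
Proof.
have step t' : t' <> GLeaf -> 
    (forall s i F a, rwf s i F a -> rcodes t' s i F a ->
    [/\ gvalid t', size_face s i a = glab t', size_comp s i a = (gedges t').*2
      & forall u, face_sum u s i F a = gsum u t']) ->
    (forall s i F h, wf s i F h -> codes t' s i F h ->
    [/\ gvalid t', size_face s i h = (glab t').+1, size_comp s i h = (gedges t').*2.+1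
      & forall u, face_sum u s i F h = gsum u t']).
  move=> tl R s i F h w; rewrite codesE => ct.
  have {ct} /andP[sh ct] : (s h != h) && rcodes t' (del s h) i F (s h) by case: t' tl ct {R}.
  have [v e1 e2 e3] := R _ _ _ _ (rwf_del w sh) ct.
  rewrite (size_face_del w sh) (size_comp_del w sh) e1 e2; split=> // u.
  by rewrite (face_sum_del u w sh).
elim: t => [|b d t [IH _]|t1 [IH1 _] t2 [IH2 _]].
- split=> // s i F h [ii ih fx hF cF] /= /eqP sh.
  have l x : linked s i h x = (x == h).
    apply/idP/eqP=> [l|->]; last exact: linked_refl.
    by apply/eqP; apply: (linked_ind (P := pred1 h) _ _ l (eqxx _)) => u /eqP->; rewrite ?sh ?ih /=.
  split=> //.
  + rewrite /size_face -[RHS](cards1 h); apply: eq_card => x; rewrite inE.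
    by rewrite -l; apply/idP/idP=> [/porbit_face_linked//|]; rewrite l => /eqP->; exact: porbit_id.
  + by rewrite /size_comp -[RHS](cards1 h); apply: eq_card => x; rewrite !inE l.
  + move=> u; rewrite /face_sum big1 // => x /andP[]; rewrite l => /eqP->.
    by rewrite porbit_id.
- suff R : forall s i F a, rwf s i F a -> rcodes (GNode1 b d t) s i F a ->
    [/\ gvalid (GNode1 b d t), size_face s i a = glab (GNode1 b d t), size_comp s i a = (gedges (GNode1 b d t)).*2
      & forall u, face_sum u s i F a = gsum u (GNode1 b d t)] by split=> //; exact: step.
  move=> s i F a w /and4P[nf /eqP bE /eqP dE ct].
  have [v e1 e2 e3] := IH _ _ _ _ (wf_cut_del w nf) ct.
  have := size_face_cut_del w nf; rewrite e1 {2}/size_face -dE => e.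
  have p1 : 0 < size_face s i a by rewrite lt0n card_porbit_neq0.
  have p2 : 0 < d by rewrite dE lt0n card_porbit_neq0.
  split.
  + by rewrite /= v p2 andbT; lia.
  + by rewrite /=; lia.
  + by rewrite (size_comp_cut_del w nf) e2.
  + by move=> u; rewrite (face_sum_cut_del u w nf) /= e3 -bE -dE.
- suff R : forall s i F a, rwf s i F a -> rcodes (GNode2 t1 t2) s i F a ->
    [/\ gvalid (GNode2 t1 t2), size_face s i a = glab (GNode2 t1 t2), size_comp s i a = (gedges (GNode2 t1 t2)).*2
      & forall u, face_sum u s i F a = gsum u (GNode2 t1 t2)] by split=> //; exact: step.
  move=> s i F a w /and3P[nl ct1 ct2].
  have [w1 w2] := wf_cut w nl.
  have [v e1 e2 e3] := IH1 _ _ _ _ w1 ct1; have [v' e1' e2' e3'] := IH2 _ _ _ _ w2 ct2.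
  split.
  + by rewrite /= v v'.
  + by rewrite (size_face_cut w nl) e1 e1' /=; lia.
  + by rewrite (size_comp_cut w nl) e2 e2' /= doubleS doubleD; lia.
  + by move=> u; rewrite (face_sum_cut u w nl) e3 e3'.
Qed.

Lemma rcodes_stats t s i F a : rwf s i F a -> rcodes t s i F a ->
  [/\ gvalid t, size_face s i a = glab t, size_comp s i a = (gedges t).*2
    & forall u, face_sum u s i F a = gsum u t].
Proof. by case: (codes_stats t) => _; apply. Qed.

(** Two constructors cannot both apply: if [i a] is off the face of [a], the cut merges the two
    faces and thereby keeps [a] linked to [i a]. *)
Lemma codes_inj t :
  (forall t' s i F h, wf s i F h -> codes t s i F h -> codes t' s i F h -> t = t') /\
  (forall t' s i F a, rwf s i F a -> rcodes t s i F a -> rcodes t' s i F a -> t = t').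
Proof.
have step t0 : 
    (forall t' s i F a, rwf s i F a -> rcodes t0 s i F a -> rcodes t' s i F a -> t0 = t') ->
    (forall t' s i F h, wf s i F h -> codes t0 s i F h -> codes t' s i F h -> t0 = t').
  move=> R t' s i F h w; rewrite !codesE.
  have [sh|sh] := eqVneq (s h) h; first by case: t0 t' {R} => [||] // [].
  case: t0 t' R => [|b d t0|t1 t2] [|b' d' t'|t1' t2'] R //; rewrite ?sh => c c'; exact: (R _ _ _ _ _ (rwf_del w sh) c c').
elim: t => [|b d t0 [IH _]|t1 [IH1 _] t2 [IH2 _]].
- by split=> //; apply: step.
- suff R : forall t' s i F a, rwf s i F a -> rcodes (GNode1 b d t0) s i F a ->
    rcodes t' s i F a -> GNode1 b d t0 = t' by split=> //; exact: step.
  move=> [|b' d' t'|t1' t2'] s i F a w //.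
    move=> /and4P[nf /eqP-> /eqP-> ct] /and4P[_ /eqP-> /eqP-> ct']; congr GNode1.
    exact: IH (wf_cut_del w nf) ct ct'.
  move=> /and4P[nf _ _ _] /and3P[/negP nl _ _]; case: nl; have [ii nfx _ _] := w.
  by apply: porbit_face_linked; rewrite face_cut_link // nfx // linked_refl.
- suff R : forall t' s i F a, rwf s i F a -> rcodes (GNode2 t1 t2) s i F a ->
    rcodes t' s i F a -> GNode2 t1 t2 = t' by split=> //; exact: step.
  move=> [|b' d' t'|t1' t2'] s i F a w //.
    move=> /and3P[/negP nl _ _] /and4P[nf _ _ _]; case: nl; have [ii nfx _ _] := w.
    by apply: porbit_face_linked; rewrite face_cut_link // nfx // linked_refl.
  move=> /and3P[nl c1 c2] /and3P[_ c1' c2']; have [w1 w2] := wf_cut w nl.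
  by congr GNode2; [exact: IH1 w1 c1 c1'|exact: IH2 w2 c2 c2'].
Qed.

Lemma rcodes_inj t t' s i F a : rwf s i F a -> rcodes t s i F a -> rcodes t' s i F a -> t = t'.
Proof. by case: (codes_inj t) => _ h; exact: h. Qed.

End Stats.

(** * Isomorphic maps have the same codes, and conversely *)

Section Iso.
Variable D : finType.
Implicit Types (t : gtree) (s i f g : {perm D}) (x y z a h : D) (F : {set D}).

Lemma porbit_exp_inj f x j k : j < #|porbit f x| -> k < #|porbit f x| ->
  ((f ^+ j)%g x == (f ^+ k)%g x) = (j == k).
Proof.
move=> lj lk; have := nth_uniq x _ _ (uniq_traject_porbit f x) => /(_ j k).
by rewrite !size_traject !nth_traject // !permX => ->.
Qed.

Lemma card_porbit_eq f x d : 0 < d -> (f ^+ d)%g x = x ->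
  (forall j, 0 < j < d -> (f ^+ j)%g x != x) -> #|porbit f x| = d.
Proof.
move=> d0 fd nj; have n0 : 0 < #|porbit f x| by rewrite lt0n card_porbit_neq0.
case: (ltngtP #|porbit f x| d) => // lt.
  by have := nj #|porbit f x|; rewrite n0 lt permX iter_porbit eqxx => /(_ isT).
have := porbit_exp_inj lt n0; rewrite fd perm1 eqxx => /esym/eqP e.
by rewrite e in d0.
Qed.

(* A face of degree [d] merged into the root face at [a], with the dart [a']
   forgotten, occupies the [d - 1] places that follow [a]. *)
Lemma splice_face f a a' : a' \notin porbit f a ->
  ((del (tperm a a' * f) a') ^+ #|porbit f a'|)%g a = f a.
Proof.
set d := #|_|; set f' := (_ * f)%g; set f2 := del f' a' => nf.
have d0 : 0 < d by rewrite lt0n card_porbit_neq0.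
have aa : a != a' by apply: contraNneq nf => <-; exact: porbit_id.
have na j : (f ^+ j)%g a' != a.
  apply: contraNneq nf => <-; rewrite porbit_sym; exact: mem_porbit.
have na' j : 0 < j < d -> (f ^+ j)%g a' != a'.
  by case/andP=> j0 jd; have := porbit_exp_inj jd d0; rewrite perm1 => ->; rewrite -lt0n.
have f'a : f' a = f a' by rewrite permM tpermL.
have f'a' : f' a' = f a by rewrite permM tpermR.
have fd : (f ^+ d)%g a' = a' by rewrite permX iter_porbit.
have P j : j < d -> (f2 ^+ j)%g a = if j == 0 then a else (f ^+ j)%g a'.
  elim: j => [|j IH] jd; first by rewrite perm1.
  have nja : (f ^+ j.+1)%g a' != a' by exact: na'.
  rewrite expgSr permM IH 1?ltnW // /f2 delE; case: j IH jd nja => [|j] _ jd nja /=.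
    by rewrite (negPf aa) f'a -{1}(expg1 f) (negPf nja) expg1.
  rewrite (negPf (na' _ _)) /=; last by rewrite ltnW.
  have -> : f' ((f ^+ j.+1)%g a') = (f ^+ j.+2)%g a'.
    rewrite [RHS](_ : _ = f ((f ^+ j.+1)%g a')); last by rewrite (expgSr _ j.+1) permM.
    by rewrite /f' permM tpermD // eq_sym ?na //; apply: na'; exact: ltnW.
  by rewrite (negPf nja).
rewrite -(prednK d0) expgSr permM P ?prednK //.
have [d1|d1] := eqVneq d.-1 0; rewrite delE.
  by rewrite (negPf aa) f'a; move: fd; rewrite -(prednK d0) d1 expg1 => ->; rewrite eqxx f'a'.
have dd : 0 < d.-1 < d by rewrite lt0n d1 ltn_predL.
rewrite (negPf (na' _ dd)) {1 2}/f' permM tpermD; [|by rewrite eq_sym na|by rewrite eq_sym na'].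
have -> : f ((f ^+ d.-1)%g a') = a' by rewrite -[RHS]fd -[in RHS](prednK d0) expgSr permM.
by rewrite eqxx f'a'.
Qed.

(** Converse of [splice_face]: the points at distances 1 to [d - 1] after [a], closed up by the
    spare point [a'], become a face of degree [d]. *)
Lemma unsplice_face f a a' d : f a' = a' -> a != a' -> 0 < d <= #|porbit f a| ->
  let f1 := (tperm a a' * (f * tperm a' ((f ^+ d)%g a)))%g in
  #|porbit f1 a'| = d /\ forall x, x \in porbit f1 a' -> x = a' \/ (x != a /\ x \in porbit f a).
Proof.
case: d => // d fa' aa dn f1; set y := (f ^+ _)%g a in f1 *.
have na' j : (f ^+ j)%g a != a'.
  have fj : (f ^+ j)%g a' = a' by elim: j => [|j IH]; rewrite ?perm1 // expgSr permM IH.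
  by rewrite -[X in _ != X]fj (inj_eq perm_inj).
have na j : 0 < j <= d -> (f ^+ j)%g a != a.
  case/andP=> j0 jd; have := @porbit_exp_inj f a j 0; rewrite perm1 => -> //; first by rewrite -lt0n.
    exact: leq_ltn_trans jd _.
  exact: leq_trans dn.
have ny j : 0 < j <= d -> (f ^+ j)%g a != y.
  case/andP=> j0 jd; rewrite /y expgSr; case: j j0 jd => // j _ jd.
  rewrite expgSr !permM (inj_eq perm_inj) porbit_exp_inj ?ltn_eqF //.
  exact: leq_ltn_trans (ltnW jd) _.
have st0 : f1 a' = tperm a' y (f a) by rewrite /f1 !permM tpermR.
have st x : x != a -> x != a' -> f1 x = tperm a' y (f x).
  by move=> xa xa'; rewrite /f1 !permM [tperm a a' x]tpermD // eq_sym.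
have P j : 0 < j <= d -> (f1 ^+ j)%g a' = (f ^+ j)%g a.
  elim: j => // j IH /andP[_ jd]; rewrite (expgSr f1) permM.
  have -> : f1 ((f1 ^+ j)%g a') = tperm a' y ((f ^+ j.+1)%g a).
    rewrite (expgSr f) [(f ^+ j * f)%g a]permM; case: j IH jd => [|j] IH jd; first by rewrite !perm1 st0.
    by have jd' := ltnW jd; rewrite IH // st ?na' ?na.
  by rewrite tpermD // eq_sym ?na' ?ny.
have Pd : (f1 ^+ d.+1)%g a' = a'.
  rewrite (expgSr f1) permM.
  have -> : f1 ((f1 ^+ d)%g a') = tperm a' y y.
    rewrite {2}/y (expgSr f) [(f ^+ d * f)%g a]permM; have [d0|d0] := posnP d; first by rewrite d0 !perm1 st0.
    by rewrite P ?d0 ?leqnn // st ?na' ?na ?d0 ?leqnn.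
  by rewrite tpermR.
have c : #|porbit f1 a'| = d.+1.
  by apply: card_porbit_eq => // j /andP[j0 jd]; rewrite P ?j0 // ?na'.
split=> // x; rewrite porbit_traject c => /trajectP[j jd ->]; rewrite -permX.
case: j jd => [|j] jd; first by rewrite perm1; left.
by right; rewrite P //; split; [exact: na|exact: mem_porbit].
Qed.

(** The permutation is corrected one point at a time, by transpositions. This allows isomorphisms to
    be permutations of the whole type of darts although only one component constrains them. *)
Lemma perm_extend (A : {set D}) (f : D -> D) : {in A &, injective f} ->
  exists g : {perm D}, {in A, g =1 f}.
Proof.
have [n] := ubnP #|A|; elim: n A => // n IH A /ltnSE le fi.
have [->|[x xA]] := set_0Vmem A; first by exists 1%g => x; rewrite inE.
have [||g gf] := IH (A :\ x); first by rewrite (cardsD1 x A) xA in le.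
  by move=> y z /setD1P[_ yA] /setD1P[_ zA]; exact: fi.
exists (g * tperm (g x) (f x))%g => y yA; rewrite permM.
have [->|yx] := eqVneq y x; first by rewrite tpermL.
have gy : g y = f y by apply: gf; rewrite !inE yx.
by rewrite tpermD // ?(inj_eq perm_inj) 1?eq_sym // gy; apply: contra_neq yx => /fi->.
Qed.

(** Commutation is required on the root component only: the isolated darts left by peeling, and the
    other components, are arbitrary. *)
Definition miso g s i a s' i' a' := g a = a' /\
  forall x, linked s i a x -> g (s x) = s' (g x) /\ g (i x) = i' (g x).

Definition iso_at g s i F a s' i' F' a' := miso g s i a s' i' a' /\
  forall x, linked s i a x -> (g x \in F') = (x \in F).

Lemma miso_linked g s i a s' i' a' x : miso g s i a s' i' a' ->
  linked s' i' a' (g x) = linked s i a x.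
Proof.
move=> [ga gc]; apply/idP/idP=> l; last first.
  suff /andP[]: linked s i a x && linked s' i' a' (g x) by [].
  apply: (linked_ind (P := fun y => linked s i a y && linked s' i' a' (g y)) _ _ l) => [u|u|].
  - case/andP=> lu lg; have [-> _] := gc u lu.
    by rewrite (linked_trans lu) ?linked_l // (linked_trans lg) // linked_l.
  - case/andP=> lu lg; have [_ ->] := gc u lu.
    by rewrite (linked_trans lu) ?linked_r // (linked_trans lg) // linked_r.
  - by rewrite ga !linked_refl.
suff h : linked s i a ((g^-1)%g (g x)) by rewrite permK in h.
apply: (linked_ind (P := fun y => linked s i a ((g^-1)%g y)) _ _ l) => [u lu|u lu|].
- have [e _] := gc _ lu; rewrite permKV in e; rewrite -e permK.
  by rewrite (linked_trans lu) // linked_l.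
- have [_ e] := gc _ lu; rewrite permKV in e; rewrite -e permK.
  by rewrite (linked_trans lu) // linked_r.
- by rewrite -ga permK linked_refl.
Qed.

Lemma miso_exp g s i a s' i' a' x n : miso g s i a s' i' a' -> linked s i a x ->
  g (((i * s) ^+ n)%g x) = ((i' * s') ^+ n)%g (g x).
Proof.
move=> [_ gc] l; elim: n => [|n IH]; first by rewrite !perm1.
rewrite !expgSr !permM -IH; set y := ((i * s) ^+ n)%g x.
have ly : linked s i a y.
  by apply: linked_trans l _; apply: porbit_face_linked; exact: mem_porbit.
have liy : linked s i a (i y) by rewrite (linked_trans ly) // linked_r.
by have [-> _] := gc _ liy; have [_ ->] := gc _ ly.
Qed.

Lemma miso_porbit g s i a s' i' a' x : miso g s i a s' i' a' -> linked s i a x ->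
  porbit (i' * s')%g (g x) = [set g y | y in porbit (i * s)%g x].
Proof.
move=> m l; apply/setP=> y; apply/porbitP/imsetP => [[n ->]|[z /porbitP[n ->] ->]].
  by exists (((i * s) ^+ n)%g x); rewrite ?mem_porbit // (miso_exp _ m).
by exists n; rewrite (miso_exp _ m).
Qed.

Lemma miso_mem_porbit g s i a s' i' a' x y : miso g s i a s' i' a' -> linked s i a x ->
  (g y \in porbit (i' * s')%g (g x)) = (y \in porbit (i * s)%g x).
Proof. by move=> m l; rewrite (miso_porbit m l) mem_imset //; exact: perm_inj. Qed.

Lemma miso_card_porbit g s i a s' i' a' x : miso g s i a s' i' a' -> linked s i a x ->
  #|porbit (i' * s')%g (g x)| = #|porbit (i * s)%g x|.
Proof. by move=> m l; rewrite (miso_porbit m l) card_imset //; exact: perm_inj. Qed.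

Lemma iso_at_del g s i F h s' i' F' h' : iso_at g s i F h s' i' F' h' ->
  i h = h -> s h != h ->
  iso_at g (del s h) i F (s h) (del s' h') i' F' (s' h').
Proof.
move=> [[gh gc] gF] ih sh.
have e : g (s h) = s' h' by rewrite -gh; case: (gc _ (linked_refl s i h)).
split; first split=> // x; last first.
  by move=> x; rewrite linked_del_root // => /andP[_]; exact: gF.
rewrite linked_del_root // => /andP[_ /gc[e1 e2]]; split=> //.
by rewrite /del !permM -e1 -gh inj_tperm ?gh ?e //; exact: perm_inj.
Qed.

Lemma iso_at_cut g s i F a s' i' F' a' : involutive i ->
  iso_at g s i F a s' i' F' a' ->
  iso_at g s (cut i a) F a s' (cut i' a') F' a' /\
  iso_at g s (cut i a) F (i a) s' (cut i' a') F' (i' a').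
Proof.
move=> ii [[ga gc] gF].
have e : g (i a) = i' a' by rewrite -ga; case: (gc _ (linked_refl s i a)).
have P x : linked s i a x -> g (s x) = s' (g x) /\ g (cut i a x) = cut i' a' (g x).
  move=> l; split; first by case: (gc _ l).
  rewrite /cut !permM.
  have -> : tperm a' (i' a') (g x) = g (tperm a (i a) x).
    by rewrite -e -[X in tperm X]ga -inj_tperm //; exact: perm_inj.
  suff /gc[_ ->] : linked s i a (tperm a (i a) x) by [].
  by case: tpermP => //; rewrite ?linked_r ?linked_refl.
have la x : linked s (cut i a) a x -> linked s i a x by rewrite (linked_cut_root s a x ii) => ->.
have lb x : linked s (cut i a) (i a) x -> linked s i a x.
  by rewrite (linked_cut_root s a x ii) orbC => ->.
split; split; [split=> // x /la /P //|by move=> x /la /gF|split=> // x /lb /P //|by move=> x /lb /gF].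
Qed.

Lemma miso_uncut g s i a s' i' a' : involutive i -> g a = a' -> g (i a) = i' a' ->
  (forall x, linked s i a x -> g (s x) = s' (g x) /\ g (cut i a x) = cut i' a' (g x)) ->
  miso g s i a s' i' a'.
Proof.
move=> ii ga gia P; split=> // x l; split; first by case: (P _ l).
rewrite -{1}(cutK i a) permM -[in RHS](cutK i' a') permM.
have -> : tperm a' (i' a') (g x) = g (tperm a (i a) x).
  by rewrite -gia -[X in tperm X]ga -inj_tperm //; exact: perm_inj.
suff /P[_ ->] : linked s i a (tperm a (i a) x) by [].
by case: tpermP => //; rewrite ?linked_r ?linked_refl.
Qed.

Lemma iso_at_cut_del g s i F a s' i' F' a' : rwf s i F a -> rwf s' i' F' a' ->
  i a \notin porbit (i * s)%g a ->
  iso_at g s i F a s' i' F' a' ->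
  iso_at g (del s (i a)) (cut i a) (F :\: porbit (i * s)%g (i a)) a
    (del s' (i' a')) (cut i' a') (F' :\: porbit (i' * s')%g (i' a')) a'.
Proof.
move=> w w' nf is0; have [ii nfx _ _] := w.
have ia : i a != a by apply: nfx; exact: linked_refl.
have [[[ga gc] _] _] := iso_at_cut ii is0; have [m gF] := is0.
have e : g (i a) = i' a' by case: m => <- h; case: (h _ (linked_refl s i a)).
have lia : linked s i a (i a) by exact: linked_r.
have l' x : linked (del s (i a)) (cut i a) a x -> linked s i a x /\ linked s (cut i a) a x.
  rewrite linked_cut_del // => /andP[_ l]; split=> //; move: l.
  rewrite (linked_cut_root s a x ii); case/orP=> //; apply: linked_trans.
  by apply: porbit_face_linked; rewrite face_cut_link.
split; first split=> // x.
  move=> /l'[l lc]; have [e1 e2] := gc _ lc; split=> //.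
  rewrite /del !permM -e1; have [e3 _] := m.2 _ lia; rewrite -e -e3.
  by rewrite inj_tperm //; exact: perm_inj.
by move=> x /l'[l _]; rewrite !inE gF // -e (miso_mem_porbit _ m).
Qed.

Lemma codes_iso t :
  (forall g s i F h s' i' F' h', wf s i F h -> wf s' i' F' h' ->
    iso_at g s i F h s' i' F' h' -> codes t s i F h -> codes t s' i' F' h') /\
  (forall g s i F a s' i' F' a', rwf s i F a -> rwf s' i' F' a' ->
    iso_at g s i F a s' i' F' a' -> rcodes t s i F a -> rcodes t s' i' F' a').
Proof.
have step t0 :
  (forall g s i F a s' i' F' a', rwf s i F a -> rwf s' i' F' a' ->
    iso_at g s i F a s' i' F' a' -> rcodes t0 s i F a -> rcodes t0 s' i' F' a') ->
  (forall g s i F h s' i' F' h', wf s i F h -> wf s' i' F' h' ->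
    iso_at g s i F h s' i' F' h' -> codes t0 s i F h -> codes t0 s' i' F' h').
  move=> R g s i F h s' i' F' h' w w' is0; rewrite !codesE.
  have e : (s' h' == h') = (s h == h).
    case: is0 => -[gh gc] _; have [e _] := gc _ (linked_refl s i h).
    by rewrite -gh -e (inj_eq perm_inj).
  rewrite e; have [sh|sh] := eqVneq (s h) h; first by case: t0 {R}.
  have sh' : s' h' != h' by rewrite e.
  have [_ ih _ _ _] := w.
  have := R _ _ _ _ _ _ _ _ _ (rwf_del w sh) (rwf_del w' sh') (iso_at_del is0 ih sh).
  by case: t0 {R}.
elim: t => [|b d t [IH _]|t1 [IH1 _] t2 [IH2 _]].
- by split=> //; exact: step.
- suff R : forall g s i F a s' i' F' a', rwf s i F a -> rwf s' i' F' a' ->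
    iso_at g s i F a s' i' F' a' -> rcodes (GNode1 b d t) s i F a -> rcodes (GNode1 b d t) s' i' F' a'.
    by split=> //; exact: step.
  move=> g s i F a s' i' F' a' w w' is0 /= /and4P[nf /eqP-> /eqP-> ct].
  have [m gF] := is0; have ga := m.1.
  have la := linked_refl s i a; have lia := linked_r s i a.
  have e : g (i a) = i' a' by rewrite -ga; case: (m.2 _ la).
  have nf' : i' a' \notin porbit (i' * s')%g a' by rewrite -e -[X in porbit _ X]ga (miso_mem_porbit _ m).
  rewrite nf' -e gF // eqxx (miso_card_porbit m) // eqxx e /=.
  exact: IH (wf_cut_del w nf) (wf_cut_del w' nf') (iso_at_cut_del w w' nf is0) ct.
- suff R : forall g s i F a s' i' F' a', rwf s i F a -> rwf s' i' F' a' ->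
    iso_at g s i F a s' i' F' a' -> rcodes (GNode2 t1 t2) s i F a -> rcodes (GNode2 t1 t2) s' i' F' a'.
    by split=> //; exact: step.
  move=> g s i F a s' i' F' a' w w' is0 /= /and3P[nl c1 c2].
  have [ii _ _ _] := w; have [is1 is2] := iso_at_cut ii is0.
  have e : g (i a) = i' a' by case: is0 => -[<- h] _; case: (h _ (linked_refl s i a)).
  have nl' : ~~ linked s' (cut i' a') a' (i' a') by rewrite -e (miso_linked _ is1.1).
  rewrite nl'; have [w1 w2] := wf_cut w nl; have [w1' w2'] := wf_cut w' nl'.
  by rewrite (IH1 _ _ _ _ _ _ _ _ _ w1 w1' is1 c1) (IH2 _ _ _ _ _ _ _ _ _ w2 w2' is2 c2).
Qed.

End Iso.

(** * Equal codes give isomorphic maps *)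

Section MkIso.
Variable D : finType.
Implicit Types (t : gtree) (s i f g : {perm D}) (x y z a h : D) (F : {set D}).

Lemma tperm_perm_eq g x y z : z != x -> g z != y -> (g * tperm (g x) y)%g z = g z.
Proof. by move=> zx gz; rewrite permM tpermD // eq_sym // (inj_eq perm_inj). Qed.

(** The isomorphism of the peeled maps ignores the removed half-edges. The transposition sends [h]
    to [h'] and changes no other image in the component, since those images lie in the peeled
    component, which excludes [h']. *)
Lemma iso_at_undel g s i F h s' i' F' h' :
  wf s i F h -> wf s' i' F' h' -> s h != h -> s' h' != h' ->
  iso_at g (del s h) i F (s h) (del s' h') i' F' (s' h') ->
  iso_at (g * tperm (g h) h')%g s i F h s' i' F' h'.
Proof.
move=> w w' sh sh' [m gF]; have [_ ih _ hF _] := w; have [_ ih' _ hF' _] := w'.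
set g' := (g * _)%g.
have gh : g' h = h' by rewrite permM tpermL.
have gx x : x != h -> linked s i h x -> g' x = g x /\ linked (del s h) i (s h) x.
  move=> xh l; have l' : linked (del s h) i (s h) x by rewrite linked_del_root // xh.
  split=> //; rewrite tperm_perm_eq //.
  by move: l'; rewrite -(miso_linked _ m) linked_del_root // => /andP[].
clearbody g'.
have gsh : g' (s h) = s' h' by have [-> _] := gx (s h) sh (linked_l _ _ _); exact: m.1.
split; first split=> // x l.
  have [->|xh] := eqVneq x h; first by rewrite ih gsh gh ih'.
  have [e l'] := gx x xh l; have [e1 e2] := m.2 _ l'.
  have ixh : i x != h by rewrite -ih (inj_eq perm_inj).
  have [e3 _] := gx (i x) ixh (linked_trans l (linked_r _ _ _)).
  split; last by rewrite e3 e2 e.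
  rewrite -{1}(del_mulK s h) -[in RHS](del_mulK s' h') permM [RHS]permM -gsh -{1}gh.
  rewrite inj_tperm; last exact: perm_inj.
  congr (tperm _ _ _); rewrite e -e1; set y := del s h x.
  have ly : linked (del s h) i (s h) y by rewrite (linked_trans l') // linked_l.
  by move: ly; rewrite linked_del_root // => /andP[yh ly]; case: (gx y yh ly).
move=> x l; have [->|xh] := eqVneq x h; first by rewrite gh (negPf hF) (negPf hF').
by have [-> /gF->] := gx x xh l.
Qed.

(** The images of the two pieces lie in different components of the cut target, so the two
    restrictions together are injective and extend to a permutation. *)
Lemma iso_at_glue g1 g2 s i F a s' i' F' a' : rwf s i F a -> rwf s' i' F' a' ->
  ~~ linked s (cut i a) a (i a) -> ~~ linked s' (cut i' a') a' (i' a') ->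
  iso_at g1 s (cut i a) F a s' (cut i' a') F' a' ->
  iso_at g2 s (cut i a) F (i a) s' (cut i' a') F' (i' a') ->
  exists g, iso_at g s i F a s' i' F' a'.
Proof.
move=> w w' nl nl' [m1 f1] [m2 f2]; have [ii _ _ _] := w.
pose A := [set x | linked s i a x].
pose f x := if linked s (cut i a) a x then g1 x else g2 x.
have lA x : linked s i a x = linked s (cut i a) a x || linked s (cut i a) (i a) x.
  exact: linked_cut_root.
have disj x y : linked s (cut i a) a x -> linked s (cut i a) (i a) y -> g1 x != g2 y.
  move=> lx ly; apply: contra nl' => /eqP e.
  rewrite -(miso_linked _ m1) e in lx; rewrite -(miso_linked _ m2) linked_sym in ly.
  exact: linked_trans lx ly.
have fi : {in A &, injective f}.
  move=> x y; rewrite !inE !lA /f.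
  case: (linked s (cut i a) a x) (disj x y) => [/(_ isT) d1 _|_ /= lx];
    case: (linked s (cut i a) a y) (disj y x) => [/= d2 _|_ /= ly].
  - exact: perm_inj.
  - by move=> e; have := d1 ly; rewrite e eqxx.
  - by move=> e; have := d2 isT lx; rewrite e eqxx.
  - exact: perm_inj.
have [g gf] := perm_extend fi.
have ga x : linked s (cut i a) a x -> g x = g1 x.
  by move=> l; rewrite gf ?inE ?lA ?l // /f l.
have gb x : linked s (cut i a) (i a) x -> g x = g2 x.
  move=> l; rewrite gf ?inE ?lA ?l ?orbT // /f; case: ifP => // l1.
  by case/negP: nl; rewrite (linked_trans l1) // linked_sym.
exists g; split; last first.
  by move=> x; rewrite lA => /orP[l|l]; [rewrite ga // f1|rewrite gb // f2].
apply: miso_uncut => //.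
- by rewrite ga ?linked_refl // m1.1.
- by rewrite gb ?linked_refl // m2.1.
move=> x; rewrite lA => /orP[l|l].
  have [e1 e2] := m1.2 _ l.
  by rewrite !ga // ?(linked_trans l) ?linked_l ?linked_r.
have [e1 e2] := m2.2 _ l.
by rewrite !gb // ?(linked_trans l) ?linked_l ?linked_r.
Qed.

Lemma iso_at_uncut_del g s i F a s' i' F' a' : rwf s i F a -> rwf s' i' F' a' ->
  i a \notin porbit (i * s)%g a -> i' a' \notin porbit (i' * s')%g a' ->
  (i a \in F) = (i' a' \in F') ->
  #|porbit (i * s)%g (i a)| = #|porbit (i' * s')%g (i' a')| ->
  iso_at g (del s (i a)) (cut i a) (F :\: porbit (i * s)%g (i a)) a
    (del s' (i' a')) (cut i' a') (F' :\: porbit (i' * s')%g (i' a')) a' ->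
  iso_at (g * tperm (g (i a)) (i' a'))%g s i F a s' i' F' a'.
Proof.
move=> w w' nf nf' eF ed [m gF]; have [ii nfx _ cF] := w; have [ii' nfx' _ cF'] := w'.
have ia : i a != a by apply: nfx; exact: linked_refl.
have ia' : i' a' != a' by apply: nfx'; exact: linked_refl.
set g' := (g * _)%g; set d := #|_| in ed; pose b := i a; pose b' := i' a'.
have gb : g' b = b' by rewrite permM tpermL.
have gx x : x != b -> linked s i a x -> g' x = g x /\ linked (del s b) (cut i a) a x.
  move=> xb l; have l' : linked (del s b) (cut i a) a x by rewrite linked_cut_del // xb.
  split=> //; rewrite tperm_perm_eq //.
  by move: l'; rewrite -(miso_linked _ m) linked_cut_del // => /andP[].
clearbody g'.
have ga : g' a = a' by have [|-> _] := gx a _ (linked_refl _ _ _); [rewrite eq_sym|exact: m.1].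
(* Deleting [b] forgets its place in the rotation. By [splice_face] this place is found [d] steps
   after [a] along the merged face, and the two degrees agree. *)
have gsb : g' (s b) = s' b'.
  have e1 : s b = ((cut i a * del s b) ^+ d)%g a.
    rewrite face_del ?cut_root' // face_cut splice_face // permM //.
  have e2 : s' b' = ((cut i' a' * del s' b') ^+ d)%g a'.
    rewrite ed face_del ?cut_root' // face_cut splice_face // permM //.
  rewrite e2 -[X in _ = _ X](m.1) -(miso_exp _ m) ?linked_refl // -e1.
  have := linked_refl (del s b) (cut i a) a.
  have ls : linked s i a (s b) by rewrite (linked_trans (linked_r _ _ _) (linked_l _ _ _)).
  have sb : s b != b.
    have l : linked s (cut i a) a b by apply: porbit_face_linked; rewrite face_cut_link.
    apply: contraTneq l => e; have := linked_del_id s a (cut_root' a ii).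
    by rewrite /del e tperm1 mulg1 linked_sym eq_sym (negPf ia) => ->.
  by case: (gx _ sb ls).
have mm : miso g' s i a s' i' a'.
  apply: miso_uncut => // x l.
  have dE : g' (del s b x) = del s' b' (g' x) /\ g' (cut i a x) = cut i' a' (g' x).
    have [->|xb] := eqVneq x b; first by rewrite gb !del_id !cut_root'.
    have [e l'] := gx x xb l; have [e1 e2] := m.2 _ l'; rewrite e -e1 -e2.
    have l1 : linked (del s b) (cut i a) a (del s b x) by rewrite (linked_trans l') ?linked_l.
    have l2 : linked (del s b) (cut i a) a (cut i a x) by rewrite (linked_trans l') ?linked_r.
    move: l1 l2; rewrite !linked_cut_del // => /andP[n1 l1] /andP[n2 l2].
    by have [-> _] := gx _ n1 l1; have [-> _] := gx _ n2 l2.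
  split; last exact: dE.2.
  rewrite -{1}(del_mulK s b) -[in RHS](del_mulK s' b') permM [RHS]permM -gsb -{1}gb.
  by rewrite -dE.1 inj_tperm //; exact: perm_inj.
split=> // x l; have lb : linked s i a b by exact: linked_r.
have := miso_mem_porbit x mm lb; rewrite gb => eG.
have [xG|xG] := boolP (x \in porbit (i * s)%g b).
  by rewrite (stable_under_porbit cF xG) (stable_under_porbit cF' (_ : _ \in porbit _ b')) ?eG.
have xb : x != b by apply: contraNneq xG => ->; exact: porbit_id.
have [e l'] := gx x xb l; have := gF _ l'; rewrite -e !inE -/b -/b' eG xG.
by [].
Qed.

Lemma codes_mkiso t :
  (forall s i F h s' i' F' h', wf s i F h -> wf s' i' F' h' ->
    codes t s i F h -> codes t s' i' F' h' -> exists g, iso_at g s i F h s' i' F' h') /\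
  (forall s i F a s' i' F' a', rwf s i F a -> rwf s' i' F' a' ->
    rcodes t s i F a -> rcodes t s' i' F' a' -> exists g, iso_at g s i F a s' i' F' a').
Proof.
have step t0 : t0 <> GLeaf ->
  (forall s i F a s' i' F' a', rwf s i F a -> rwf s' i' F' a' ->
    rcodes t0 s i F a -> rcodes t0 s' i' F' a' -> exists g, iso_at g s i F a s' i' F' a') ->
  (forall s i F h s' i' F' h', wf s i F h -> wf s' i' F' h' ->
    codes t0 s i F h -> codes t0 s' i' F' h' -> exists g, iso_at g s i F h s' i' F' h').
  move=> tl R s i F h s' i' F' h' w w'; rewrite !codesE => c c'.
  have {c} /andP[sh c] : (s h != h) && rcodes t0 (del s h) i F (s h) by case: t0 tl c {R c'}.
  have {c'} /andP[sh' c'] : (s' h' != h') && rcodes t0 (del s' h') i' F' (s' h').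
    by case: t0 tl c' {R c}.
  have [g is0] := R _ _ _ _ _ _ _ _ (rwf_del w sh) (rwf_del w' sh') c c'.
  by exists (g * tperm (g h) h')%g; exact: iso_at_undel.
elim: t => [|b d t [IH _]|t1 [IH1 _] t2 [IH2 _]].
- split=> // s i F h s' i' F' h' [ii ih fx hF cF] [ii' ih' fx' hF' cF'] /= /eqP sh /eqP sh'.
  have l x : linked s i h x -> x = h.
    move=> l; apply/eqP; apply: (linked_ind (P := pred1 h) _ _ l (eqxx _)) => u /eqP->.
      by rewrite /= sh.
    by rewrite /= ih.
  exists (tperm h h'); split; first split=> [|x /l ->]; rewrite ?tpermL ?ih ?sh ?ih' ?sh' ?tpermL //.
  by move=> x /l ->; rewrite tpermL (negPf hF) (negPf hF').
- suff R : forall s i F a s' i' F' a', rwf s i F a -> rwf s' i' F' a' ->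
    rcodes (GNode1 b d t) s i F a -> rcodes (GNode1 b d t) s' i' F' a' ->
    exists g, iso_at g s i F a s' i' F' a' by split=> //; exact: step.
  move=> s i F a s' i' F' a' w w' /= /and4P[nf /eqP e1 /eqP e2 c] /and4P[nf' /eqP e1' /eqP e2' c'].
  have [g is0] := IH _ _ _ _ _ _ _ _ (wf_cut_del w nf) (wf_cut_del w' nf') c c'.
  exists (g * tperm (g (i a)) (i' a'))%g; apply: iso_at_uncut_del => //.
    by rewrite -e1 -e1'.
  by rewrite -e2 -e2'.
- suff R : forall s i F a s' i' F' a', rwf s i F a -> rwf s' i' F' a' ->
    rcodes (GNode2 t1 t2) s i F a -> rcodes (GNode2 t1 t2) s' i' F' a' ->
    exists g, iso_at g s i F a s' i' F' a' by split=> //; exact: step.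
  move=> s i F a s' i' F' a' w w' /= /and3P[nl c1 c2] /and3P[nl' c1' c2'].
  have [w1 w2] := wf_cut w nl; have [w1' w2'] := wf_cut w' nl'.
  have [g1 is1] := IH1 _ _ _ _ _ _ _ _ w1 w1' c1 c1'.
  have [g2 is2] := IH2 _ _ _ _ _ _ _ _ w2 w2' c2 c2'.
  exact: iso_at_glue is1 is2.
Qed.

End MkIso.

(** * Every tree is the code of a planar map *)

Section Build.
Variable D : finType.
Implicit Types (t : gtree) (s i j f g : {perm D}) (x y z a h : D) (F A : {set D}).

(** [ndarts D] compensates for the fixed points. The points moved by [s2] are deleted from it one at
    a time. *)
Lemma ncyc_disjoint s1 s2 : (forall x, s2 x != x -> s1 x = x) ->
  ncyc (s1 * s2)%g + ndarts D = ncyc s1 + ncyc s2.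
Proof.
have [n] := ubnP #|[pred x | s2 x != x]|; elim: n s2 => // n IH s2 /ltnSE le dis.
have [x sx|id2] := pickP (fun x => s2 x != x); last first.
  have -> : s2 = 1%g by apply/permP=> x; rewrite perm1; apply/eqP; rewrite -[_ == _]negbK id2.
  by rewrite mulg1 ncyc1.
have mv y : del s2 x y != y -> (y != x) && (s2 y != y).
  rewrite delE; have [->|yx] /= := eqVneq y x; first by rewrite eqxx.
  by have [e _|//] := eqVneq (s2 y) x; rewrite e eq_sym.
have lt : #|[pred y | del s2 x y != y]| < n.
  apply: (leq_trans _ le); apply: proper_card; apply/properP; split.
    by apply/subsetP=> y; rewrite !inE => /mv /andP[].
  by exists x; rewrite !inE // del_id eqxx.
have := IH _ lt; rewrite (ncyc_del sx).
have -> : (s1 * del s2 x)%g = del (s1 * s2)%g x.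
  by rewrite /del mulgA permM dis.
rewrite ncyc_del; last by rewrite permM dis.
move=> h; have := h (fun y my => dis y (proj2 (andP (mv y my)))); clear; lia.
Qed.

Lemma subset_card_ex A a n : a \in A -> 0 < n <= #|A| ->
  exists B : {set D}, [/\ B \subset A, a \in B & #|B| = n].
Proof.
case: n => // n aA /= le; have [m em] : exists m, #|A| = n.+1 + m by exists (#|A| - n.+1); rewrite subnKC.
elim: m A aA em {le} => [|m IH] A aA em; first by exists A; rewrite em addn0.
have [x /setD1P[xa xA]] : exists x, x \in A :\ a.
  by apply/set0Pn; rewrite -card_gt0; have := cardsD1 a A; rewrite aA em; case: #|_|; lia.
have [||B [sB aB cB]] := IH (A :\ x).
- by rewrite !inE eq_sym xa.
- by have := cardsD1 x A; rewrite xA em; lia.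
by exists B; split=> //; apply: subset_trans sB (subD1set _ _).
Qed.

Lemma linked_perm_on A s i a x : perm_on A s -> perm_on A i -> a \in A ->
  linked s i a x -> x \in A.
Proof.
move=> os oi aA l; apply: (linked_ind (P := [in A]) _ _ l aA) => u uA /=.
  by rewrite (perm_closed _ os).
by rewrite (perm_closed _ oi).
Qed.

(* Euler's formula when all darts of [A] are linked and the other darts are isolated. *)
Definition planar_count A s i : Prop :=
  ncyc s + ncyc i + ncyc (i * s)%g + #|A|.*2 = (ndarts D).*2 + ndarts D + 2.

Definition built (A : {set D}) s i F :=
  [/\ perm_on A s, perm_on A i, F \subset A & planar_count A s i].

Lemma join_involutive j a b : involutive j -> j a = a -> j b = b ->
  involutive (tperm a b * j)%g /\ forall x, x != a -> x != b -> (tperm a b * j)%g x = j x.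
Proof.
move=> ij ja jb.
have e x : x != a -> x != b -> (tperm a b * j)%g x = j x.
  by move=> xa xb; rewrite permM tpermD // eq_sym.
split=> // x; have [->|xa] := eqVneq x a; first by rewrite !permM tpermL jb tpermR ja.
have [->|xb] := eqVneq x b; first by rewrite !permM tpermR ja tpermL jb.
have jxa : j x != a by rewrite -[X in _ != X]ja (inj_eq perm_inj).
have jxb : j x != b by rewrite -[X in _ != X]jb (inj_eq perm_inj).
by rewrite (e x xa xb) (e _ jxa jxb).
Qed.

Lemma build_undel t A s i F h a : t <> GLeaf -> h \in A -> a \in A :\ h ->
  built (A :\ h) s i F -> rwf s i F a -> (forall x, x \in A :\ h -> linked s i a x) ->
  rcodes t s i F a ->
  exists s' i' F', [/\ built A s' i' F', wf s' i' F' h,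
    (forall x, x \in A -> linked s' i' h x) & codes t s' i' F' h].
Proof.
move=> tl hA /setD1P[ah aA] [os oi sF pc] [ii nfx aF cF] lA c.
have out x : x \notin A :\ h -> s x = x /\ i x = x.
  by move=> nx; rewrite (out_perm os nx) (out_perm oi nx).
have [sh ih] : s h = h /\ i h = h by apply: out; rewrite !inE eqxx.
pose s' := (s * tperm h a)%g.
have s'h : s' h = a by rewrite permM sh tpermL.
have s'hh : s' h != h by rewrite s'h.
have ds : del s' h = s by rewrite /del s'h -mulgA tperm2 mulg1.
have lr x : linked s i a x = (x != h) && linked s' i h x.
  by rewrite -(linked_del_root x ih s'hh) ds s'h.
have hF : h \notin F by apply/negP=> /(subsetP sF); rewrite !inE eqxx.
exists s', i, F; split.
- have sub : A :\ h \subset A by exact: subD1set.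
  split; [| exact: subset_trans oi sub|exact: subset_trans sF sub|].
    apply/subsetP=> x; rewrite inE; apply: contraNT => nx.
    have xh : x != h by apply: contraNneq nx => ->.
    have xa : x != a by apply: contraNneq nx => ->.
    by rewrite permM (proj1 (out x _)) ?inE ?xh // tpermD // eq_sym.
  have fh : (i * s')%g h != h by rewrite permM ih.
  move: pc; rewrite /planar_count -ds face_del // (ncyc_del s'hh) (ncyc_del fh).
  by rewrite (cardsD1 h A) hA; clear; lia.
- split=> //.
  + move=> x l ix; apply/eqP; apply: contraT => xh.
    by have := nfx x; rewrite lr xh l ix eqxx => /(_ isT).
  + move=> x xF; have -> : (i * s')%g x = tperm h a ((i * s)%g x) by rewrite !permM.
    rewrite tpermD ?cF //.
      by apply: contraNneq hF => ->; exact: cF.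
    by apply: contraNneq aF => ->; exact: cF.
- move=> x xA; have [->|xh] := eqVneq x h; first exact: linked_refl.
  by have := lA x; rewrite !inE xh xA lr xh => /(_ isT).
- by rewrite codesE s'hh ds s'h c; case: t tl {c}.
Qed.

(** Supports being disjoint, products of permutations juxtapose the pieces, and an edge joining the
    half-edges [a] and [b] inverts the cut. The identity is an isomorphism from each piece to its
    copy in the product, so [codes_iso] transports the codes. *)
Lemma build_glue t1 t2 A1 A2 a b s1 i1 F1 s2 i2 F2 :
  [disjoint A1 & A2] -> a \in A1 -> b \in A2 ->
  built A1 s1 i1 F1 -> wf s1 i1 F1 a -> (forall x, x \in A1 -> linked s1 i1 a x) ->
  codes t1 s1 i1 F1 a ->
  built A2 s2 i2 F2 -> wf s2 i2 F2 b -> (forall x, x \in A2 -> linked s2 i2 b x) ->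
  codes t2 s2 i2 F2 b ->
  exists s i F, [/\ built (A1 :|: A2) s i F, rwf s i F a,
    (forall x, x \in A1 :|: A2 -> linked s i a x) & rcodes (GNode2 t1 t2) s i F a].
Proof.
move=> dA aA1 bA2 [os1 oi1 sF1 pc1] w1 l1 c1 [os2 oi2 sF2 pc2] w2 l2 c2.
have [ii1 i1a fx1 aF1 cF1] := w1; have [ii2 i2b fx2 bF2 cF2] := w2.
have n2 x : x \in A1 -> x \notin A2 by move=> xA; rewrite (disjointFr dA xA).
have n1 x : x \in A2 -> x \notin A1 by move=> xA; rewrite (disjointFl dA xA).
pose s := (s1 * s2)%g; pose j := (i1 * i2)%g; pose i := (tperm a b * j)%g.
pose F := F1 :|: F2.
have A1E x : x \in A1 -> [/\ s x = s1 x, j x = i1 x & (x \in F) = (x \in F1)].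
  move=> xA; rewrite /s /j !permM (out_perm os2) ?n2 ?(perm_closed _ os1) // (out_perm oi2) ?n2 ?(perm_closed _ oi1) //.
  by split=> //; rewrite inE (negPf (contra (subsetP sF2 x) (n2 x xA))) orbF.
have A2E : forall x, x \in A2 -> [/\ s x = s2 x, j x = i2 x & (x \in F) = (x \in F2)].
  move=> x xA; rewrite /s /j !permM (out_perm os1) ?n1 // (out_perm oi1) ?n1 //.
  by split=> //; rewrite inE (negPf (contra (subsetP sF1 x) (n1 x xA))).
have outE x : x \notin A1 -> x \notin A2 -> s x = x /\ j x = x.
  by move=> x1 x2; rewrite /s /j !permM !(out_perm os1, out_perm oi1, out_perm os2, out_perm oi2).
have ja : j a = a by have [_ -> _] := A1E a aA1.
have jb : j b = b by have [_ -> _] := A2E b bA2.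
have ab : a != b by apply: contraTneq bA2 => <-; exact: n2.
have ij : involutive j.
  move=> x; have [x1|x1] := boolP (x \in A1).
    have [_ e _] := A1E x x1; rewrite e; have [|_ -> _] := A1E (i1 x); last exact: ii1.
    by rewrite (perm_closed _ oi1).
  have [x2|x2] := boolP (x \in A2); last by have [_ e] := outE x x1 x2; rewrite !e.
  have [_ e _] := A2E x x2; rewrite e; have [|_ -> _] := A2E (i2 x); last exact: ii2.
  by rewrite (perm_closed _ oi2).
have [ii iE] := join_involutive ij ja jb; rewrite -/i in ii iE.
have ia : i a = b by rewrite permM tpermL.
have ib : i b = a by rewrite permM tpermR.
have ci : cut i a = j by rewrite /cut ia /i mulgA tperm2 mul1g.
have iso1 : iso_at 1 s1 i1 F1 a s j F a.
  split; first split=> [|x l]; first by rewrite perm1.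
    have [e1 e2 _] := A1E x (linked_perm_on os1 oi1 aA1 l).
    by rewrite !perm1 e1 e2.
  by move=> x l; rewrite perm1; have [_ _ ->] := A1E x (linked_perm_on os1 oi1 aA1 l).
have iso2 : iso_at 1 s2 i2 F2 b s j F b.
  split; first split=> [|x l]; first by rewrite perm1.
    have [e1 e2 _] := A2E x (linked_perm_on os2 oi2 bA2 l).
    by rewrite !perm1 e1 e2.
  by move=> x l; rewrite perm1; have [_ _ ->] := A2E x (linked_perm_on os2 oi2 bA2 l).
have la x : linked s j a x = linked s1 i1 a x by rewrite -(miso_linked x iso1.1) perm1.
have lb x : linked s j b x = linked s2 i2 b x by rewrite -(miso_linked x iso2.1) perm1.
have aF : a \notin F by have [_ _ ->] := A1E a aA1.
have bF : b \notin F by have [_ _ ->] := A2E b bA2.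
have cFj : stable_under (j * s)%g F.
  move=> x /setUP[xF|xF].
    have xA := subsetP sF1 x xF; have [_ e _] := A1E x xA.
    have iA : i1 x \in A1 by rewrite (perm_closed _ oi1).
    by have [e' _ _] := A1E _ iA; rewrite permM e e' inE -permM cF1.
  have xA := subsetP sF2 x xF; have [_ e _] := A2E x xA.
  have iA : i2 x \in A2 by rewrite (perm_closed _ oi2).
  by have [e' _ _] := A2E _ iA; rewrite permM e e' inE -[s2 _]permM cF2 ?orbT.
have wa : wf s j F a.
  split=> // x; rewrite la => l; have [_ -> _] := A1E x (linked_perm_on os1 oi1 aA1 l).
  exact: fx1.
have wb : wf s j F b.
  split=> // x; rewrite lb => l; have [_ -> _] := A2E x (linked_perm_on os2 oi2 bA2 l).
  exact: fx2.
have nl : ~~ linked s (cut i a) a (i a).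
  rewrite ci ia la; apply/negP=> /(linked_perm_on os1 oi1 aA1).
  by apply/negP; exact: n1.
have c1' : codes t1 s j F a by case: (codes_iso D t1) => h _; exact: h w1 wa iso1 c1.
have c2' : codes t2 s j F b by case: (codes_iso D t2) => h _; exact: h w2 wb iso2 c2.
exists s, i, F; split.
- have sub1 : A1 \subset A1 :|: A2 by exact: subsetUl.
  have sub2 : A2 \subset A1 :|: A2 by exact: subsetUr.
  split.
  + apply: perm_onM; [exact: subset_trans os1 sub1|exact: subset_trans os2 sub2].
  + apply: perm_onM.
      apply/subsetP=> x; rewrite !inE; case: tpermP => [->|->|]; rewrite ?aA1 ?bA2 ?orbT ?eqxx //.
    apply: perm_onM; [exact: subset_trans oi1 sub1|exact: subset_trans oi2 sub2].
  + by rewrite subUset (subset_trans sF1 sub1) (subset_trans sF2 sub2).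
  + have moved A' f x : perm_on A' f -> f x != x -> x \in A' by move=> o; exact: (subsetP o).
    have d1 : ncyc s + ndarts D = ncyc s1 + ncyc s2.
      by apply: ncyc_disjoint => x /(moved _ _ _ os2) /n1 nx; rewrite (out_perm os1).
    have d2 : ncyc j + ndarts D = ncyc i1 + ncyc i2.
      by apply: ncyc_disjoint => x /(moved _ _ _ oi2) /n1 nx; rewrite (out_perm oi1).
    have d3 : ncyc (j * s)%g + ndarts D = ncyc (i1 * s1)%g + ncyc (i2 * s2)%g.
      have -> : (j * s = (i1 * s1) * (i2 * s2))%g.
        rewrite /j /s; apply/permP=> x; rewrite !permM.
        have [x1|x1] := boolP (x \in A1).
          have y1 : i1 x \in A1 by rewrite (perm_closed _ oi1).
          have y2 : s1 (i1 x) \in A1 by rewrite (perm_closed _ os1).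
          by rewrite (out_perm oi2 (n2 _ y1)) (out_perm oi2 (n2 _ y2)).
        rewrite (out_perm oi1 x1) (out_perm os1 x1).
        have [x2|x2] := boolP (x \in A2); last by rewrite (out_perm oi2 x2) (out_perm os1 x1).
        by rewrite (out_perm os1) // n1 // (perm_closed _ oi2).
      apply: ncyc_disjoint => x mx; have nx : x \notin A1.
        apply/n1; apply: contraNT mx => nx; rewrite permM (out_perm oi2 nx) (out_perm os2 nx) //.
      by rewrite permM (out_perm oi1 nx) (out_perm os1 nx).
    have iaa : i a != a by rewrite ia eq_sym.
    have e1 := ncyc_cut ii iaa; have e2 := ncyc_face_cut s ii iaa.
    have fa : i a \in porbit (i * s)%g a.
      rewrite -[_ \in _]negbK -face_cut_link //; apply: contra nl; exact: porbit_face_linked.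
    rewrite fa ci addn0 in e2; rewrite ci in e1.
    have cA : #|A1 :|: A2| = #|A1| + #|A2|.
      by rewrite cardsU disjoint_setI0 // cards0 subn0.
    move: d1 d2 d3 e1 e2 pc1 pc2; rewrite /planar_count cA -/i; clear; lia.
- split=> //.
  + move=> x; rewrite (linked_cut_root s a x ii) ci ia.
    have [->|xa] := eqVneq x a; first by rewrite ia eq_sym ab.
    have [->|xb] := eqVneq x b; first by rewrite ib ab.
    rewrite iE // => /orP[l|l].
      by apply: contraNneq xa => e; apply/eqP; have [_ _ h _ _] := wa; exact: h.
    by apply: contraNneq xb => e; apply/eqP; have [_ _ h _ _] := wb; exact: h.
  + move=> x xF; rewrite permM iE -?permM ?cFj //.
      by apply: contraNneq aF => <-.
    by apply: contraNneq bF => <-.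
- move=> x; rewrite inE (linked_cut_root s a x ii) ci ia la lb.
  by case/orP=> [/l1->|/l2->]; rewrite ?orbT.
- by rewrite /= nl ci ia c1' c2'.
Qed.

(** The spare dart [c] becomes the other end of the root edge. It is inserted in the rotation just
    before [y], the point [d] steps after [a] along the root face; the stretch in between becomes
    the revealed face. *)
Lemma build_splice t b d A a c s2 j F2 : c \in A -> a \in A :\ c ->
  0 < d <= glab t + 1 ->
  built (A :\ c) s2 j F2 -> wf s2 j F2 a -> (forall x, x \in A :\ c -> linked s2 j a x) ->
  codes t s2 j F2 a ->
  exists s i F, [/\ built A s i F, rwf s i F a,
    (forall x, x \in A -> linked s i a x) & rcodes (GNode1 b d t) s i F a].
Proof.
move=> cA aA dn [os oi sF pc] w l2 c2; have [ij ja fx aF cF] := w.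
have [_ fs _ _] := (codes_stats D t).1 _ _ _ _ w c2.
have out x : x \notin A :\ c -> s2 x = x /\ j x = x.
  by move=> nx; rewrite (out_perm os nx) (out_perm oi nx).
have [sc jc] : s2 c = c /\ j c = c by apply: out; rewrite !inE eqxx.
have [ac aA'] := setD1P aA.
pose f2 := (j * s2)%g; pose y := (f2 ^+ d)%g a.
have f2c : f2 c = c by rewrite permM jc sc.
have yo : y \in porbit f2 a by exact: mem_porbit.
have yA : y \in A :\ c by apply: (linked_perm_on os oi aA); exact: porbit_face_linked.
have [yc yA'] := setD1P yA.
have yF : y \notin F2 by rewrite (stable_under_porbit cF yo).
pose s := (s2 * tperm c y)%g; pose i := (tperm a c * j)%g.
have [ii iE] := join_involutive ij ja jc; rewrite -/i in ii iE.
have ia : i a = c by rewrite permM tpermL.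
have ic : i c = a by rewrite permM tpermR.
have ci : cut i a = j by rewrite /cut ia /i mulgA tperm2 mul1g.
have sc' : s c = y by rewrite permM sc tpermL.
have ds : del s c = s2 by rewrite /del sc' -mulgA tperm2 mulg1.
have fE : (i * s)%g = (tperm a c * (f2 * tperm c y))%g by rewrite /i /s /f2 !mulgA.
(* Counting the half-edge [a], the root face has [glab t + 1] places: the largest degree that
   [gvalid] allows. *)
have dn' : 0 < d <= #|porbit f2 a| by move: fs; rewrite /size_face -/f2 => ->; move: dn; clear; lia.
have [cG inG] := unsplice_face f2c ac dn'; rewrite -/y -fE in cG inG.
set G := porbit (i * s)%g c in cG inG.
have cinG : c \in G by exact: porbit_id.
have aG : a \notin G by apply/negP=> /inG[e|[]]; rewrite ?e eqxx // in ac *.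
have GF x : x \in G -> x \notin F2.
  case/inG=> [->|[_ xo]]; last by rewrite (stable_under_porbit cF xo).
  by apply/negP=> /(subsetP sF); rewrite !inE eqxx.
pose F := if b then F2 :|: G else F2.
have FG : F :\: G = F2.
  apply/setP=> x; rewrite inE /F; clear F; case: b; rewrite ?inE; case: (boolP (x \in G)) => [/GF/negPf->|] //=;
    by rewrite ?orbF.
have bF : (c \in F) = b.
  by rewrite /F; clear F FG; case: b; rewrite ?inE ?cinG ?orbT // (negPf (GF _ cinG)).
have nf : i a \notin porbit (i * s)%g a by rewrite ia porbit_sym.
have iaa : i a != a by rewrite ia eq_sym.
have lE x : linked s2 j a x = (x != c) && linked s i a x.
  by have := linked_cut_del x ii iaa nf; rewrite ia ds ci.
have yG : G \subset A.
  apply/subsetP=> x /inG[->//|[_ xo]].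
  by have /setD1P[] : x \in A :\ c by apply: (linked_perm_on os oi aA); exact: porbit_face_linked.
have sub : A :\ c \subset A by exact: subD1set.
exists s, i, F; split.
- split.
  + apply: perm_onM; first exact: subset_trans os sub.
    by apply/subsetP=> x; rewrite !inE; case: tpermP => [->|->|]; rewrite ?eqxx.
  + apply: perm_onM; last exact: subset_trans oi sub.
    by apply/subsetP=> x; rewrite !inE; case: tpermP => [->|->|]; rewrite ?eqxx.
  + rewrite /F; clear F FG bF; case: b; rewrite ?subUset ?yG (subset_trans sF sub) //.
  + have e1 := ncyc_cut ii iaa; have e2 := ncyc_face_cut s ii iaa.
    rewrite nf ci in e2; rewrite ci in e1.
    have e3 : ncyc s2 = ncyc s + 1 by rewrite -ds ncyc_del // sc'.
    have e4 : ncyc (j * s2)%g = ncyc (j * s)%g + 1.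
      by rewrite -ds face_del // ncyc_del // permM jc sc'.
    move: e1 e3 e4 pc e2; rewrite /planar_count (cardsD1 c A) cA /=; clear; lia.
- split=> //.
  + move=> x l; have [->|xa] := eqVneq x a; first by rewrite ia eq_sym.
    have [->|xc] := eqVneq x c; first by rewrite ic.
    rewrite iE //; apply: contraNneq xa => e; apply/eqP; apply: fx => //.
    by rewrite lE xc.
  + by rewrite /F; clear F FG bF; case: b; rewrite ?inE ?negb_or aF ?aG.
  + have cF2 x : x \in F2 -> (i * s)%g x \in F2.
      move=> xF; have xc : x != c by apply: contraTneq xF => ->; exact: GF.
      have xa : x != a by apply: contraNneq aF => <-.
      rewrite fE permM tpermD 1?eq_sym // permM.
      have fF : f2 x \in F2 by exact: cF.
      rewrite tpermD //; first by apply: contraTneq fF => <-; exact: GF.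
      by apply: contraNneq yF => ->.
    rewrite /F; clear F FG bF; case: b => x; rewrite ?inE; last exact: cF2.
    case/orP=> [/cF2->//|xG]; apply/orP; right.
    rewrite -eq_porbit_mem; have := porbit_perm (i * s)%g 1 x; rewrite expg1 => ->.
    by rewrite eq_porbit_mem.
- move=> x xA; have [->|xc] := eqVneq x c; first by rewrite -ia linked_r.
  by have := l2 x; rewrite !inE xc xA lE xc => /(_ isT).
- by rewrite /= nf ia ci bF eqxx -/G cG eqxx FG ds c2.
Qed.

(** The set [A] of darts to be used is arbitrary, because a split divides it according to the sizes
    of the two subtrees. *)
Lemma build t : gvalid t ->
  (forall A h, h \in A -> #|A| = (gedges t).*2.+1 ->
    exists s i F, [/\ built A s i F, wf s i F h,
      (forall x, x \in A -> linked s i h x) & codes t s i F h]) /\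
  (t <> GLeaf -> forall A a, a \in A -> #|A| = (gedges t).*2 ->
    exists s i F, [/\ built A s i F, rwf s i F a,
      (forall x, x \in A -> linked s i a x) & rcodes t s i F a]).
Proof.
have step t0 : 0 < gedges t0 ->
  (t0 <> GLeaf -> forall A a, a \in A -> #|A| = (gedges t0).*2 ->
    exists s i F, [/\ built A s i F, rwf s i F a,
      (forall x, x \in A -> linked s i a x) & rcodes t0 s i F a]) ->
  (forall A h, h \in A -> #|A| = (gedges t0).*2.+1 ->
    exists s i F, [/\ built A s i F, wf s i F h,
      (forall x, x \in A -> linked s i h x) & codes t0 s i F h]).
  move=> e0 R A h hA cA; have tl : t0 <> GLeaf by move=> e; rewrite e in e0.
  have cA' : #|A :\ h| = (gedges t0).*2 by have := cardsD1 h A; rewrite hA cA; lia.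
  have [a aA] : exists a, a \in A :\ h by apply/set0Pn; rewrite -card_gt0 cA' double_gt0.
  have [s [i [F [bl w l c]]]] := R tl _ _ aA cA'.
  exact: build_undel tl hA aA bl w l c.
elim: t => [|b d t IH|t1 IH1 t2 IH2] v.
- split=> // A h hA /eqP; rewrite /= => /cards1P[z Az]; exists 1%g, 1%g, set0.
  move: hA; rewrite Az inE => /eqP <-; split.
  + split; rewrite ?perm_on1 ?sub0set //.
    by rewrite /planar_count mulg1 ncyc1 cards1; lia.
  + split=> [x||x l _||x]; rewrite ?perm1 ?inE //.
    by apply/eqP; apply: (linked_ind (P := pred1 h) _ _ l (eqxx _)) => u /eqP->; rewrite perm1 /=.
  + by move=> x; rewrite inE => /eqP->; exact: linked_refl.
  + by rewrite /= perm1.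
- case/and3P: v => d0 dl v; have [IHp _] := IH v.
  suff R : GNode1 b d t <> GLeaf -> forall A a, a \in A -> #|A| = (gedges (GNode1 b d t)).*2 ->
    exists s i F, [/\ built A s i F, rwf s i F a,
      (forall x, x \in A -> linked s i a x) & rcodes (GNode1 b d t) s i F a] by split=> //; exact: step.
  move=> _ A a aA cA.
  have [c /setD1P[ca cA']] : exists c, c \in A :\ a.
    by apply/set0Pn; rewrite -card_gt0; have := cardsD1 a A; rewrite aA cA /=; lia.
  have aA' : a \in A :\ c by rewrite !inE eq_sym ca.
  have cc : #|A :\ c| = (gedges t).*2.+1 by have := cardsD1 c A; rewrite cA' cA /=; lia.
  have [s [i [F [bl w l cd]]]] := IHp _ _ aA' cc.
  by apply: (build_splice b cA' aA' _ bl w l cd); rewrite d0.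
- case/andP: v => v1 v2; have [IHp1 _] := IH1 v1; have [IHp2 _] := IH2 v2.
  suff R : GNode2 t1 t2 <> GLeaf -> forall A a, a \in A -> #|A| = (gedges (GNode2 t1 t2)).*2 ->
    exists s i F, [/\ built A s i F, rwf s i F a,
      (forall x, x \in A -> linked s i a x) & rcodes (GNode2 t1 t2) s i F a] by split=> //; exact: step.
  move=> _ A a aA cA.
  have [|A1 [sA1 aA1 c1]] := @subset_card_ex A a (gedges t1).*2.+1 aA.
    by rewrite cA /= doubleS doubleD; lia.
  have c2 : #|A :\: A1| = (gedges t2).*2.+1.
    by rewrite cardsD (setIidPr sA1) cA c1 /= doubleS doubleD; lia.
  have [b bA2] : exists b, b \in A :\: A1 by apply/set0Pn; rewrite -card_gt0 c2.
  have [s1 [i1 [F1 [bl1 w1 l1 cd1]]]] := IHp1 _ _ aA1 c1.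
  have [s2 [i2 [F2 [bl2 w2 l2 cd2]]]] := IHp2 _ _ bA2 c2.
  have dis : [disjoint A1 & A :\: A1] by rewrite disjoint_sym -setI_eq0 setIDAC setDIl setDv setI0.
  have := build_glue dis aA1 bA2 bl1 w1 l1 cd1 bl2 w2 l2 cd2.
  have -> : A1 :|: (A :\: A1) = A by rewrite -{1}(setIidPr sA1) setID.
  by [].
Qed.

End Build.

(** * Counting isomorphism classes *)

Fixpoint gtree_code (t : gtree) : GenTree.tree (bool * nat) :=
  match t with
  | GLeaf => GenTree.Node 0 [::]
  | GNode1 b d t1 => GenTree.Node 1 [:: GenTree.Leaf (b, d); gtree_code t1]
  | GNode2 t1 t2 => GenTree.Node 2 [:: gtree_code t1; gtree_code t2]
  end.
Fixpoint gtree_decode (u : GenTree.tree (bool * nat)) : option gtree :=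
  match u with
  | GenTree.Node 0 [::] => Some GLeaf
  | GenTree.Node 1 [:: GenTree.Leaf (b, d); u1] => omap (GNode1 b d) (gtree_decode u1)
  | GenTree.Node 2 [:: u1; u2] =>
      obind (fun t1 => omap (GNode2 t1) (gtree_decode u2)) (gtree_decode u1)
  | _ => None
  end.
Lemma gtree_codeK : pcancel gtree_code gtree_decode.
Proof. by elim=> //= [b d t -> | t1 -> t2 ->]. Qed.

HB.instance Definition _ := Countable.copy gtree (pcan_type gtree_codeK).

(** [c] relates each object to a complete invariant, whose possible values are listed by [ts]. *)
Lemma card_classes (X : finType) (E : rel X) (S : {set X}) (Y : eqType)
    (ts : seq Y) (c : Y -> X -> bool) :
  equivalence_rel E -> uniq ts ->
  (forall x, x \in S -> exists2 t, t \in ts & c t x) ->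
  (forall t, t \in ts -> exists2 x, x \in S & c t x) ->
  (forall x y t, x \in S -> y \in S -> E x y -> c t x -> c t y) ->
  (forall x t t', x \in S -> c t x -> c t' x -> t = t') ->
  (forall x y t, x \in S -> y \in S -> c t x -> c t y -> E x y) ->
  #|equivalence_partition E S| = size ts.
Proof.
move=> eE uts ex1 ex2 cE cu cc; pose B t := [set x in S | c t x].
have Bi : {in ts &, injective B}.
  move=> t t' /ex2[x xS cx] t'ts e; have : x \in B t' by rewrite -e inE xS.
  by rewrite inE => /andP[_ cx']; exact: cu xS cx cx'.
have cB x t : x \in S -> c t x -> [set y in S | E x y] = B t.
  move=> xS cx; apply/setP=> y; rewrite !inE; case: (boolP (y \in S)) => //= yS.
  by apply/idP/idP=> [exy|cy]; [exact: cE exy cx|exact: cc cx cy].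
rewrite -(size_map B) -(card_uniqP _); last by rewrite map_inj_in_uniq.
apply: eq_card => C; apply/imsetP/mapP => [[x xS ->]|[t tts ->]].
  by have [t tts cx] := ex1 x xS; exists t => //; exact: cB.
by have [x xS cx] := ex2 t tts; exists x => //; rewrite (cB _ _ xS cx).
Qed.

Fixpoint plain (t : gtree) : bool :=
  match t with
  | GLeaf => true
  | GNode1 b d t1 => [&& ~~ b, d == 3 & plain t1]
  | GNode2 t1 t2 => plain t1 && plain t2
  end.

Fixpoint one_mark q (t : gtree) : bool :=
  match t with
  | GLeaf => false
  | GNode1 b d t1 => if b then (d == q) && plain t1 else (d == 3) && one_mark q t1
  | GNode2 t1 t2 => one_mark q t1 && plain t2 || plain t1 && one_mark q t2
  end.

Definition in_mark (b : bool) (d : nat) : nat := b.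
(** On valid codes its [gsum] vanishes exactly when marked faces have degree [q] and all other inner
    faces degree 3. *)
Definition bad_degree q (b : bool) (d : nat) : nat := d != if b then q else 3.

Fixpoint nmarks (t : gtree) : nat :=
  match t with
  | GLeaf => 0
  | GNode1 b _ t1 => b + nmarks t1
  | GNode2 t1 t2 => nmarks t1 + nmarks t2
  end.

Lemma plain_nmarks q t : gvalid t ->
  plain t = (nmarks t == 0) && (gsum (bad_degree q) t == 0).
Proof.
elim: t => //= [b d t IH /and3P[d0 _ /IH->]|t1 IH1 t2 IH2 /andP[/IH1-> /IH2->]].
  rewrite !addn_eq0 muln_eq0 /bad_degree !eqb0 negbK (gtn_eqF d0) /=.
  by case: b => //=; rewrite andbCA.
by rewrite !addn_eq0 andbACA.
Qed.

Lemma one_mark_nmarks q t : gvalid t ->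
  one_mark q t = (nmarks t == 1) && (gsum (bad_degree q) t == 0).
Proof.
elim: t => //= [b d t IH /and3P[d0 _ v]|t1 IH1 t2 IH2 /andP[v1 v2]].
  rewrite IH // (plain_nmarks q) // addn_eq0 muln_eq0 /bad_degree eqb0 negbK (gtn_eqF d0) /=.
  by case: b => /=; rewrite ?add1n ?add0n ?eqSS andbCA.
rewrite IH1 // IH2 // !(plain_nmarks q) // addn_eq0.
case: (nmarks t1) (nmarks t2) => [|[|m1]] [|[|m2]] //=; rewrite ?andbF ?orbF //.
Qed.

(** A marked set is seen through its number of darts; this converts that number into a number of
    marked faces. *)
Lemma gsum_in_mark q t : gvalid t -> gsum (bad_degree q) t = 0 ->
  gsum in_mark t = q * nmarks t.
Proof.
elim: t => //= [_ _|b d t IH /and3P[d0 _ v]|t1 IH1 t2 IH2 /andP[v1 v2]]; first by rewrite muln0.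
  move=> /eqP; rewrite addn_eq0 muln_eq0 (gtn_eqF d0) /= /bad_degree eqb0 negbK => /andP[/eqP-> /eqP/(IH v)->].
  by case: b; rewrite /in_mark /= mulnDr ?muln1 ?muln0.
by move/eqP; rewrite addn_eq0 => /andP[/eqP/(IH1 v1)-> /eqP/(IH2 v2)->]; rewrite mulnDr.
Qed.

Section Count.
Variable e : nat.
Implicit Types (M N : rooted_map e) (t : gtree) (F : {set 'I_(e.*2)}) (x : 'I_(e.*2)).

Definition rmcode t M F := rcodes t (rotate M) (reverse M) F (root M).
Definition rmwf M F := rwf (rotate M) (reverse M) F (root M).

Lemma sum_porbits (T : finType) (s : {perm T}) : \sum_(C in porbits s) #|C| = #|T|.
Proof.
have -> : porbits s = preim_partition (porbit s) [set: T].
  apply/setP=> F; apply/imsetP/imsetP => -[x _ ->]; exists x; rewrite ?inE //.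
    by apply/setP=> y; rewrite !inE eq_porbit_mem porbit_sym.
  by apply/setP=> y; rewrite !inE eq_porbit_mem porbit_sym.
by rewrite -(card_partition (preim_partitionP _ _)) cardsT.
Qed.

Lemma ncyc_involution (i : {perm 'I_(e.*2)}) : involutive i -> (forall x, i x != x) -> ncyc i = e.
Proof.
move=> ii nf; have := etrans (sum_porbits i) (card_ord _); rewrite (eq_bigr (fun=> 2)).
  by rewrite sum_nat_const -[in RHS]muln2 => /eqP; rewrite eqn_pmul2r // => /eqP.
move=> C /imsetP[x _ ->]; apply: card_porbit_eq => //.
  by rewrite expgS expg1 permM ii.
by case=> // -[|//] _; rewrite expg1.
Qed.

Lemma planar_mapP M : is_planar_map M ->
  [/\ involutive (reverse M), forall x, reverse M x != x,
    forall x y, linked (rotate M) (reverse M) x y & eulerian (rotate M) (reverse M)].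
Proof.
case/and4P=> /forallP nf /forallP ii /forallP co /eqP eu.
have ii' : involutive (reverse M) by move=> x; apply/eqP.
have l x y : linked (rotate M) (reverse M) x y by have /forallP h := co x; exact: h.
split=> //; rewrite /eulerian (ncyc_involution ii' nf).
have -> : ncomp (rotate M) (reverse M) = 1.
  apply/eqP/cards1P; exists [set: 'I_(e.*2)]; apply/setP=> K; rewrite inE.
  apply/imsetP/eqP => [[x _ ->]|->]; first by apply/setP=> y; rewrite !inE l.
  by exists (root M) => //; apply/setP=> y; rewrite !inE l.
have : ncyc (rotate M) + ncyc (right_walk M) = e + 2 by exact: eu.
rewrite /right_walk /ndarts card_ord; move: (ncyc _) (ncyc _) => m1 m2; clear; lia.
Qed.

Lemma root_linked M F x : is_planar_map M -> linked (rotate M) (reverse M) (root M) x.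
Proof. by case/planar_mapP. Qed.

Lemma rmcode_ex M F : is_planar_map M -> rmwf M F -> exists t, rmcode t M F.
Proof.
move=> pM w; have [_ _ _ eu] := planar_mapP pM.
by case: (exists_codes 'I_(e.*2) (#|[set x | linked (rotate M) (reverse M) (root M) x]|.+1)) => _ h; exact: h w eu (ltnSn _).
Qed.

Lemma rmcode_stats M F t : is_planar_map M -> rmwf M F -> rmcode t M F ->
  [/\ gvalid t, #|root_face M| = glab t, e = gedges t
    & forall u, \sum_(x | x \notin root_face M) u (x \in F) #|porbit (right_walk M) x| = gsum u t].
Proof.
move=> pM w c; have [v e1 e2 e3] := rcodes_stats w c; split=> //.
  have : size_comp (rotate M) (reverse M) (root M) = e.*2.
    rewrite -[RHS]card_ord -cardsT; apply: eq_card => x; rewrite !inE.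
    by rewrite (root_linked F).
  by rewrite e2 => /double_inj.
move=> u; rewrite -e3; apply: eq_bigl => x.
by rewrite (root_linked F).
Qed.

Lemma rmcode_build t : gvalid t -> t <> GLeaf -> gedges t = e ->
  exists M F, [/\ is_planar_map M, rmwf M F & rmcode t M F].
Proof.
move=> v tl te; have e0 : 0 < e.*2.
  by rewrite double_gt0 -te; case: t tl {v te}.
pose a := Ordinal e0; have [_ /(_ tl [set: 'I_(e.*2)] a)] := build 'I_(e.*2) v.
rewrite inE cardsT card_ord te => /(_ isT erefl) [s [i [F [[_ _ _ pc] w l c]]]].
exists (RootedMap s i a), F; split=> //; have [ii nf _ _] := w.
have lr x : linked s i a x by apply: l; rewrite inE.
have nf' x : i x != x by apply: nf.
apply/and4P; split; rewrite /=.
- by apply/forallP=> x; exact: nf'.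
- by apply/forallP=> x; rewrite ii.
- apply/forallP=> x; apply/forallP=> y; rewrite -/(linked s i x y).
  by apply: linked_trans (lr y); rewrite linked_sym.
- change (ncyc s + ncyc (i * s)%g == e + 2).
  move: pc; rewrite /planar_count (ncyc_involution ii nf') /ndarts cardsT card_ord.
  by move: (ncyc _) (ncyc _) => m1 m2; clear; lia.
Qed.

Lemma iso_at_maps M N F G (h : {perm 'I_(e.*2)}) :
  rotate N = (rotate M ^ h)%g -> reverse N = (reverse M ^ h)%g -> root N = h (root M) ->
  G = h @: F ->
  iso_at h (rotate M) (reverse M) F (root M) (rotate N) (reverse N) G (root N).
Proof.
move=> -> -> -> ->; split; first by split=> // x _; rewrite !permJ.
by move=> x _; rewrite mem_imset //; exact: perm_inj.
Qed.

Lemma maps_iso_at M N F G (h : {perm 'I_(e.*2)}) : is_planar_map M ->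
  iso_at h (rotate M) (reverse M) F (root M) (rotate N) (reverse N) G (root N) ->
  [/\ rotate N = (rotate M ^ h)%g, reverse N = (reverse M ^ h)%g, root N = h (root M) & G = h @: F].
Proof.
move=> pM [[hr hc] hF]; have l x : linked (rotate M) (reverse M) (root M) x by exact: root_linked.
split=> //.
- by apply/permP=> x; rewrite -[x](permKV h) permJ; case: (hc _ (l ((h^-1)%g x))).
- by apply/permP=> x; rewrite -[x](permKV h) permJ; case: (hc _ (l ((h^-1)%g x))).
- apply/setP=> x; rewrite -[x](permKV h) hF // mem_imset //; exact: perm_inj.
Qed.

Lemma rmwf_set0 M : is_planar_map M -> rmwf M set0.
Proof.
by case/planar_mapP=> ii nf _ _; split; rewrite ?inE // => x; rewrite inE.
Qed.

Lemma face_mem M x : porbit (right_walk M) x \in faces M.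
Proof. exact: imset_f. Qed.

Lemma root_face_eq M x :
  (porbit (right_walk M) x == root_face M) = (x \in root_face M).
Proof. by rewrite /root_face eq_porbit_mem. Qed.

Lemma rmwf_face M F0 : is_planar_map M -> F0 \in faces M -> F0 != root_face M -> rmwf M F0.
Proof.
case/planar_mapP=> ii nf _ _ /imsetP[x _ ->] nr; split=> // [|y].
  by rewrite porbit_sym -root_face_eq.
rewrite -!eq_porbit_mem => /eqP <-; rewrite eq_sym eq_porbit_mem.
by have := mem_porbit (right_walk M) 1 y; rewrite expg1 porbit_sym.
Qed.

Lemma rmwf_out M F x : rmwf M F -> x \in F -> x \notin root_face M.
Proof.
case=> _ _ rF cF xF; apply: contra rF => xr.
by rewrite -(stable_under_porbit cF xr).
Qed.

Lemma card_triangulation_classes n p (ts : seq gtree) : 0 < p -> e + p + 3 = 3 * n ->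
  uniq ts -> (forall t, (t \in ts) = [&& gvalid t, plain t, glab t == p & gedges t == e]) ->
  #|equivalence_partition (@map_iso e) [set M | is_triangulation n p M]| = size ts.
Proof.
move=> p0 en uts tsE.
apply: (@card_classes _ _ _ _ _ (fun t M => rmcode t M set0) (@map_iso_equiv e) uts).
- move=> M; rewrite inE => /and4P[pM nM /eqP pE /forall_inP deg].
  have w := rmwf_set0 pM; have [t c] := rmcode_ex pM w; exists t => //.
  have [v e1 e2 e3] := rmcode_stats pM w c.
  (* No face is marked here, so the degree asked of marked faces can be any; with 1, [gsum_in_mark]
     equates marked darts and marks. *)
  rewrite tsE v -e2 -e1 pE !eqxx (plain_nmarks 1) // !andbT /=.
  have bad : gsum (bad_degree 1) t = 0.
    rewrite -e3 big1 // => x xr; rewrite inE /bad_degree.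
    by have := deg _ (face_mem M x); rewrite root_face_eq xr /= => ->.
  have := gsum_in_mark v bad; rewrite mul1n => <-; rewrite bad -e3 big1 // => x _.
  by rewrite inE.
- move=> t; rewrite tsE => /and4P[v pt /eqP gp /eqP ge].
  have tl : t <> GLeaf by move=> tl; rewrite -gp tl in p0.
  have [M [F [pM w c]]] := rmcode_build v tl ge; have [_ e1 _ e3] := rmcode_stats pM w c.
  move: pt; rewrite (plain_nmarks 1) // => /andP[/eqP nm /eqP bad].
  (* The construction comes with some marked set; since the code has no mark, that set has no
     dart. *)
  have F0 : F = set0.
    apply/setP=> x; rewrite inE; apply/negP=> xF.
    have := e3 in_mark; rewrite (gsum_in_mark v bad) nm muln0 => /eqP.
    by rewrite sum_nat_eq0 => /forall_inP/(_ x (rmwf_out w xF)); rewrite xF.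
  rewrite F0 in c e3; exists M => //; rewrite inE.
  have tri : is_triangulation #|vertices M| p M.
    rewrite /is_triangulation pM eqxx e1 gp eqxx /=; apply/forall_inP=> G /imsetP[x _ ->].
    apply/implyP; rewrite root_face_eq => xr; move/eqP: bad; rewrite -e3 sum_nat_eq0.
    by move/forall_inP/(_ x xr); rewrite inE /bad_degree eqb0 negbK.
  (* Euler's formula recovers the number of vertices from the number of edges and the degree [p]. *)
  suff -> : n = #|vertices M| by [].
  have := triangulation_edges tri; rewrite en; clear; lia.
- move=> M N t; rewrite !inE => /and4P[pM _ _ _] /and4P[pN _ _ _].
  case/existsP=> h /and3P[/eqP r1 /eqP r2 /eqP r3] c.
  have i0 : iso_at h (rotate M) (reverse M) set0 (root M) (rotate N) (reverse N) set0 (root N).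
    by apply: iso_at_maps => //; rewrite imset0.
  by case: (codes_iso 'I_(e.*2) t) => _; apply; [| |exact: i0|exact: c]; exact: rmwf_set0.
- by move=> M t t'; rewrite inE => /and4P[pM _ _ _]; apply: rcodes_inj; exact: rmwf_set0.
- move=> M N t; rewrite !inE => /and4P[pM _ _ _] /and4P[pN _ _ _] c c'.
  have [h i0] := (codes_mkiso 'I_(e.*2) t).2 _ _ _ _ _ _ _ _ (rmwf_set0 pM) (rmwf_set0 pN) c c'.
  have [r1 r2 r3 _] := maps_iso_at pM i0.
  by apply/existsP; exists h; rewrite r1 r2 r3 !eqxx.
Qed.

Lemma card_triangulation2_classes n p q (ts : seq gtree) : 0 < p -> 0 < q ->
  e + p + q = 3 * n ->
  uniq ts -> (forall t, (t \in ts) = [&& gvalid t, one_mark q t, glab t == p & gedges t == e]) ->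
  #|equivalence_partition (@map_iso2 e) [set MF | is_triangulation2 n p q MF]| = size ts.
Proof.
move=> p0 q0 en uts tsE.
have triw (MF : rooted_map e * {set 'I_(e.*2)}) : is_triangulation2 n p q MF -> is_planar_map MF.1 /\ rmwf MF.1 MF.2.
  case: MF => M F0 /and5P[pM _ _ /and3P[f1 f2 _] _]; split=> //; exact: rmwf_face.
apply: (@card_classes _ _ _ _ _ (fun t MF => rmcode t MF.1 MF.2) (@map_iso2_equiv e) uts).
- move=> [M F0]; rewrite inE => tri; have [/= pM w] := triw _ tri.
  case/and5P: tri => _ nM /eqP pE /and3P[f1 f2 /eqP f3] /forall_inP deg.
  have [t c] := rmcode_ex pM w; exists t => //.
  have [v e1 e2 e3] := rmcode_stats pM w c.
  have FE x : x \in F0 -> porbit (right_walk M) x = F0.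
    by case/imsetP: f1 => y _ ->; rewrite -eq_porbit_mem => /eqP.
  have bad : gsum (bad_degree q) t = 0.
    rewrite -e3 big1 // => x xr; rewrite /bad_degree; case: (boolP (x \in F0)) => [/FE->|xF].
      by rewrite f3 eqxx.
    have := deg _ (face_mem M x); rewrite root_face_eq xr /=.
    suff -> : porbit (right_walk M) x != F0 by move=> /= ->.
    by apply: contraNneq xF => <-; exact: porbit_id.
  rewrite tsE v -e2 -e1 pE !eqxx one_mark_nmarks // bad eqxx !andbT /=.
  have := gsum_in_mark v bad; rewrite -e3.
  have -> : \sum_(x | x \notin root_face M) in_mark (x \in F0) #|porbit (right_walk M) x| = q.
    rewrite -f3 -sum1_card big_mkcond [RHS]big_mkcond; apply: eq_bigr => x _.
    by case: (boolP (x \in F0)) => [xF|_]; [rewrite (rmwf_out w xF)|case: ifP].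
  by rewrite -{1}[q]muln1 => /eqP; rewrite eqn_pmul2l // eq_sym.
- move=> t; rewrite tsE => /and4P[v pt /eqP gp /eqP ge].
  have tl : t <> GLeaf by move=> tl; rewrite -gp tl in p0.
  have [M [F [pM w c]]] := rmcode_build v tl ge; have [_ e1 _ e3] := rmcode_stats pM w c.
  move: pt; rewrite one_mark_nmarks // => /andP[/eqP nm /eqP bad].
  have deg x : x \notin root_face M -> #|porbit (right_walk M) x| = if x \in F then q else 3.
    move=> xr; move/eqP: bad; rewrite -e3 sum_nat_eq0.
    by move/forall_inP/(_ x xr); rewrite /bad_degree eqb0 negbK => /eqP.
  (* A single mark of degree [q] gives [q] marked darts; [F] contains a whole face of that degree,
     hence is that face. *)
  have cF : #|F| = q.
    rewrite -[RHS]muln1 -nm -(gsum_in_mark v bad) -e3 -sum1_card big_mkcond [RHS]big_mkcond.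
    apply: eq_bigr => x _.
    by case: (boolP (x \in F)) => [xF|_]; [rewrite (rmwf_out w xF)|case: ifP].
  have [x xF] : exists x, x \in F by apply/set0Pn; rewrite -card_gt0 cF.
  have FE : F = porbit (right_walk M) x.
    apply/esym/eqP; rewrite eqEcard cF deg ?(rmwf_out w) // xF leqnn andbT.
    by apply/subsetP=> y yx; have [_ _ _ st] := w; rewrite (stable_under_porbit st yx).
  exists (M, F) => //; rewrite inE.
  have tri : is_triangulation2 #|vertices M| p q (M, F).
    rewrite /is_triangulation2 pM eqxx e1 gp eqxx cF eqxx /=; apply/andP; split.
      by rewrite andbT {1}FE face_mem FE root_face_eq (rmwf_out w).
    apply/forall_inP=> G /imsetP[y _ ->]; apply/implyP; rewrite root_face_eq => /andP[yr yF].
    rewrite deg //; case: ifP => // yF'; case/eqP: yF.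
    by rewrite FE; apply/eqP; rewrite eq_porbit_mem -FE.
  suff -> : n = #|vertices M| by [].
  have := triangulation2_edges tri; rewrite en; clear; lia.
- move=> [M F] [N G] t; rewrite inE => /triw[/= pM wM]; rewrite inE => /triw[/= pN wN].
  case/existsP=> h /and4P[/eqP r1 /eqP r2 /eqP r3 /eqP r4] c.
  have i0 := iso_at_maps r1 r2 r3 r4.
  by case: (codes_iso 'I_(e.*2) t) => _; apply; [exact: wM|exact: wN|exact: i0|exact: c].
- by move=> [M F] t t'; rewrite inE => /triw[/= pM wM]; exact: rcodes_inj.
- move=> [M F] [N G] t; rewrite inE => /triw[/= pM wM]; rewrite inE => /triw[/= pN wN] c c'.
  have [h i0] := (codes_mkiso 'I_(e.*2) t).2 _ _ _ _ _ _ _ _ wM wN c c'.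
  have [r1 r2 r3 r4] := maps_iso_at pM i0.
  by apply/existsP; exists h; rewrite /= r1 r2 r3 r4 !eqxx.
Qed.

End Count.

(** * Enumerating trees *)

(** Leaves and label of the first subtree of a binary node. The two labels sum to [p - 2], so there
    are [p.-1] choices, none when [p = 1]. *)
Definition cells n p := [seq (m, i) | m <- iota 0 n.+1, i <- iota 0 p.-1].

Lemma mem_cells n p c : (c \in cells n p) = (c.1 <= n) && (c.2 < p.-1).
Proof.
case: c => m i; apply/allpairsP/andP => [[[m' i'] []]|[h1 h2]].
  by rewrite !mem_iota !add0n ltnS /= => h1 h2 [-> ->].
by exists (m, i); rewrite !mem_iota !add0n ltnS; split.
Qed.

Lemma uniq_cells n p : uniq (cells n p).
Proof. by apply: allpairs_uniq; rewrite ?iota_uniq // => -[? ?] [? ?] _ _ /= [-> ->]. Qed.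

Section TreeList.
Variables (X : eqType) (lf : X) (n1 : nat -> X -> X) (n2 : nat -> X -> X -> X).

Definition pair_list (g h : nat -> nat -> seq X) n p : seq X :=
  [seq n2 p u.1 u.2 | c <- cells n p,
    u <- [seq (t1, t2) | t1 <- g c.1 c.2, t2 <- h (n - c.1) (p - 2 - c.2)]].

(** [f] is fuel, a bound on the height: the unary case keeps [n] and increases [p]. The constructors
    are parameters because peeling codes and labelled trees follow the same recursion. *)
Fixpoint tlist f n p : seq X :=
  if f is f'.+1 then
    if p == 0 then (if n == 1 then [:: lf] else [::])
    else map (n1 p) (tlist f' n p.+1) ++ pair_list (tlist f') (tlist f') n p
  else [::].

Variable base : nat -> nat -> nat -> seq X.

(** Trees with one mark; [base] lists those that carry it at the root. *)
Fixpoint mlist f n p : seq X :=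
  if f is f'.+1 then
    base f' n p ++
    if p == 0 then [::]
    else map (n1 p) (mlist f' n p.+1) ++
      (pair_list (tlist f') (mlist f') n p ++ pair_list (mlist f') (tlist f') n p)
  else [::].

Lemma mem_pair_list g h n p t :
  reflect (exists t1 t2 m i, [/\ m <= n, i < p.-1, t1 \in g m i, t2 \in h (n - m) (p - 2 - i)
    & t = n2 p t1 t2]) (t \in pair_list g h n p).
Proof.
apply: (iffP allpairsPdep) => [[c [u [cc /allpairsP[[t1 t2] /= [h1 h2 ->]] ->]]]|].
  by exists t1, t2, c.1, c.2; move: cc; rewrite mem_cells => /andP[].
case=> t1 [t2 [m [i [h1 h2 h3 h4 ->]]]]; exists (m, i), (t1, t2); split=> //.
  by rewrite mem_cells h1 h2.
by apply/allpairsP; exists (t1, t2).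
Qed.

Lemma size_pair_list g h n p : size (pair_list g h n p) =
  \sum_(0 <= m < n.+1) \sum_(0 <= i < p.-1) size (g m i) * size (h (n - m) (p - 2 - i)).
Proof.
rewrite size_allpairs_dep sumnE big_map big_allpairs /= /index_iota !subn0.
by apply: eq_bigr => m _; apply: eq_bigr => i _; rewrite size_allpairs.
Qed.

Variables (lv lab : X -> nat) (mk : X -> bool).
Hypothesis n1_inj : forall p, injective (n1 p).
Hypothesis n2_inj : forall p t1 t2 t1' t2', n2 p t1 t2 = n2 p t1' t2' -> t1 = t1' /\ t2 = t2'.
Hypothesis n1_n2 : forall p t t1 t2, n1 p t <> n2 p t1 t2.
Hypothesis tlistP : forall f n p t, t \in tlist f n p -> [/\ lv t = n, lab t = p & ~~ mk t].

Lemma uniq_pair_list g h n p :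
  (forall n p t, t \in g n p -> lv t = n /\ lab t = p) ->
  (forall n p, uniq (g n p)) -> (forall n p, uniq (h n p)) -> uniq (pair_list g h n p).
Proof.
move=> gP ug uh; apply: allpairs_uniq_dep; first exact: uniq_cells.
  by move=> c _; apply: allpairs_uniq => // -[? ?] [? ?] _ _ [-> ->].
pose pairs (c : nat * nat) := [seq (t1, t2) | t1 <- g c.1 c.2, t2 <- h (n - c.1) (p - 2 - c.2)].
have gl_of v : v \in [seq @Tagged _ c (fun=> (X * X)%type) u | c <- cells n p, u <- pairs c] ->
    lv (tagged v).1 = (tag v).1 /\ lab (tagged v).1 = (tag v).2.
  case/allpairsPdep=> c [u [_ /allpairsP[[t1 t2] [mt _ ->]] ->]].
  exact: gP mt.
move=> v v' /gl_of[a1 a2] /gl_of[b1 b2] /= /n2_inj[].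
case: v v' a1 a2 b1 b2 => [[m i] [t1 t2]] [[m' i'] [t1' t2']] /= <- <- <- <-.
by move=> -> ->.
Qed.

Lemma uniq_tlist f n p : uniq (tlist f n p).
Proof.
elim: f n p => //= f IH n p; case: eqP => // _; first by case: ifP.
rewrite cat_uniq map_inj_uniq // IH uniq_pair_list ?andbT //=; last first.
  by move=> ? ? t /tlistP[].
by apply/hasPn=> t /mem_pair_list[t1 [t2 [_ [_ [_ _ _ _ ->]]]]]; apply/negP=> /mapP[t' _ /esym/n1_n2].
Qed.

Hypothesis mlistP : forall f n p t, t \in mlist f n p -> [/\ lv t = n, lab t = p & mk t].
Hypothesis base_uniq : forall f n p, uniq (base f n p).
Hypothesis base_n1 : forall f n p t s, n1 p t \in base f n p -> t \in s -> all (fun u => ~~ mk u) s.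
Hypothesis base_n2 : forall f n p t1 t2, n2 p t1 t2 \notin base f n p.

Lemma uniq_mlist f n p : uniq (mlist f n p).
Proof.
elim: f n p => //= f IH n p; rewrite cat_uniq base_uniq /=; apply/andP; split.
  case: eqP => // _; rewrite !has_cat !negb_or; apply/and3P; split; apply/hasPn=> t.
  - case/mapP=> t' t'm ->; apply/negP=> /base_n1 /(_ t'm) /allP/(_ t' t'm).
    by have [_ _ ->] := mlistP t'm.
  - by case/mem_pair_list=> t1 [t2 [_ [_ [_ _ _ _ ->]]]]; exact: base_n2.
  - by case/mem_pair_list=> t1 [t2 [_ [_ [_ _ _ _ ->]]]]; exact: base_n2.
case: eqP => // _; rewrite cat_uniq map_inj_uniq // IH /= cat_uniq; apply/and4P; split.
- rewrite has_cat negb_or; apply/andP; split; apply/hasPn=> t.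
    by case/mem_pair_list=> t1 [t2 [_ [_ [_ _ _ _ ->]]]]; apply/negP=> /mapP[t' _ /esym/n1_n2].
  by case/mem_pair_list=> t1 [t2 [_ [_ [_ _ _ _ ->]]]]; apply/negP=> /mapP[t' _ /esym/n1_n2].
- apply: uniq_pair_list; [|exact: uniq_tlist|exact: IH]; by move=> ? ? t /tlistP[].
- apply/hasPn=> t /mem_pair_list[t1 [t2 [m [i [_ _ /mlistP[_ _ mk1] _ ->]]]]].
  apply/negP=> /mem_pair_list[u1 [u2 [m' [i' [_ _ /tlistP[_ _ mk2] _ /n2_inj[e _]]]]]].
  by rewrite -e mk1 in mk2.
- apply: uniq_pair_list; [|exact: IH|exact: uniq_tlist]; by move=> ? ? t /mlistP[].
Qed.

End TreeList.

Fixpoint gleaves (t : gtree) : nat :=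
  match t with
  | GLeaf => 1
  | GNode1 _ _ t1 => gleaves t1
  | GNode2 t1 t2 => gleaves t1 + gleaves t2
  end.

Definition gl := tlist GLeaf (fun _ => GNode1 false 3) (fun _ => GNode2).
(** Revealing the marked face at boundary [p] leaves boundary [p + q - 2] and nothing more to
    mark. *)
Definition gbase q f n p := if p == 0 then [::] else map (GNode1 true q) (gl f n (p + q - 2)).
Definition gml q := mlist GLeaf (fun _ => GNode1 false 3) (fun _ => GNode2) (gbase q).

(** Euler's formula for triangulations, the leaves of a code being the vertices of the map. *)
Lemma gedges_plain t : gvalid t -> plain t -> gedges t + glab t + 3 = 3 * gleaves t.
Proof.
elim: t => //= [b d t IH /and3P[_ dl v] /and3P[_ /eqP d3 pt]|t1 IH1 t2 IH2 /andP[v1 v2] /andP[p1 p2]].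
  by have := IH v pt; rewrite d3 in dl *; lia.
by have := IH1 v1 p1; have := IH2 v2 p2; lia.
Qed.

Lemma gedges_one q t : gvalid t -> one_mark q t -> gedges t + glab t + q = 3 * gleaves t.
Proof.
elim: t => //= [b d t IH /and3P[_ dl v]|t1 IH1 t2 IH2 /andP[v1 v2]].
  case: b => /andP[/eqP d3 pt]; subst d.
    by have := gedges_plain v pt; lia.
  by have := IH v pt; lia.
case/orP=> /andP[p1 p2].
  by have := IH1 v1 p1; have := gedges_plain v2 p2; lia.
by have := gedges_plain v1 p1; have := IH2 v2 p2; lia.
Qed.

Fixpoint gheight (t : gtree) : nat :=
  match t with
  | GLeaf => 0
  | GNode1 _ _ t1 => (gheight t1).+1
  | GNode2 t1 t2 => (maxn (gheight t1) (gheight t2)).+1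
  end.

Lemma gheight_edges t : gheight t <= gedges t.
Proof. by elim: t => //= t1 h1 t2 h2; rewrite ltnS geq_max; apply/andP; split; lia. Qed.

Lemma mem_gl f n p t :
  (t \in gl f n p) = [&& gvalid t, plain t, glab t == p, gleaves t == n & gheight t < f].
Proof.
elim: f n p t => [|f IH] n p t; first by rewrite ltn0 !andbF.
rewrite /gl [tlist _ _ _ _ _ _]/= -/gl; case: eqP => [->|/eqP p0].
  transitivity ((n == 1) && (t == GLeaf)); first by case: eqP => //= _; rewrite inE.
  case: t => [|b d t|t1 t2] /=; rewrite ?andbT ?andbF.
  - by rewrite eq_sym.
  - apply/esym/negP=> /andP[/and3P[_ dl _] /and4P[/and3P[_ /eqP d3 _] /eqP l _ _]].
    by subst d; lia.
  - by rewrite addn2 /= !andbF.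
rewrite mem_cat; case: t => [|b d t|t1 t2] /=.
- rewrite [0 == p]eq_sym (negPf p0); apply/norP; split; first by apply/mapP=> -[].
  by apply/mem_pair_list=> -[t1 [t2 [m [i [_ _ _ _]]]]].
- apply/orP/andP => [[/mapP[t' + [-> -> ->]]|/mem_pair_list[? [? [? [? []]]]] //]|].
    rewrite IH => /and5P[-> -> /eqP-> -> e]; split; first by clear -p0; lia.
    by apply/and4P; split=> //; clear -p0; lia.
  case=> /and3P[_ dl v] /and4P[/and3P[b0 /eqP d3 pt] /eqP l1 l2 e]; left.
  rewrite d3 (negPf b0) mem_map; last by move=> ? ? [].
  by rewrite IH v pt l2 -ltnS e !andbT; apply/eqP; move: dl l1; rewrite d3; lia.
- rewrite ltnS gtn_max; apply/orP/idP => [[/mapP[] //|/mem_pair_list[u1 [u2 [m [i [mn ip + + [-> ->]]]]]]]|].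
    rewrite !IH => /and5P[-> -> /eqP-> /eqP-> ->] /and5P[-> -> /eqP-> /eqP-> ->] /=.
    by rewrite (subnKC mn) eqxx !andbT; apply/eqP; move: ip; clear; lia.
  case/and5P=> /andP[v1 v2] /andP[p1 p2] /eqP l1 /eqP l2 /andP[e1 e2]; right.
  apply/mem_pair_list; exists t1, t2, (gleaves t1), (glab t1).
  rewrite !IH v1 v2 p1 p2 e1 e2 !eqxx /= -l1 -l2 addKn leq_addr eqxx !andbT.
  by split=> //; [|apply/eqP]; clear; lia.
Qed.

Lemma mem_gml q f n p t : 0 < q ->
  (t \in gml q f n p) = [&& gvalid t, one_mark q t, glab t == p, gleaves t == n & gheight t < f].
Proof.
move=> q0; elim: f n p t => [|f IH] n p t; first by rewrite ltn0 !andbF.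
rewrite /gml [mlist _ _ _ _ _ _ _]/= -/(gml q) -/gl mem_cat /gbase; case: eqP => [->|/eqP p0].
  apply/esym/negP; case: t => [|b d t|t1 t2] //=; last by rewrite addn2 /= !andbF.
  by case/and5P=> /and3P[_ dl _]; case: b => /andP[/eqP d3 _] /eqP l _ _; subst d; lia.
rewrite !mem_cat; case: t => [|b d t|t1 t2] /=.
- apply/or4P=> -[/mapP[] //|/mapP[] //|/mem_pair_list|/mem_pair_list] [t1 [t2 [m [i [_ _ _ _]]]]] //.
- rewrite ltnS; apply/or4P/and5P => [[/mapP[t' + [-> -> ->]]|/mapP[t' + [-> -> ->]]| |]|].
  + rewrite mem_gl => /and5P[-> -> /eqP-> -> ->]; split=> //; rewrite ?eqxx //.
      by clear -p0 q0; lia.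
    by clear -p0 q0; lia.
  + by rewrite IH => /and5P[-> -> /eqP-> -> ->]; split=> //; clear -p0; lia.
  + by case/mem_pair_list=> ? [? [? [? []]]].
  + by case/mem_pair_list=> ? [? [? [? []]]].
  case=> /and3P[_ dl v] om /eqP l1 l2 e.
  case: b om => /andP[/eqP d3 pt]; subst d.
    constructor 1; rewrite mem_map; last by move=> ? ? [].
    by rewrite mem_gl v pt l2 e !andbT; apply/eqP; clear -dl l1; lia.
  constructor 2; rewrite mem_map; last by move=> ? ? [].
  by rewrite IH v pt l2 e !andbT; apply/eqP; clear -dl l1; lia.
- rewrite ltnS gtn_max; apply/or4P/and5P => [[/mapP[] //|/mapP[] //| |]|].
  + case/mem_pair_list=> u1 [u2 [m [i [mn ip + + [-> ->]]]]].
    rewrite mem_gl IH => /and5P[-> -> /eqP-> /eqP-> ->] /and5P[-> -> /eqP-> /eqP-> ->] /=.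
    by rewrite (subnKC mn) eqxx orbT; split=> //; apply/eqP; move: ip; clear; lia.
  + case/mem_pair_list=> u1 [u2 [m [i [mn ip + + [-> ->]]]]].
    rewrite mem_gl IH => /and5P[-> -> /eqP-> /eqP-> ->] /and5P[-> -> /eqP-> /eqP-> ->] /=.
    by rewrite (subnKC mn) eqxx; split=> //; apply/eqP; move: ip; clear; lia.
  case=> /andP[v1 v2] /orP[] /andP[p1 p2] /eqP l1 /eqP l2 /andP[e1 e2].
    constructor 4; apply/mem_pair_list; exists t1, t2, (gleaves t1), (glab t1).
    rewrite mem_gl IH v1 v2 p1 p2 e1 e2 !eqxx /= -l1 -l2 addKn leq_addr eqxx !andbT.
    by split=> //; [|apply/eqP]; clear; lia.
  constructor 3; apply/mem_pair_list; exists t1, t2, (gleaves t1), (glab t1).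
  rewrite mem_gl IH v1 v2 p1 p2 e1 e2 !eqxx /= -l1 -l2 addKn leq_addr eqxx !andbT.
  by split=> //; [|apply/eqP]; clear; lia.
Qed.

Lemma one_mark_plain q t : one_mark q t -> ~~ plain t.
Proof.
elim: t => //= [[] d t IH|t1 IH1 t2 IH2]; rewrite ?negb_and ?orbT //.
  by case/andP=> _ /IH ->; rewrite !orbT.
by case/orP=> /andP[]; [move=> /IH1-> //|move=> _ /IH2->; rewrite orbT].
Qed.

Lemma uniq_gl f n p : uniq (gl f n p).
Proof.
apply: (@uniq_tlist _ _ _ _ gleaves glab (fun t => ~~ plain t)) => //.
- by move=> _ ? ? [].
- by move=> _ ? ? ? ? [].
- by move=> f' n' p' t; rewrite mem_gl => /and5P[_ -> /eqP-> /eqP-> _].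
Qed.

Lemma uniq_gml q f n p : 0 < q -> uniq (gml q f n p).
Proof.
move=> q0; apply: (@uniq_mlist _ _ _ _ _ gleaves glab (fun t => ~~ plain t)) => //.
- by move=> _ ? ? [].
- by move=> _ ? ? ? ? [].
- by move=> f' n' p' t; rewrite mem_gl => /and5P[_ -> /eqP-> /eqP-> _].
- by move=> f' n' p' t; rewrite mem_gml // => /and5P[_ /one_mark_plain -> /eqP-> /eqP-> _].
- move=> f' n' p'; rewrite /gbase; case: eqP => // _; rewrite map_inj_uniq ?uniq_gl // => ? ? [].
  by [].
- by move=> f' n' p' t s; rewrite /gbase; case: eqP => // _ /mapP[].
- by move=> f' n' p' t1 t2; rewrite /gbase; case: eqP => // _; apply/negP=> /mapP[].
Qed.

(** * Lists of the labelled trees counted by [B] *)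

Definition pl := tlist (Leaf false 0) Node1 Node2.
Definition dbase r (f n p : nat) := if (n == 0) && (p == r) then [:: Leaf true r] else [::].
Definition dl r := mlist (Leaf false 0) Node1 Node2 (dbase r).

(** Here trees and maps meet: labelled trees without distinguished leaf obey the same recursion as
    plain codes, hence are counted by [T]. *)
Lemma size_pl f n p : size (pl f n p) = size (gl f n p).
Proof.
elim: f n p => //= f IH n p; rewrite /pl /gl /=; case: eqP => // _; first by case: ifP.
rewrite !size_cat !size_map -/pl -/gl !size_pair_list IH; congr (_ + _).
by apply: eq_bigr => m _; apply: eq_bigr => i _; rewrite !IH.
Qed.

Fixpoint lheight (t : ltree) : nat :=
  match t with
  | Leaf _ _ => 0
  | Node1 _ t1 => (lheight t1).+1
  | Node2 _ t1 t2 => (maxn (lheight t1) (lheight t2)).+1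
  end.

Lemma lheight_size t : lheight t <= inner_size t.
Proof. by elim: t => //= l t1 h1 t2 h2; rewrite ltnS geq_max; apply/andP; split; lia. Qed.

Lemma cat_nseqP (T : eqType) (z : T) s1 s2 n : s1 ++ s2 = nseq n z ->
  [/\ size s1 <= n, s1 = nseq (size s1) z & s2 = nseq (n - size s1) z].
Proof.
move=> e; have : all (pred1 z) (s1 ++ s2) by rewrite e all_pred1_nseq.
have : size (s1 ++ s2) = n by rewrite e size_nseq.
rewrite size_cat all_cat => <- /andP[/all_pred1P e1 /all_pred1P e2].
by rewrite leq_addr addKn.
Qed.

Lemma perm_nseqE (T : eqType) (z : T) s n : perm_eq s (nseq n z) -> s = nseq n z.
Proof.
move=> e; have /all_pred1P -> : all (pred1 z) s by rewrite (perm_all _ e) all_pred1_nseq.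
by rewrite (perm_size e) size_nseq.
Qed.

Lemma perm_cat_mem (T : eqType) (a z : T) s1 s2 n :
  a \in s1 -> perm_eq (s1 ++ s2) (a :: nseq n z) ->
  exists2 m, m <= n & perm_eq s1 (a :: nseq m z) /\ s2 = nseq (n - m) z.
Proof.
move=> as1 pe; have p1 := perm_to_rem as1.
have : perm_eq (a :: (rem a s1 ++ s2)) (a :: nseq n z).
  by rewrite perm_sym (perm_trans _ (perm_cat p1 (perm_refl s2))) // perm_sym.
rewrite perm_cons => /perm_nseqE /cat_nseqP[le e1 e2].
by exists (size (rem a s1)) => //; split=> //; rewrite (perm_trans p1) // perm_cons -e1.
Qed.

(** Used at a binary node: one subtree carries the distinguished leaf, the other only leaves of
    label 0. *)
Lemma perm_catP (T : eqType) (a z : T) s1 s2 n :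
  perm_eq (s1 ++ s2) (a :: nseq n z) ->
  (exists2 m, m <= n & s1 = nseq m z /\ perm_eq s2 (a :: nseq (n - m) z)) \/
  (exists2 m, m <= n & perm_eq s1 (a :: nseq m z) /\ s2 = nseq (n - m) z).
Proof.
move=> pe; have : a \in s1 ++ s2 by rewrite (perm_mem pe) inE eqxx.
rewrite mem_cat => /orP[as1|as2]; [right; exact: perm_cat_mem as1 pe|left].
have [|m le [e1 e2]] := perm_cat_mem as2 (_ : perm_eq (s2 ++ s1) (a :: nseq n z)).
  by rewrite perm_catC.
by exists (n - m); rewrite ?leq_subr // e2 subKn.
Qed.

Lemma mem_pl f n p t :
  (t \in pl f n p) = [&& label_rule t, label t == p, leaves t == nseq n (false, 0) & lheight t < f].
Proof.
elim: f n p t => [|f IH] n p t; first by rewrite ltn0 !andbF.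
rewrite /pl [tlist _ _ _ _ _ _]/= -/pl; case: eqP => [->|/eqP p0].
  transitivity ((n == 1) && (t == Leaf false 0)); first by case: eqP => //= _; rewrite inE.
  case: t => [b l|l t|l t1 t2] /=; rewrite ?andbT ?andbF.
  - apply/andP/andP => [[/eqP-> /eqP[-> ->]] //|[/eqP-> /eqP]].
    by case: n => [|[|n]] //= [->].
  - by rewrite lt0n; case: (l == 0); rewrite ?andbF.
  - by rewrite lt0n; case: (l == 0); rewrite ?andbF.
rewrite mem_cat; case: t => [b l|l t|l t1 t2] /=.
- transitivity false.
    apply/norP; split; first by apply/mapP=> -[].
    by apply/mem_pair_list=> -[t1 [t2 [m [i [_ _ _ _]]]]].
  apply/esym/negP=> /and3P[/eqP-> /eqP + _]; case: n => // n [_ e _].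
  by rewrite e in p0.
- apply/orP/idP => [[/mapP[t' + [-> ->]]|/mem_pair_list[? [? [? [? []]]]] //]|].
    by rewrite IH addn1 ltnS eqxx lt0n p0 => /and4P[-> -> -> ->].
  case/and4P=> /and3P[l0 l1 r] /eqP lp lv e; left.
  rewrite addn1 in l1; rewrite -lp mem_map; last by move=> ? ? [].
  by rewrite IH l1 r lv ?eqxx -ltnS e.
- rewrite ltnS gtn_max; apply/orP/idP => [[/mapP[] //|/mem_pair_list[u1 [u2 [m [i [mn ip + + [-> -> ->]]]]]]]|].
    rewrite !IH => /and4P[-> /eqP-> /eqP-> ->] /and4P[-> /eqP-> /eqP-> ->] /=.
    rewrite -nseqD (subnKC mn) !eqxx !andbT lt0n p0 /=; apply/eqP; move: ip; clear; lia.
  case/and4P=> /and4P[l0 /eqP l1 r1 r2] /eqP lp /eqP lv /andP[e1 e2]; right.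
  have [le s1 s2] := cat_nseqP lv.
  apply/mem_pair_list; exists t1, t2, (size (leaves t1)), (label t1).
  rewrite !IH r1 r2 e1 e2 -s1 -s2 !eqxx /= le -lp; split=> //; rewrite -?l1 ?andbT.
    by clear; lia.
  by apply/eqP; clear; lia.
Qed.

Lemma mem_dl r f n p t : 0 < r ->
  (t \in dl r f n p) = is_peeling_tree n p r t && (lheight t < f).
Proof.
move=> r0; elim: f n p t => [|f IH] n p t; first by rewrite ltn0 !andbF.
rewrite /dl [mlist _ _ _ _ _ _ _]/= -/(dl r) -/pl mem_cat.
have bE : (t \in dbase r f n p) = [&& n == 0, p == r & t == Leaf true r].
  by rewrite /dbase; case: eqP => //= _; case: eqP => //= _; rewrite inE.
rewrite bE /is_peeling_tree; case: t {bE} => [b l|l t|l t1 t2] /=.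
- transitivity [&& n == 0, p == r & Leaf b l == Leaf true r].
    apply/orb_idr; case: eqP => // _; rewrite !mem_cat => /or3P[/mapP[] //|/mem_pair_list|/mem_pair_list];
    by case=> ? [? [? [? []]]].
  rewrite andbT; apply/and3P/andP => [[/eqP-> /eqP-> /eqP[-> ->]] //|[/eqP-> pe]].
  have /= := perm_size pe; rewrite size_nseq => -[] n0; rewrite -n0 in pe *.
  have : (true, r) \in [:: (b, p)] by rewrite (perm_mem pe) inE eqxx.
  by rewrite inE => /eqP[<- <-].
- rewrite !andbF /=; case: eqP => [->|/eqP p0].
    by rewrite in_nil lt0n; case: (l == 0); rewrite /= ?andbF.
  rewrite !mem_cat ltnS; apply/or3P/idP => [[/mapP[t' + [-> ->]]|/mem_pair_list[? [? [? [? []]]]] //|/mem_pair_list[? [? [? [? []]]]] //]|].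
    by rewrite IH addn1 eqxx lt0n p0 => /andP[/and3P[-> -> ->] ->].
  case/andP=> /and3P[/and3P[l0 l1 rr] /eqP lp lv] e; constructor 1.
  rewrite addn1 in l1; rewrite -lp mem_map; last by move=> ? ? [].
  by rewrite IH /is_peeling_tree l1 rr lv e.
- rewrite !andbF /=; case: eqP => [->|/eqP p0].
    by rewrite in_nil lt0n; case: (l == 0); rewrite /= ?andbF.
  rewrite !mem_cat ltnS gtn_max; apply/or3P/idP => [[/mapP[] //| |]|].
  + case/mem_pair_list=> u1 [u2 [m [i [mn ip + + [-> -> ->]]]]].
    rewrite mem_pl IH => /and4P[-> /eqP-> /eqP-> ->] /andP[/and3P[-> /eqP-> pe] ->] /=.
    rewrite eqxx !andbT lt0n p0 /=; apply/andP; split; first by apply/eqP; move: ip; clear; lia.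
    have -> : nseq n (false, 0) = nseq m (false, 0) ++ nseq (n - m) (false, 0).
      by rewrite -nseqD subnKC.
    rewrite -[X in perm_eq _ X]cat1s (perm_trans (perm_cat (perm_refl _) pe)) //.
    by rewrite -cat1s perm_catCA.
  + case/mem_pair_list=> u1 [u2 [m [i [mn ip + + [-> -> ->]]]]].
    rewrite mem_pl IH => /andP[/and3P[-> /eqP-> pe] ->] /and4P[-> /eqP-> /eqP-> ->] /=.
    rewrite eqxx !andbT lt0n p0 /=; apply/andP; split; first by apply/eqP; move: ip; clear; lia.
    have -> : nseq n (false, 0) = nseq m (false, 0) ++ nseq (n - m) (false, 0).
      by rewrite -nseqD subnKC.
    by rewrite (perm_trans (perm_cat pe (perm_refl _))).
  case/andP=> /and3P[/and4P[l0 /eqP l1 r1 r2] /eqP lp lv] /andP[e1 e2].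
  case/perm_catP: lv => -[m mn [h1 h2]].
    constructor 2; apply/mem_pair_list; exists t1, t2, m, (label t1).
    rewrite mem_pl IH /is_peeling_tree r1 r2 e1 e2 h1 h2 !eqxx /= -lp; split=> //; rewrite -?l1 ?andbT.
      by clear; lia.
    by apply/eqP; clear; lia.
  constructor 3; apply/mem_pair_list; exists t1, t2, m, (label t1).
  rewrite mem_pl IH /is_peeling_tree r1 r2 e1 e2 h1 h2 !eqxx /= -lp; split=> //; rewrite -?l1 ?andbT.
    by clear; lia.
  by apply/eqP; clear; lia.
Qed.

(** * Recurrences and generating series *)

Lemma uniq_dl r f n p : 0 < r -> uniq (dl r f n p).
Proof.
move=> r0; apply: (@uniq_mlist _ _ _ _ _ (fun t => count (pred1 (false, 0)) (leaves t)) label (fun t => has fst (leaves t))) => //.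
- by move=> ? ? ? [].
- by move=> ? ? ? ? ? [].
- move=> f' n' p' t; rewrite mem_pl => /and4P[_ /eqP-> /eqP-> _].
  by rewrite count_nseq has_nseq andbF /= ?eqxx ?mul1n.
- move=> f' n' p' t; rewrite mem_dl // => /andP[/and3P[_ /eqP-> pe] _].
  have /seq.permP -> := pe; rewrite (perm_has _ pe) /= count_nseq /= ?eqxx ?mul1n.
  by split.
- by move=> f' n' p'; rewrite /dbase; case: ifP.
- by move=> f' n' p' t s; rewrite /dbase; case: ifP.
- by move=> f' n' p' t1 t2; rewrite /dbase; case: ifP.
Qed.

(** * The numbers [T], [T2] and [B] as sizes of lists *)

Lemma size_gl_stable f n p : 3 * n <= f -> size (gl f n p) = size (gl (3 * n) n p).
Proof.
move=> le; apply/perm_size/uniq_perm; rewrite ?uniq_gl // => t; rewrite !mem_gl.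
case v: (gvalid t) => //=; case pt: (plain t) => //=; case: eqP => //= _; case: eqP => //= en.
have := gedges_plain v pt; have := gheight_edges t; rewrite en => h1 h2.
by apply/idP/idP=> _; lia.
Qed.

Lemma T_size f n p : 3 * n <= f -> T n p = size (gl f n p).
Proof.
move=> le; rewrite size_gl_stable // /T; case: eqP => [->|/eqP p0].
  by case: n {le} => // n; rewrite mulnS /gl /=; case: ifP.
have cl (e : 'I_(3 * n)) : #|equivalence_partition (@map_iso e) [set M | is_triangulation n p M]|
    = if e + p + 3 == 3 * n then size (gl (3 * n) n p) else 0.
  case: eqP => [en|ne].
    apply: card_triangulation_classes; rewrite ?lt0n ?uniq_gl // => t; rewrite mem_gl.
    case v: (gvalid t) => //=; case pt: (plain t) => //=; case: eqP => //= gp.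
    have := gedges_plain v pt; have := gheight_edges t; rewrite gp => h1 h2.
    apply/andP/eqP=> [[/eqP e1 _]|e1]; first by move: en; clear -h2 e1; lia.
    by split; [apply/eqP|]; clear -en h1 h2 e1; lia.
  have -> : [set M : rooted_map e | is_triangulation n p M] = finset.set0.
    apply/setP=> M; rewrite !inE; apply/negP=> /triangulation_edges; exact: ne.
  apply/eqP; rewrite cards_eq0; apply/eqP/setP=> C; rewrite inE; apply/negP=> /imsetP[x].
  by rewrite inE.
(* Only [e = 3 * n - (p + 3)] contributes; when this difference would be negative, there is no code
   either. *)
rewrite (eq_bigr _ (fun e _ => cl e)).
have [le3|lt3] := leqP (p + 3) (3 * n).
  have lt : 3 * n - (p + 3) < 3 * n by clear -le3 p0; lia.
  rewrite (bigD1 (Ordinal lt)) //= big1 ?addn0.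
    by case: eqP => // ne; case: ne; clear -le3; lia.
  move=> e ne; case: eqP => // en; case/eqP: ne; apply/val_inj => /=; clear -en; lia.
rewrite big1 => [|e _]; last by case: eqP => // en; exfalso; clear -en lt3; lia.
case gE: (gl _ _ _) => [//|t s]; have : t \in gl (3 * n) n p by rewrite gE inE eqxx.
rewrite mem_gl => /and5P[v pt /eqP gp /eqP en _].
by have := gedges_plain v pt; rewrite gp en; clear -lt3; lia.
Qed.

Lemma size_gml_stable q f n p : 0 < q -> 0 < p -> 3 * n <= f ->
  size (gml q f n p) = size (gml q (3 * n) n p).
Proof.
move=> q0 p0 le; apply/perm_size/uniq_perm; rewrite ?uniq_gml // => t; rewrite !mem_gml //.
case v: (gvalid t) => //=; case pt: (one_mark q t) => //=; case: eqP => //= gp; case: eqP => //= en.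
have := gedges_one v pt; have := gheight_edges t; rewrite en gp => h1 h2.
by apply/idP/idP=> _; clear -h1 h2 q0 p0 le; lia.
Qed.

Lemma T2_size f n p q : 0 < q -> 0 < p -> 3 * n <= f -> T2 n p q = size (gml q f n p).
Proof.
move=> q0 p0 le; rewrite size_gml_stable // /T2.
have cl (e : 'I_(3 * n)) : #|equivalence_partition (@map_iso2 e) [set MF | is_triangulation2 n p q MF]|
    = if e + p + q == 3 * n then size (gml q (3 * n) n p) else 0.
  case: eqP => [en|ne].
    apply: card_triangulation2_classes; rewrite ?uniq_gml // => t; rewrite mem_gml //.
    case v: (gvalid t) => //=; case pt: (one_mark q t) => //=; case: eqP => //= gp.
    have := gedges_one v pt; have := gheight_edges t; rewrite gp => h1 h2.
    apply/andP/eqP=> [[/eqP e1 _]|e1]; first by move: en; clear -h2 e1; lia.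
    by split; [apply/eqP|]; clear -en h1 h2 e1 p0; lia.
  have -> : [set MF : rooted_map e * _ | is_triangulation2 n p q MF] = finset.set0.
    apply/setP=> M; rewrite finset.in_set finset.in_set0; apply/negP=> /triangulation2_edges; exact: ne.
  apply/eqP; rewrite cards_eq0; apply/eqP/setP=> C; rewrite inE; apply/negP=> /imsetP[x].
  by rewrite inE.
rewrite (eq_bigr _ (fun e _ => cl e)).
have [le3|lt3] := leqP (p + q) (3 * n).
  have lt : 3 * n - (p + q) < 3 * n by clear -le3 p0; lia.
  rewrite (bigD1 (Ordinal lt)) //= big1 ?addn0.
    by case: eqP => // ne; case: ne; clear -le3; lia.
  move=> e ne; case: eqP => // en; case/eqP: ne; apply/val_inj => /=; clear -en; lia.
rewrite big1 => [|e _]; last by case: eqP => // en; exfalso; clear -en lt3; lia.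
case gE: (gml _ _ _ _) => [//|t s]; have : t \in gml q (3 * n) n p by rewrite gE inE eqxx.
rewrite mem_gml // => /and5P[v pt /eqP gp /eqP en _].
by have := gedges_one v pt; rewrite gp en; clear -lt3; lia.
Qed.

Lemma peeling_tree_bound n p r t : is_peeling_tree n p r t -> p + inner_size t <= r + 3 * n.
Proof.
case/and3P=> rt /eqP lp lv; have := label_rule_bound rt.
have -> : leaf_weight t = r + 3 + n * 3.
  by rewrite /leaf_weight (perm_big _ lv) /= big_cons big_nseq iter_addn_0 /= add0n mulnC.
by rewrite lp; clear; lia.
Qed.

Lemma B_size f n p r : 0 < r -> r + 3 * n < f -> B n p r = size (dl r f n p).
Proof.
move=> r0 lt; rewrite /B (gtn_eqF r0).
have -> : [set t | is_peeling_tree n p r t]%classic = [set` [fset t in dl r f n p]%fset]%classic.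
  apply/seteqP; split=> t /=; rewrite inE mem_dl //.
    move=> pt; rewrite pt /=; have := peeling_tree_bound pt; have := lheight_size t.
    by clear -lt; lia.
  by case/andP.
by rewrite set_fsetK card_fseq undup_id // uniq_dl.
Qed.

Lemma T0 p : T 0 p = 0.
Proof. by rewrite (@T_size 0). Qed.

Lemma T_boundary0 n : T n 0 = (n == 1).
Proof. by []. Qed.

(** The extremal maps are plane trees, with both sides of all [n - 1] edges on the boundary. On
    codes, a triangle lowers the label by 1 and a split adds 2 to the sum of the labels. *)
Lemma T_eq0 n p : 2 * n < p + 2 -> T n p = 0.
Proof.
rewrite (@T_size (3 * n)) // => lt; case gE: (gl _ _ _) => [//|t s].
have : t \in gl (3 * n) n p by rewrite gE inE eqxx.
rewrite mem_gl => /and5P[v pt /eqP gp /eqP en _]; rewrite -gp -en in lt.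
suff : glab t + 2 <= 2 * gleaves t by clear -lt; lia.
elim: t v pt {lt gE gp en} => //= [b d t IH /and3P[_ dl v] /and3P[_ /eqP d3 pt]|t1 IH1 t2 IH2 /andP[v1 v2] /andP[p1 p2]].
  by have := IH v pt; subst d; clear; lia.
by have := IH1 v1 p1; have := IH2 v2 p2; clear; lia.
Qed.

Lemma T2_eq0 n p q : 0 < p -> 0 < q -> 3 * n < p + q -> T2 n p q = 0.
Proof.
move=> p0 q0 lt; rewrite (@T2_size (3 * n)) //; case gE: (gml _ _ _ _) => [//|t s].
have : t \in gml q (3 * n) n p by rewrite gE inE eqxx.
rewrite mem_gml // => /and5P[v pt /eqP gp /eqP en _].
by have := gedges_one v pt; rewrite gp en; clear -lt; lia.
Qed.

Lemma B_eq0 n p r : 0 < r -> r + 3 * n < p -> B n p r = 0.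
Proof.
move=> r0 lt; rewrite (@B_size (r + 3 * n).+1) //; case gE: (dl _ _ _ _) => [//|t s].
have : t \in dl r (r + 3 * n).+1 n p by rewrite gE inE eqxx.
by rewrite mem_dl // => /andP[/peeling_tree_bound + _]; clear -lt; lia.
Qed.

(** * Convolutions and the linear peeling recurrence *)

Definition conv (f g : nat -> nat) n := \sum_(0 <= m < n.+1) f m * g (n - m).

Lemma eq_conv f g f' g' n : (forall m, m <= n -> f m = f' m) -> (forall m, m <= n -> g m = g' m) ->
  conv f g n = conv f' g' n.
Proof.
move=> ef eg; rewrite /conv; apply: eq_big_nat => m /andP[_ mn].
by rewrite ef // eg // leq_subr.
Qed.

Lemma convC f g n : conv f g n = conv g f n.
Proof.
rewrite /conv big_nat_rev /=; apply: eq_big_nat => m /andP[_ mn].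
by rewrite add0n subSS mulnC subKn.
Qed.

Lemma convA f g h n : conv f (conv g h) n = conv (conv f g) h n.
Proof.
rewrite /conv; transitivity (\sum_(0 <= m < n.+1) \sum_(0 <= j < n.+1 | m <= j) f m * g (j - m) * h (n - j)).
  apply: eq_big_nat => m /andP[_ mn]; rewrite big_distrr /=.
  rewrite [RHS](_ : _ = \sum_(0 + m <= j < n.+1) f m * g (j - m) * h (n - j)); last first.
    by rewrite add0n [RHS](big_nat_widenl _ 0).
  rewrite big_addn subSn //.
  by apply: eq_big_nat => k _; rewrite mulnA addnK addnC subnDA.
rewrite (exchange_big_dep_nat predT) //=; apply: eq_big_nat => j /andP[_ jn].
by rewrite big_distrl /= [RHS](big_nat_widen _ _ n.+1).
Qed.

Lemma convDl f1 f2 g n : conv (fun m => f1 m + f2 m) g n = conv f1 g n + conv f2 g n.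
Proof. by rewrite /conv -big_split /=; apply: eq_bigr => m _; rewrite mulnDl. Qed.

Lemma convDr f g1 g2 n : conv f (fun m => g1 m + g2 m) n = conv f g1 n + conv f g2 n.
Proof. by rewrite !(convC f) convDl. Qed.

Lemma conv_sumr (f : nat -> nat) (I : Type) (s : seq I) (g : I -> nat -> nat) n :
  conv f (fun m => \sum_(i <- s) g i m) n = \sum_(i <- s) conv f (g i) n.
Proof. by rewrite /conv exchange_big /=; apply: eq_bigr => m _; rewrite big_distrr. Qed.

Lemma conv_suml (f : nat -> nat) (I : Type) (s : seq I) (g : I -> nat -> nat) n :
  conv (fun m => \sum_(i <- s) g i m) f n = \sum_(i <- s) conv (g i) f n.
Proof. by rewrite convC conv_sumr; apply: eq_bigr => i _; rewrite convC. Qed.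

Lemma conv_Zl k f g n : conv (fun m => k * f m) g n = k * conv f g n.
Proof. by rewrite /conv big_distrr /=; apply: eq_bigr => m _; rewrite mulnA. Qed.

Lemma conv0l f g n : (forall m, m <= n -> f m = 0) -> conv f g n = 0.
Proof. by move=> f0; rewrite /conv big_nat big1 // => m /andP[_ mn]; rewrite f0. Qed.

Lemma conv_unitl (b : bool) g n : conv (fun m => (m == 0) && b) g n = b * g n.
Proof.
rewrite /conv big_nat_recl //= subn0 big1 ?addn0 // => m _.
Qed.

(* The effect of one peeling step on the numbers [f p n] of objects with boundary [p] and [n]
   vertices or leaves; the factor 2 is the choice of the side on which a plain piece is split off. *)
Definition peel (f : nat -> nat -> nat) p n :=
  f p.+1 n + 2 * \sum_(0 <= i < p.-1) conv (T^~ i) (f (p - 2 - i)) n.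

(** A piece split off has at least one vertex, as [T 0 i = 0], so the sum only involves values of
    [f] at strictly smaller [n]. *)
Lemma eq_peel f g p n : f p.+1 n = g p.+1 n ->
  (forall j m, m < n -> f j m = g j m) -> peel f p n = peel g p n.
Proof.
move=> e h; rewrite /peel e; congr (_ + 2 * _); apply: eq_bigr => i _.
by rewrite /conv !big_nat_recl // T0 !mul0n !add0n; apply: eq_big_nat => m /andP[_ mn];
  rewrite h // subnSK // leq_subr.
Qed.

(** Induction on [n] and, for fixed [n], downwards on [p] from [K]: a step either lengthens the
    boundary or lowers [n]. Restricting to [n <= N] lets a single [K] serve. *)
Lemma peel_unique (d f g : nat -> nat -> nat) N K :
  (forall p n, 0 < p -> n <= N -> f p n = d p n + peel f p n) ->
  (forall p n, 0 < p -> n <= N -> g p n = d p n + peel g p n) ->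
  (forall n, n <= N -> f 0 n = g 0 n) ->
  (forall p n, n <= N -> K < p -> f p n = g p n) ->
  forall p n, n <= N -> f p n = g p n.
Proof.
move=> fr gr f0 fK p n; elim/ltn_ind: n p => n IHn p nN.
have [k] := ubnP (K.+1 - p); elim: k p => // k IHk p /ltnSE le.
have [->|p0] := posnP p; first exact: f0.
have [Kp|pK] := ltnP K p; first exact: fK.
rewrite fr // gr //; congr (_ + _); apply: eq_peel.
  by apply: IHk; clear -le pK; lia.
by move=> j m mn; apply: IHn => //; apply: leq_trans nN; exact: ltnW.
Qed.

(** Convolution by a series independent of the boundary maps solutions of the recurrence to
    solutions, with the source convolved. *)
Lemma peel_conv f g p n : peel (fun j => conv (f j) g) p n = conv (peel f p) g n.
Proof.
rewrite /peel convDl conv_Zl conv_suml; congr (_ + 2 * _).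
by apply: eq_bigr => i _; rewrite convA.
Qed.

Lemma peel_sum (I : Type) (s : seq I) (f : I -> nat -> nat -> nat) p n :
  peel (fun j m => \sum_(i <- s) f i j m) p n = \sum_(i <- s) peel (f i) p n.
Proof.
rewrite /peel big_split /=; congr (_ + _); rewrite -big_distrr /=; congr (2 * _).
rewrite [RHS]exchange_big /=.
by apply: eq_bigr => i _; rewrite conv_sumr.
Qed.

Lemma peel_add f g p n : peel (fun j m => f j m + g j m) p n = peel f p n + peel g p n.
Proof.
rewrite /peel [RHS]addnACA; congr (_ + _); rewrite -mulnDr -big_split /=; congr (2 * _).
by apply: eq_bigr => i _; rewrite convDr.
Qed.

Lemma sum_cells_conv (f g : nat -> nat -> nat) n p :
  \sum_(0 <= m < n.+1) \sum_(0 <= i < p.-1) f i m * g (p - 2 - i) (n - m)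
  = \sum_(0 <= i < p.-1) conv (f i) (g (p - 2 - i)) n.
Proof. by rewrite exchange_big. Qed.

Lemma sum_conv_rev (f g : nat -> nat -> nat) n p :
  \sum_(0 <= i < p.-1) conv (f i) (g (p - 2 - i)) n
  = \sum_(0 <= i < p.-1) conv (g i) (f (p - 2 - i)) n.
Proof.
rewrite big_nat_rev /=; apply: eq_big_nat => i /andP[_ ip].
by rewrite convC; congr (conv (g _) (f _) n); move: ip; clear; lia.
Qed.

Lemma T_rec n p : 0 < p ->
  T n p = T n p.+1 + \sum_(0 <= i < p.-1) conv (T^~ i) (T^~ (p - 2 - i)) n.
Proof.
move=> p0; rewrite (@T_size (3 * n).+1) // /gl [tlist _ _ _ _ _ _]/= (gtn_eqF p0) -/gl.
rewrite size_cat size_map size_pair_list -T_size //.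
rewrite -(sum_cells_conv (fun i m => T m i) (fun i m => T m i)); congr (_ + _).
apply: eq_big_nat => m /andP[_ mn]; apply: eq_bigr => i _.
by rewrite -!T_size // leq_mul2l /= ?leq_subr // -ltnS.
Qed.

Definition T2b q p n := if p == 0 then 0 else T2 n p q.

Lemma T2b_rec q n p : 0 < q -> 0 < p -> T2b q p n = T n (p + q - 2) + peel (T2b q) p n.
Proof.
move=> q0 p0; rewrite /T2b (gtn_eqF p0) (@T2_size (3 * n).+1) //.
rewrite /gml [mlist _ _ _ _ _ _ _]/= -/(gml q) -/gl /gbase (gtn_eqF p0).
rewrite !size_cat !size_map !size_pair_list -T_size // -T2_size // /peel /=; congr (_ + (_ + _)).
have e m i : m <= n -> size (gml q (3 * n) m i) = if i == 0 then 0 else T2 m i q.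
  move=> mn; have [->|i0] := posnP i; last by rewrite -T2_size ?gtn_eqF // leq_mul2l.
  by case: (3 * n).
have t m i : m <= n -> size (gl (3 * n) m i) = T m i.
  by move=> mn; rewrite -T_size // leq_mul2l.
(* The marked face lies in the second piece or in the first; [sum_conv_rev] exchanges the two
   sums. *)
rewrite mul2n -addnn; congr (_ + _).
  rewrite -(sum_cells_conv (fun i m => T m i) (fun i m => if i == 0 then 0 else T2 m i q)).
  apply: eq_big_nat => m /andP[_ mn]; apply: eq_bigr => i _.
  by rewrite e ?leq_subr // t // -ltnS.
rewrite (sum_conv_rev (fun i m => T m i) (fun i m => if i == 0 then 0 else T2 m i q)).
rewrite -(sum_cells_conv (fun i m => if i == 0 then 0 else T2 m i q) (fun i m => T m i)).
apply: eq_big_nat => m /andP[_ mn]; apply: eq_bigr => i _.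
by rewrite t ?leq_subr // e // -ltnS.
Qed.

(* Unlike [B n p 0], this keeps the peeling recurrence true at [p = 0]. *)
Definition Bb r p n := if r == 0 then n.+1 * T n.+1 p else B n p r.

Lemma Bb_B r p n : 0 < p -> B n p r = Bb r p n.
Proof.
move=> p0; rewrite /Bb /B; case: eqP => // _; case: eqP => // ->.
by rewrite T_eq0 // addn2.
Qed.

Lemma Bb_boundary0 r n : Bb r 0 n = (n == 0) && (r == 0).
Proof.
rewrite /Bb; case: eqP => [_|/eqP r0]; first by rewrite T_boundary0 eqSS andbT; case: eqP => [->|]; rewrite ?muln0.
rewrite (@B_size (r + 3 * n).+1) ?lt0n //; rewrite /dl /= /dbase cats0.
by rewrite [0 == r]eq_sym (negPf r0) !andbF.
Qed.

(** For [r = 0] this is [T_rec] differentiated in the variable that counts vertices: the product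
    rule on the quadratic term yields the factor 2 of [peel]. For other [r] it is read off the
    lists. *)
Lemma Bb_rec r n p : 0 < p -> Bb r p n = ((n == 0) && (p == r)) + peel (Bb r) p n.
Proof.
move=> p0; have [->|r0] := posnP r.
  rewrite (gtn_eqF p0) andbF add0n /Bb /= T_rec // mulnDr /peel; congr (_ + _).
  rewrite big_distrr /= -/(Bb 0).
  pose w i m := m * T m i.
  (* Product rule: [n.+1] is the sum of the indices of the two factors. *)
  have split i j : n.+1 * conv (T^~ i) (T^~ j) n.+1 = conv (w i) (T^~ j) n.+1 + conv (T^~ i) (w j) n.+1.
    rewrite /conv big_distrr -big_split /=; apply: eq_big_nat => m /andP[_ mn].
    have -> : n.+1 = m + (n.+1 - m) by rewrite subnKC // -ltnS.
    by rewrite /w addKn; lia.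
  have shift i j : conv (T^~ i) (w j) n.+1 = conv (T^~ i) (Bb 0 j) n.
    rewrite /conv big_nat_recr //= /w subnn muln0 addn0; apply: eq_big_nat => m /andP[_ mn].
    by rewrite /Bb /= subSn // -ltnS.
  rewrite (eq_bigr _ (fun i _ => split i (p - 2 - i))) big_split /=.
  rewrite (sum_conv_rev w (fun i m => T m i)) addnn -mul2n; congr (2 * _).
  by apply: eq_bigr => i _; exact: shift.
have e f m i : r + 3 * m < f -> size (dl r f m i) = Bb r i m.
  by move=> lt; rewrite /Bb (gtn_eqF r0) -B_size.
pose f := r + 3 * n.+1.
have t m i : m <= n -> size (pl f m i) = T m i.
  by move=> mn; rewrite size_pl -T_size // /f; move: mn; clear; lia.
have e' m i : m <= n -> size (dl r f m i) = Bb r i m.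
  by move=> mn; rewrite e // /f; move: mn; clear; lia.
rewrite -(e f.+1); last by rewrite /f; clear; lia.
rewrite /dl [mlist _ _ _ _ _ _ _]/= -/(dl r) -/pl (gtn_eqF p0).
rewrite !size_cat size_map !size_pair_list e' // /peel /=; congr (_ + (_ + _)).
  by rewrite /dbase; case: ifP.
rewrite mul2n -addnn; congr (_ + _).
  rewrite -(sum_cells_conv (fun i m => T m i) (Bb r)).
  apply: eq_big_nat => m /andP[_ mn]; apply: eq_bigr => i _.
  by rewrite e' ?leq_subr // t // -ltnS.
rewrite (sum_conv_rev (fun i m => T m i) (Bb r)) -(sum_cells_conv (Bb r) (fun i m => T m i)).
apply: eq_big_nat => m /andP[_ mn]; apply: eq_bigr => i _.
by rewrite t ?leq_subr // e' // -ltnS.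
Qed.

Lemma Bb_eq0 r p n : r + 3 * n.+1 < p -> Bb r p n = 0.
Proof.
move=> lt; rewrite /Bb; case: eqP => [_|/eqP r0].
  by rewrite T_eq0 ?muln0 //; move: lt; clear; lia.
by rewrite B_eq0 ?lt0n //; move: lt; clear; lia.
Qed.

(* The labels on the path from the root to the distinguished leaf form a walk whose up-steps are by
   one: it either avoids 1, or goes to 2 and stays above 1 after its last visit to 1. *)
Lemma Bb_last_visit r p n : Bb r.+1 p n =
  (if p == 0 then 0 else Bb r p.-1 n) + conv (Bb 1 p) (Bb r 1) n.
Proof.
pose S p n := if p == 0 then 0 else Bb r p.-1 n; rewrite -/(S p n).
apply: (@peel_unique (fun p n => (n == 0) && (p == r.+1)) (Bb r.+1)
  (fun p n => S p n + conv (Bb 1 p) (Bb r 1) n) n (r.+1 + 3 * n.+1)) => //.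
- by move=> q m q0 _; exact: Bb_rec.
- move=> q m q0 _; rewrite peel_add peel_conv.
  have -> : conv (Bb 1 q) (Bb r 1) m = (q == 1) * Bb r 1 m + conv (peel (Bb 1) q) (Bb r 1) m.
    rewrite -conv_unitl -convDl; apply: eq_conv => // k _; exact: Bb_rec.
  rewrite !addnA; congr (_ + _).
  (* At label 1 the lowered walk has no recurrence of its own: the step from 1 to 2 yields [Bb r 1],
     which the source term of [Bb 1] supplies. Above 1, it is the recurrence of [Bb r] at the label
     lowered by one. *)
  rewrite /peel {1 2}/S /= (gtn_eqF q0); case: q q0 => // -[|q] _ /=.
    by rewrite Bb_boundary0 !big_geq // !addn0 mul1n eqSS [0 == r]eq_sym.
  rewrite mul0n !addn0 eqSS Bb_rec // /peel mul2n -addnn !addnA.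
  suff -> : \sum_(0 <= i < q.+1) conv (T^~ i) (S (q.+2 - 2 - i)) m =
    \sum_(0 <= i < q.+1.-1) conv (T^~ i) (Bb r (q.+1 - 2 - i)) m by [].
  (* The extra last term leaves label 0 on the path, where [S] vanishes. *)
  rewrite [LHS]big_nat_recr //= !subSS subn0 subnn.
  rewrite [X in _ + X](_ : _ = 0); last by rewrite convC conv0l.
  rewrite addn0; apply: eq_big_nat => i /andP[_ iq].
  apply: eq_conv => // k _; rewrite /S; case: eqP => [e|_]; last by congr Bb; move: iq; clear; lia.
  by move: iq e; clear; lia.
- move=> m _; rewrite Bb_boundary0 andbF /S /= conv0l // => k _.
  by rewrite Bb_boundary0 andbF.
- move=> q m mn lt; rewrite Bb_eq0; last by move: lt mn; clear; lia.
  rewrite /S; case: eqP => [e|_]; first by rewrite e in lt.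
  rewrite Bb_eq0; last by move: lt mn; clear; lia.
  by rewrite conv0l // => k km; rewrite Bb_eq0 //; move: lt mn km; clear; lia.
Qed.

(** [r] is the boundary length when the marked face is revealed, and a map of boundary [r + q - 2]
    remains. The range of [r] depends on [N] instead of [n], so that it stays fixed while
    [peel_unique] varies the number of vertices. *)
Lemma T2b_sum q p n N : 0 < q -> n <= N ->
  T2b q p n = \sum_(1 <= r < (2 * N - q).+1) conv (Bb r p) (T^~ (r + q - 2)) n.
Proof.
move=> q0; set K := 2 * N - q.
apply: (@peel_unique (fun p n => T n (p + q - 2)) (T2b q)
  (fun p n => \sum_(1 <= r < K.+1) conv (Bb r p) (T^~ (r + q - 2)) n) N (K.+1 + 3 * N.+1)).
- by move=> p' n' p0 _; exact: T2b_rec.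
- move=> p' n' p0 nN; rewrite peel_sum.
  have e r : conv (Bb r p') (T^~ (r + q - 2)) n' = (p' == r) * T n' (r + q - 2)
      + peel (fun j => conv (Bb r j) (T^~ (r + q - 2))) p' n'.
    rewrite peel_conv -(conv_unitl _ (T^~ (r + q - 2))) -convDl.
    by apply: eq_conv => // k _; exact: Bb_rec.
  rewrite (eq_bigr _ (fun r _ => e r)) big_split /=; congr (_ + _).
  have [pK|Kp] := ltnP p' K.+1.
    rewrite (bigD1_seq p') ?mem_index_iota ?p0 ?iota_uniq //= eqxx mul1n big1 ?addn0 //.
    by move=> r ne; rewrite eq_sym (negPf ne).
  (* Beyond [K] the sum has no source term, but the boundary [p' + q - 2] is then too long for [n']
     vertices. *)
  rewrite T_eq0; last by move: Kp nN; rewrite /K; clear -q0 p0; lia.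
  rewrite big_nat big1 // => r /andP[_ rK].
  by rewrite gtn_eqF //; apply: leq_trans Kp.
- move=> n' _; rewrite big_nat big1 // => r /andP[r1 _].
  by rewrite conv0l // => k _; rewrite Bb_boundary0 (gtn_eqF r1) andbF.
- move=> p' n' nN lt; have p0 : 0 < p' by move: lt; case: p'.
  rewrite /T2b (gtn_eqF p0) T2_eq0 //; last by move: lt nN; clear; lia.
  rewrite big_nat big1 // => r /andP[_ rK].
  by rewrite conv0l // => k km; rewrite Bb_eq0 //; move: lt nN km rK; clear; lia.
Qed.

Theorem mainTheorem6 :
  (forall r p n : nat, 1 <= r -> 1 <= p -> 1 <= n ->
     B n p r = B n (maxn (p - 1) 1) (r - 1)
               + \sum_(0 <= k < n) B k 1 (r - 1) * B (n - k) p 1)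
  /\
  (forall p q n : nat, 1 <= p -> 1 <= q -> 1 <= n ->
     T2 n p q =
       \sum_(1 <= r < (2 * n - q).+1)
         \sum_(0 <= k < (n - (r + q) %/ 2 + 1).+1)
           B k p r * T (n - k) (r + q - 2)).
Proof.
split=> [[|r] p n // _ p1 n1|p q n p1 q1 n1].
  rewrite subSS subn0 !Bb_B ?leq_max ?orbT // Bb_last_visit (gtn_eqF p1) convC /conv big_nat_recr //=.
  rewrite subnn addnCA [RHS]addnC; congr (_ + _).
    by apply: eq_bigr => k _; rewrite !Bb_B.
  (* The term [k = n] of the convolution carries [B 0 p 1], which is 1 for [p = 1] and 0 above. For
     [p = 1] it takes the place of [Bb r 0 n], which is 0 since [n >= 1]; hence the [maxn]. *)
  case: p p1 => // -[|p] _ /=.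
    rewrite Bb_boundary0 (gtn_eqF n1) add0n -[RHS]muln1; congr (_ * _).
    by rewrite Bb_rec // /peel big_geq // -[Bb 1 2 0]Bb_B // B_eq0.
  rewrite -[Bb 1 p.+2 0]Bb_B // B_eq0 // muln0 addn0 subSS subn0.
  by congr Bb; clear; lia.
have -> : T2 n p q = T2b q p n by rewrite /T2b (gtn_eqF p1).
rewrite (T2b_sum p q1 (leqnn n)); apply: eq_big_nat => r /andP[r1 rK].
(* For larger [k], at most [(r + q) %/ 2 - 2] vertices would have to carry a boundary of length
   [r + q - 2], which [T_eq0] excludes. *)
rewrite /conv (@big_cat_nat _ _ _ (n - (r + q) %/ 2 + 1).+1) //=; last first.
  by move: r1 q1 n1 rK; clear; lia.
rewrite [X in _ + X]big_nat [X in _ + X]big1 ?addn0.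
  by apply: eq_bigr => k _; rewrite Bb_B.
move=> k /andP[k1 k2]; rewrite T_eq0 ?muln0 //.
by move: k1 k2 r1 q1 n1 rK; clear; lia.
Qed.
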